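(* Let $\mathbf{u}=\mathbf{u}_n,\mathbf{v}=\mathbf{v}_n\in\mathbb{S}^{n-1}$ be deterministic sequences and $\mathcal{G}=\mathcal{G}_n\sim\mathsf{GOTE}(4,n)$. Suppose $\|\mathbf{u}-\mathbf{v}\|_2=o(1)$ as $n\to\infty$. Then $$\lambda_1(n^{-1/2}\mathcal{G}\cdot\mathbf{u}\otimes\mathbf{v})\xrightarrow{p}\frac{1}{\sqrt3}\Big(\sqrt2+\frac{1}{\sqrt2}\Big).$$
   Context: $\mathcal{G}\sim\mathsf{GOTE}(4,n)$ means that $\mathcal{G}=(\mathcal{G}_{i_1i_2i_3i_4})$ is a random symmetric tensor of order $4$ and dimension $n$ (invariant under permutations of indices in $[n]$) with density proportional to $\exp\big(-\frac18\|\mathcal{G}\|_F^2\big)$, $\|\mathcal{G}\|_F^2=\sum_{i_1,\dots,i_4\in[n]}\mathcal{G}_{i_1i_2i_3i_4}^2$, with respect to Lebesgue measure on the space of symmetric tensors. Equivalently, entries indexed by distinct multisets are independent and $\mathcal{G}_{i_1i_2i_3i_4}\sim\mathcal{N}(0,4/\#\mathrm{Perm}(i_1,\dots,i_4))$, where $\#\mathrm{Perm}$ is the number of distinct rearrangements. $\mathbb{S}^{n-1}$ is the unit sphere of $\mathbb{R}^n$. $\mathcal{G}\cdot\mathbf{u}\otimes\mathbf{v}$ is the $n\times n$ symmetric matrix with $(i,j)$ entry $\sum_{k,l}\mathcal{G}_{ijkl}u_kv_l$. $\lambda_1(A)$ is the largest eigenvalue of the symmetric matrix $A$. *)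

(* Defs.v *)
From HB Require Import structures.
From mathcomp Require Import all_boot all_order all_algebra.
From mathcomp Require Import all_classical all_reals all_analysis.

Set Implicit Arguments.
Unset Strict Implicit.
Unset Printing Implicit Defensive.
Import Order.TTheory GRing.Theory Num.Theory.
Import numFieldNormedType.Exports.
Local Open Scope classical_set_scope.
Local Open Scope ring_scope.

(* The norm `|x| of the library on 'rV[R]_n is the sup norm. *)
Definition l2norm (R : realType) (n : nat) (x : 'rV[R]_n) : R :=
  Num.sqrt (\sum_(i < n) x 0 i ^+ 2).

Definition unit_sphere (R : realType) (n : nat) : set 'rV[R]_n :=
  [set x | l2norm x = 1].

(* For a symmetric matrix with n > 0 the spectrum is finite and nonempty, so
   the supremum is a maximum. *)
Definition lambda1 (R : realType) (n : nat) (A : 'M[R]_n) : R :=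
  sup [set a | eigenvalue A a].

Definition mutually_independent d (T : measurableType d) (R : realType)
    (P : probability T R) (I : finType) (J : {set I})
    (X : I -> {RV P >-> R}) : Prop :=
  forall (K : {set I}) (B : I -> set R),
    K \subset J ->
    (forall i, i \in K -> measurable (B i)) ->
    P (\bigcap_(i in [set` K]) (X i @^-1` B i)) =
    (\prod_(i in K) P (X i @^-1` B i))%E.

Definition has_law d (T : measurableType d) (R : realType)
    (P : probability T R) (X : {RV P >-> R})
    (Q : set R -> \bar R) : Prop :=
  forall B : set R, measurable B -> distribution P X B = Q B.

Definition nperm (n : nat) (s : 4.-tuple 'I_n) : nat :=
  #|[set t : 4.-tuple 'I_n | perm_eq s t]|.

(* An order-4 random tensor is a family of random variables indexed by
   (i1, i2, i3, i4). Two index tuples give the same multiset iff they are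
   related by perm_eq, so independence is required along every set J of index
   tuples representing pairwise distinct multisets. The second parameter of
   normal_prob is the standard deviation. *)
Definition GOTE4 d (T : measurableType d) (R : realType)
    (P : probability T R) (n : nat)
    (G : 4.-tuple 'I_n -> {RV P >-> R}) : Prop :=
  [/\ forall (s t : 4.-tuple 'I_n) (w : T), perm_eq s t -> G s w = G t w,
      forall s : 4.-tuple 'I_n,
        has_law (G s) (normal_prob 0 (Num.sqrt (4 / (nperm s)%:R)))
    & forall J : {set 4.-tuple 'I_n},
        {in J &, forall s t : 4.-tuple 'I_n, perm_eq s t -> s = t} ->
        mutually_independent J G].

Definition contract2 (R : realType) (n : nat) (G : 4.-tuple 'I_n -> R)
    (u v : 'rV[R]_n) : 'M[R]_n :=
  \matrix_(i < n, j < n)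
    \sum_(k < n) \sum_(l < n) G [tuple i; j; k; l] * u 0 k * v 0 l.

Definition cvg_in_probability (d : nat -> measure_display)
    (T : forall n, measurableType (d n)) (R : realType)
    (P : forall n, probability (T n) R) (X : forall n, T n -> R) (c : R)
    : Prop :=
  forall eps : R, 0 < eps ->
    (fun n => P n [set w | eps < `|X n w - c|]) @ \oo --> 0%E.

(* Main.v *)
Require Import Defs.
From HB Require Import structures.
From mathcomp Require Import all_boot all_order all_algebra.
From mathcomp Require Import all_classical all_reals all_analysis.
From mathcomp Require Import measurable_realfun.
From mathcomp Require Import ring lra zify.
From mathcomp Require Import -(notations) mpoly.
Import Order.TTheory GRing.Theory Num.Theory.
Import numFieldNormedType.Exports.
Local Open Scope classical_set_scope.
Local Open Scope ring_scope.
Set Implicit Arguments.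
Unset Strict Implicit.
Unset Printing Implicit Defensive.

(** Let [u] be a unit vector and [H] the matrix [n^(-1/2) G . u (x) u].  Split
    [H] along [u]: a corner [h = u H u^T], a side row [r = u H P] and a block
    [B = P H P], where [P] is the projection onto the complement of [u].
    The corner has variance [4 / n].  The block is a Gaussian orthogonal matrix
    of variance 1/3, with a semicircular spectrum on
    [[-2 / sqrt 3, 2 / sqrt 3]].  The side row is independent of the block and
    has entries of variance [1 / n], not [1 / (3 n)], because the entries of the
    tensor with repeated indices are larger.  By the Schur complement an
    eigenvalue [lam] outside the bulk solves [lam = h + r (lam - B)^-1 r^T],
    which in the limit reads [lam = m lam], with [m] the Stieltjes transform of
    the semicircle, [lam * m = 1 + m^2 / 3].  Hence [lam^2 = 3 / 2], and
    [sqrt (3 / 2)] is beyond the edge [2 / sqrt 3] and equals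
    [(sqrt 2 + 1 / sqrt 2) / sqrt 3].

    The resolvent is replaced by truncated series in the side moments
    [q_k = r B^k r^T].  For a deterministic matrix, [lambda1_gt] and
    [lambda1_upper] locate the largest eigenvalue from finitely many [q_k], from
    [h] and from a bound on the norm of [B]; [stieltjes_le_outlier] and
    [stieltjes_gt_below] are the two halves of the statement that the limiting
    series crosses the diagonal at [sqrt (3 / 2)].  Together they give
    [outlier_window].

    The moments are computed by Gaussian integration by parts, on polynomials
    in the independent entries of the tensor.  This gives a closed recursion for
    the expectations of products of traces [tr B^k] ([schwinger_dyson]) and
    expresses the first two moments of [q_k] through them ([gote_moments]).
    The recursion is used twice.  For fixed exponents it shows that normalised
    traces converge to products of semicircle moments ([norm_traces_cvg]), so
    the variance of [q_k] vanishes.  For exponents of order [log n] it is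
    compared with a sequence whose additional geometric source absorbs all
    corrections of order [1 / n] ([norm_traces_bound]); Markov's inequality for
    [tr B^(2 l)] then keeps the norm of [B] below 1.22, which is less than
    [sqrt (3 / 2)] ([trace_power_small]).

    For two vectors, with [x = (u + v) / 2] and [y = (u - v) / 2], the symmetry
    of the tensor gives [G . u (x) v = G . x (x) x - G . y (x) y].  Both
    terms are multiples of contractions along unit vectors, with coefficients
    [1 - |y|^2] and [|y|^2], so the second one disappears as [|y|] tends to 0
    ([lambda1_perturb]).  Convergence in probability also needs the deviation
    events to be measurable, which holds because the largest eigenvalue is a
    supremum over rational vectors ([measurable_lambda1_dist]). *)

(** * Change of variables with a weight *)

Section transfer.
Local Open Scope ereal_scope.
Context d d' (T : measurableType d) (T' : measurableType d') (R : realType).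
Variables (mu : {measure set T -> \bar R}) (nu : {measure set T' -> \bar R}).
Variables (X : T -> T') (Z : T -> R) (c : R).
Hypotheses (mX : measurable_fun setT X) (mZ : measurable_fun setT Z).
Hypotheses (Z0 : forall x, (0 <= Z x)%R) (c0 : (0 <= c)%R).
Hypothesis muXZ : forall B, measurable B ->
  \int[mu]_x (\1_B (X x) * Z x)%:E = c%:E * nu B.

Import HBNNSimple.

Let transfer_nnsfun (f : {nnsfun T' >-> R}) :
  \int[mu]_x (f (X x) * Z x)%:E = c%:E * \int[nu]_y (f y)%:E.
Proof.
have mterm r : measurable_fun [set: T]
    (EFin \o (fun x => r * \1_(f @^-1` [set r]) (X x) * Z x)%R).
  apply/measurable_EFinP; apply: measurable_funM => //.
  by apply: measurable_funM => //; apply: measurableT_comp.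
under [X in _ = _ * X]eq_integral do rewrite fimfunE -fsumEFin//.
rewrite [X in _ = _ * X]ge0_integral_fsum//; last 2 first.
  - by move=> r; exact/measurable_EFinP/measurableT_comp.
  - by move=> n x _; rewrite EFinM nnfun_muleindic_ge0.
rewrite ge0_mule_fsumr; last first.
  by move=> r; apply: integral_ge0 => x _; rewrite EFinM nnfun_muleindic_ge0.
transitivity (\int[mu]_x (\sum_(r \in range f)
    (r * \1_(f @^-1` [set r]) (X x))%:E * (Z x)%:E)).
  apply: eq_integral => x _; rewrite -ge0_mule_fsuml; last first.
    by move=> r; rewrite EFinM nnfun_muleindic_ge0.
  by rewrite fsumEFin// -(fimfunE _ (X x)).
rewrite ge0_integral_fsum//; last first.
  by move=> r x _; rewrite mule_ge0 ?lee_fin// -lee_fin EFinM nnfun_muleindic_ge0.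
apply: eq_fsbigr => r rr.
have r0 : (0 <= r)%R by move: rr => /set_mem[x _ <-].
under [X in _ = _ * X]eq_integral do rewrite EFinM.
rewrite integralZl_indic_nnsfun// integral_indic// setIT muleCA -muXZ//.
rewrite -ge0_integralZl//.
- by apply: eq_integral => x _; rewrite -!EFinM mulrA.
- apply/measurable_EFinP/measurable_funM => //.
  exact: measurableT_comp.
- by move=> x _; rewrite lee_fin mulr_ge0.
Qed.

(** The hypothesis on indicator functions extends to nonnegative functions by
    simple functions and monotone convergence.  The weight [Z] is what makes
    the lemma reusable: with [Z = 1] it reads an expectation off a law, and
    with [Z] a product of other variables it detaches one independent
    factor. *)
Lemma integral_transfer (f : T' -> R) : measurable_fun setT f ->
  (forall y, (0 <= f y)%R) ->
  \int[mu]_x (f (X x) * Z x)%:E = c%:E * \int[nu]_y (f y)%:E.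
Proof.
move=> mf f0.
have mf' : measurable_fun setT (EFin \o f) by exact/measurable_EFinP.
have f0' x : setT x -> 0 <= (EFin \o f) x by rewrite lee_fin.
pose f_ := nnsfun_approx measurableT mf'.
have f_f y : (f_ n y)%:E @[n --> \oo] --> (f y)%:E.
  by apply: (cvg_nnsfun_approx measurableT mf' f0').
transitivity (lim (\int[mu]_x (f_ n (X x) * Z x)%:E @[n --> \oo])).
  rewrite -monotone_convergence//=.
  - apply: eq_integral => x _; apply/esym/cvg_lim => //=.
    under eq_fun do rewrite EFinM.
    by rewrite EFinM; apply: cvgeZr.
  - move=> n; apply/measurable_EFinP/measurable_funM => //.
    exact: measurableT_comp.
  - by move=> n x _; rewrite lee_fin mulr_ge0.
  - move=> x _ a b ab; rewrite lee_fin ler_wpM2r//.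
    exact/lefP/nd_nnsfun_approx.
rewrite [X in _ = _ * X](_ : _ = lim
    (\int[nu]_y (f_ n y)%:E @[n --> \oo])); last first.
  rewrite -monotone_convergence//=.
  - by apply: eq_integral => x _; apply/esym/cvg_lim.
  - by move=> n; exact/measurable_EFinP.
  - by move=> n x _; rewrite lee_fin.
  - by move=> x _ a b ab; rewrite lee_fin; exact/lefP/nd_nnsfun_approx.
rewrite -limeMl//.
  by apply: congr_lim; apply/funext => n /=; exact: transfer_nnsfun.
apply/ereal_nondecreasing_is_cvgn => x y xy; apply: ge0_le_integral => //=.
- by move=> ? _; rewrite lee_fin.
- exact/measurable_EFinP.
- exact/measurable_EFinP.
- by move=> ? _; rewrite lee_fin; exact/lefP/nd_nnsfun_approx.
Qed.
End transfer.

(** * Moments of centred normal laws *)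

Section normal_moments.
Context (R : realType) (s : R).
Hypothesis s0 : 0 < s.
Local Notation mu := (@lebesgue_measure R).

(** This is the k-th power of [y <= expR y] at [y = x / (c * k)]. *)
Lemma exprn_le_expR (c x : R) k : 0 < c -> 0 <= x ->
  x ^+ k <= (c * k%:R) ^+ k * expR (x / c).
Proof.
move=> c0 x0; have [->|k0] := posnP k.
  by rewrite !expr0 mul1r -expR0 ler_expR divr_ge0// ltW.
have ck0 : 0 < c * k%:R by rewrite mulr_gt0// ltr0n.
rewrite -{1}[x](@divfK _ (c * k%:R)) ?gt_eqF// mulrC exprMn ler_pM2l ?exprn_gt0//.
have -> : x / c = k%:R * (x / (c * k%:R)).
  have kn0 : k%:R != 0 :> R by rewrite pnatr_eq0 -lt0n.
  by field; rewrite kn0 gt_eqF.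
rewrite expRM_natl; apply: lerXn2r; rewrite ?nnegrE ?expR_ge0//.
  by rewrite divr_ge0// ltW.
by rewrite (le_trans _ (expR_ge1Dx _))// lerDr.
Qed.

Definition normal_monomial k (x : R) := x ^+ k * normal_pdf 0 s x.

Lemma measurable_normal_monomial k : measurable_fun setT (normal_monomial k).
Proof.
apply: measurable_funM; last exact: measurable_normal_pdf.
exact: measurable_funX.
Qed.

Lemma normal_pdf0E (x : R) :
  normal_pdf 0 s x = normal_peak s * expR (- x ^+ 2 / (s ^+ 2 *+ 2)).
Proof. by rewrite normal_pdfE ?gt_eqF// /normal_fun subr0. Qed.

(** The exponential excess of a normal density over the one of twice the
    variance absorbs any power, which gives both integrability and decay at
    infinity. *)
Let evenbound k : exists2 C : R, 0 <= C &
  forall x, x ^+ k.*2 * normal_pdf 0 s x <= C * normal_pdf 0 (s * Num.sqrt 2) x.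
Proof.
have ss0 : 0 < s * Num.sqrt 2 by rewrite mulr_gt0// sqrtr_gt0.
have s24 : 0 < s ^+ 2 *+ 4 by rewrite pmulrn_lgt0// exprn_gt0.
(* the exponents of the two densities differ by [x ^+ 2 / (4 * s ^+ 2)] *)
pose C0 := (s ^+ 2 *+ 4 * k%:R) ^+ k.
have C00 : 0 <= C0 by rewrite exprn_ge0// mulr_ge0// ltW.
exists (C0 * normal_peak s / normal_peak (s * Num.sqrt 2)).
  by rewrite divr_ge0 ?mulr_ge0 ?normal_peak_ge0.
move=> x; rewrite normal_pdf0E normal_pdfE ?gt_eqF// /normal_fun subr0.
rewrite [leRHS]mulrA divfK ?gt_eqF ?normal_peak_gt0 ?gt_eqF//.
rewrite mulrCA [C0 * _]mulrC -[leRHS]mulrA; apply: ler_wpM2l.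
  exact: normal_peak_ge0.
rewrite -muln2 mulnC exprM.
apply: (le_trans (ler_wpM2r (expR_ge0 _) (exprn_le_expR k s24 (sqr_ge0 x)))).
rewrite -mulrA -expRD ler_wpM2l// ler_expR exprMn sqr_sqrtr//.
have sn0 : s != 0 by rewrite gt_eqF.
by rewrite le_eqVlt; apply/orP; left; apply/eqP; field.
Qed.

Lemma integrable_normal_monomial k :
  mu.-integrable setT (EFin \o normal_monomial k).
Proof.
have even j : mu.-integrable setT (EFin \o normal_monomial j.*2).
  have [C C0 HC] := evenbound j.
  apply: (@le_integrable _ _ _ mu setT measurableT _
    (fun x => C%:E * (normal_pdf 0 (s * Num.sqrt 2) x)%:E)%E).
  - by apply/measurable_EFinP; exact: measurable_normal_monomial.
  - move=> x _ /=; rewrite lee_fin !ger0_norm//.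
    + exact: HC.
    + by rewrite mulr_ge0// normal_pdf_ge0.
    + rewrite /normal_monomial mulr_ge0 ?normal_pdf_ge0//.
      by rewrite -muln2 mulnC exprM exprn_ge0// sqr_ge0.
  - by apply: integrableZl => //; exact: integrable_normal_pdf.
apply: (@le_integrable _ _ _ mu setT measurableT _
  ((EFin \o normal_monomial 0.*2) \+ (EFin \o normal_monomial k.*2))%E).
- by apply/measurable_EFinP; exact: measurable_normal_monomial.
- move=> x _ /=; rewrite lee_fin /normal_monomial -mulrDl !normrM.
  rewrite (ger0_norm (normal_pdf_ge0 _ _ _)) ler_wpM2r ?normal_pdf_ge0//.
  rewrite expr0 -muln2 exprM; set y := x ^+ k.
  rewrite (ger0_norm (addr_ge0 ler01 (sqr_ge0 y))) -[y ^+ 2]real_normK ?num_real//.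
  have := sqr_ge0 (`|y| - 1); have := normr_ge0 y; set z := `|y|; nra.
- exact: integrableD.
Qed.

Let dmono k (x : R) : is_derive x 1 (normal_monomial k)
  (k%:R * normal_monomial k.-1 x - s ^- 2 * normal_monomial k.+1 x).
Proof.
have -> : normal_monomial k = fun x => x ^+ k *
    (normal_peak s * expR (- x ^+ 2 / (s ^+ 2 *+ 2))).
  by apply/funext => y; rewrite /normal_monomial normal_pdf0E.
rewrite /normal_monomial normal_pdf0E; set e := normal_peak s.
set f := (X in is_derive _ _ X _).
have -> : f = (@id R ^+ k) * (e \*: (expR \o ((- (s ^+ 2 *+ 2)^-1) \*: (@id R ^+ 2)))).
  apply/funext => y; rewrite /f !fctE/= /GRing.scale/= mulNr.
  by rewrite [y ^+ 2 / _]mulrC mulNr.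
apply: is_derive_eq; rewrite /= ?fctE /GRing.scale /= !mulr1.
have sn0 : s != 0 by rewrite gt_eqF.
rewrite !mulNr [_^-1 * _ ^+2]mulrC; set E := expR _.
have -> : x ^+ k.+1 = x ^+ k * x by rewrite exprSr.
by case: k {f} => [|k] /=; field.
Qed.

Let contmono k : continuous (normal_monomial k).
Proof.
by move=> x; apply: differentiable_continuous; apply/derivable1_diffP;
  have [] := dmono k x.
Qed.

(** Integration by parts.  The derivative of [normal_monomial k] is
    [k * normal_monomial k.-1 - s ^- 2 * normal_monomial k.+1], and its
    integral over [-n-1, n+1] is a boundary term that tends to zero.  For
    [k = 0] the coefficient vanishes, so the value at [k.-1 = 0] is
    harmless. *)
Lemma integral_normal_monomialS k :
  Rintegral mu setT (normal_monomial k.+1) =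
  s ^+ 2 * k%:R * Rintegral mu setT (normal_monomial k.-1).
Proof.
pose F' x := k%:R * normal_monomial k.-1 x - s ^- 2 * normal_monomial k.+1 x.
pose a n : R := n.+1%:R.
have intn j : mu.-integrable setT (EFin \o normal_monomial j).
  exact: integrable_normal_monomial.
have iF' : mu.-integrable setT (EFin \o F').
  rewrite (_ : _ \o _ = (fun x => k%:R%:E * (normal_monomial k.-1 x)%:E -
      (s ^- 2)%:E * (normal_monomial k.+1 x)%:E)%E); last by [].
  by apply: integrableB => //; apply: integrableZl => //; exact: intn.
have cF' : continuous F'.
  move=> x; apply: cvgB; (apply: cvgM; first exact: cvg_cst); exact: contmono.
have ftc n : (\int[mu]_(x in `[(- a n)%R, a n]) (F' x)%:E =
    (normal_monomial k (a n) - normal_monomial k (- a n))%R%:E)%E.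
  rewrite EFinB; apply: continuous_FTC2.
  - by apply: (@lt_trans _ _ 0); rewrite ?oppr_lt0 /a ltr0n.
  - by apply: continuous_subspaceT.
  - split.
    + by move=> x _; have [] := dmono k x.
    + by apply: cvg_at_right_filter; exact: contmono.
    + by apply: cvg_at_left_filter; exact: contmono.
  - by move=> x _; rewrite derive1E; have [] := dmono k x.
have iZ c j : mu.-integrable setT (EFin \o (fun x => c * normal_monomial j x)).
  rewrite (_ : _ \o _ = (fun x => c%:E * (normal_monomial j x)%:E)%E)//.
  by apply: integrableZl => //; exact: intn.
have lim0 : (normal_monomial k (a n) - normal_monomial k (- a n)) @[n --> \oo] --> (0 : R).
  have [C C0 HC] := evenbound k.+1.
  pose C1 := C * normal_peak (s * Num.sqrt 2).
  have H1 n (x : R) : `|x| = a n -> `|normal_monomial k x| <= C1 * (harmonic n).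
    move=> xa; have a1 : 1 <= a n by rewrite ler1n.
    have x0 : 0 < `|x| by rewrite xa (lt_le_trans ltr01).
    rewrite /normal_monomial normrM normrX (ger0_norm (normal_pdf_ge0 _ _ _)).
    rewrite (_ : harmonic n = (a n)^-1)// ler_pdivlMr ?(lt_le_trans ltr01)//.
    apply: (@le_trans _ _ (x ^+ k.+1.*2 * normal_pdf 0 s x)).
      rewrite mulrAC ler_wpM2r ?normal_pdf_ge0// -xa -exprSr.
      have -> : x ^+ k.+1.*2 = `|x| ^+ k.+1.*2.
        by rewrite -normrX ger0_norm // -muln2 mulnC exprM exprn_ge0 ?sqr_ge0.
      by apply: ler_weXn2l; rewrite ?xa// -addnn leq_addr.
    apply: (le_trans (HC x)); rewrite ler_wpM2l// normal_pdf_ub// gt_eqF//.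
    by rewrite mulr_gt0// sqrtr_gt0.
  apply/norm_cvg0P.
  apply: (@squeeze_cvgr _ _ _ _ (cst 0) (fun n => (C1 *+ 2) * harmonic n)).
  - apply: nearW => n; rewrite normr_ge0/=.
    rewrite (le_trans (ler_normB _ _))// mulrnAl mulr2n.
    have an : `|a n| = a n by rewrite ger0_norm// ler0n.
    by rewrite lerD// H1// normrN.
  - exact: cvg_cst.
  - rewrite -[X in _ --> X](mulr0 (C1 *+ 2)); apply: cvgMr.
    exact: cvg_harmonic.
have limI : (\int[mu]_(x in `[(- a n)%R, a n]) (F' x)%:E @[n --> \oo] -->
    \int[mu]_x (F' x)%:E)%E.
  under eq_fun do rewrite integral_mkcond.
  apply: (@dominated_cvg _ _ _ mu setT measurableT _ _ (fun x => `|(F' x)%:E|%E)).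
  - move=> n; apply/(measurable_restrictT _ _).1 => //.
    apply: measurable_funTS; exact: (measurable_int _ iF').
  - move=> x _; apply: cvg_near_cst; near=> n.
    rewrite patchE mem_set//= in_itv/= -ler_norml.
    near: n; exists (Num.bound `|x|) => // n /= xn.
    by rewrite /a (le_trans (ltW (archi_boundP _)))// ler_nat leqW.
  - by [].
  - exact: integrable_abse.
  - move=> n x _; rewrite patchE; case: ifPn => // _.
    by rewrite abse0.
have I0 : (\int[mu]_x (F' x)%:E = 0)%E.
  apply: cvg_unique limI _ => //.
  rewrite (_ : (fun n => _) = EFin \o (fun n =>
    normal_monomial k (a n) - normal_monomial k (- a n))); last first.
    by apply/funext => n; exact: ftc.
  by apply: cvg_EFin => //; exact: nearW.
have : Rintegral mu setT F' = 0 by rewrite /Rintegral I0.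
rewrite /F' RintegralB//.
rewrite !RintegralZl// => /eqP; rewrite subr_eq0 => /eqP H.
rewrite -mulrA H mulrA divff ?mul1r// expf_neq0// gt_eqF//.
Unshelve. all: by end_near. Qed.

Section normal_law.
Context d (T : measurableType d) (P : probability T R) (X : {RV P >-> R}).
Hypothesis XN : has_law X (normal_prob 0 s).

Let ge0_integral_normal_law (f : R -> R) : measurable_fun setT f ->
  (forall x, 0 <= f x) ->
  (\int[P]_w (f (X w))%:E = \int[mu]_x (f x * normal_pdf 0 s x)%:E)%E.
Proof.
move=> mf f0.
have mX : measurable_fun setT X by exact: measurable_funP.
transitivity (\int[normal_prob 0 s]_x (f x)%:E)%E.
  rewrite -[RHS]mul1e -(@integral_transfer _ _ T (measurableTypeR R) R P
    (normal_prob 0 s) X (cst 1) 1) //.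
    by under [RHS]eq_integral do rewrite mulr1.
  move=> B mB; rewrite mul1e -[RHS](XN (B := B))// /distribution /pushforward.
  rewrite -[X in P X]setIT -integral_indic//; last first.
    by rewrite -[_ @^-1` _]setTI; exact: mX.
  by apply: eq_integral => w _; rewrite mulr1.
rewrite -[LHS]mul1e; apply/esym.
apply: (@integral_transfer _ _ _ _ R mu (normal_prob 0 s) id _ 1) => //.
- exact: measurable_normal_pdf.
- by move=> x; exact: normal_pdf_ge0.
- move=> B mB; rewrite mul1e /normal_prob [RHS]integral_mkcond.
  apply: eq_integral => x _; rewrite patchE indicE.
  by case: ifPn => _; rewrite ?mul1r ?mul0r.
Qed.

Let integrable_normal_law (f : R -> R) : measurable_fun setT f -> (forall x, 0 <= f x) ->
  mu.-integrable setT (EFin \o (fun x => f x * normal_pdf 0 s x)) ->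
  P.-integrable setT (EFin \o (f \o X)).
Proof.
move=> mf f0 /integrableP[_ fi]; apply/integrableP; split.
  by apply/measurable_EFinP; exact: measurableT_comp.
under eq_integral do rewrite /= ger0_norm//.
rewrite ge0_integral_normal_law//.
under eq_integral do rewrite -[_ * _]ger0_norm ?mulr_ge0 ?normal_pdf_ge0//.
exact: fi.
Qed.

(** The transfer lemma needs nonnegative functions, so [x ^+ k] is written as
    the difference of [1 + x ^+ (2 * k) + x ^+ k] and [1 + x ^+ (2 * k)]. *)
Lemma integral_normal_law k :
  P.-integrable setT (EFin \o (fun w => X w ^+ k)) /\
  \int[P]_w (X w ^+ k) = \int[mu]_x normal_monomial k x.
Proof.
pose q (x : R) := 1 + (x ^+ k) ^+ 2; pose p x := q x + x ^+ k.
have q0 x : 0 <= q x by rewrite addr_ge0// sqr_ge0.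
have p0 x : 0 <= p x by rewrite /p /q; set y := x ^+ k; nra.
have mq : measurable_fun setT q.
  by apply: measurable_funD => //; do 2 apply: measurable_funX.
have mp : measurable_fun setT p.
  by apply: measurable_funD => //; apply: measurable_funX.
have qE : (fun x => q x * normal_pdf 0 s x) =
    fun x => normal_monomial 0 x + normal_monomial (k * 2) x.
  by apply/funext => x; rewrite /q /normal_monomial exprM mulrDl.
have pE : (fun x => p x * normal_pdf 0 s x) =
    fun x => (q x * normal_pdf 0 s x) + normal_monomial k x.
  by apply/funext => x; rewrite /p mulrDl.
have iq : mu.-integrable setT (EFin \o (fun x => q x * normal_pdf 0 s x)).
  by rewrite qE; apply: (integrableD _ (integrable_normal_monomial _) (integrable_normal_monomial _)).
have ip : mu.-integrable setT (EFin \o (fun x => p x * normal_pdf 0 s x)).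
  by rewrite pE; apply: (integrableD _ iq (integrable_normal_monomial _)).
have iqX := integrable_normal_law mq q0 iq.
have ipX := integrable_normal_law mp p0 ip.
have XE : (fun w => X w ^+ k) = (fun w => p (X w) - q (X w)).
  by apply/funext => w; rewrite /p addrC addKr.
have mE : normal_monomial k =
    (fun x => p x * normal_pdf 0 s x - q x * normal_pdf 0 s x).
  by apply/funext => w; rewrite -mulrBl /p addrC addKr.
split; first by rewrite XE; exact: (integrableB _ ipX iqX).
rewrite XE RintegralB// mE RintegralB//.
by congr (_ - _); rewrite /Rintegral ge0_integral_normal_law.
Qed.

End normal_law.
End normal_moments.

(** * Expectation of a product of independent variables *)

Section independent_product.
Context d (T : measurableType d) (R : realType) (P : probability T R).
Context (I : finType) (J : {set I}) (X : I -> {RV P >-> R}).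
Hypothesis indepX : mutually_independent J X.

Definition has_mean (i : I) (f : R -> R) (e : R) : Prop :=
  [/\ measurable_fun setT f, P.-integrable setT (EFin \o (f \o X i)) &
      \int[P]_w f (X i w) = e].

Let mX i : measurable_fun setT (X i).
Proof. exact: measurable_funP. Qed.

Let mXB i B : measurable B -> measurable (X i @^-1` B).
Proof. by move=> mB; rewrite -[_ @^-1` _]setTI; exact: mX. Qed.

Let mprod (f : I -> R -> R) (Q : pred I) :
  (forall i, Q i -> measurable_fun setT (f i)) ->
  measurable_fun setT (fun w => \prod_(i | Q i) f i (X i w)).
Proof.
move=> mf; rewrite (_ : (fun _ => _) = fun w => \prod_(i <- index_enum I)
    (if Q i then f i (X i w) else 1)); last first.
  by apply/funext => w; rewrite big_mkcond.
apply: measurable_prod => i _; case: (boolP (Q i)) => // Qi.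
by apply: measurableT_comp => //; exact: mf.
Qed.

Let indic_mean i (B : set R) : measurable B ->
  has_mean i (\1_B : R -> R) (fine (P (X i @^-1` B))).
Proof.
move=> mB; have mi : measurable_fun setT (\1_B \o X i : T -> R).
  by apply: measurableT_comp => //; exact: measurable_indic.
split; first exact: measurable_indic.
- apply/integrableP; split; first exact/measurable_EFinP.
  apply: (@le_lt_trans _ _ (\int[P]_w (cst 1%:E w))%E).
    apply: ge0_le_integral => //=.
    + by do 2 apply: measurableT_comp => //.
    + by move=> w _; rewrite lee_fin indicE; case: (_ \in _); rewrite ?normr1 ?normr0.
  by rewrite integral_cst// mul1e (le_lt_trans (probability_le1 _ _))// ltry.
- rewrite /Rintegral -[in RHS](setIT (_ @^-1` _)) -integral_indic//.
  exact: mXB.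
Qed.

Let prod_indic (B : I -> set R) (f : I -> R -> R) (e : I -> R) :
  (forall i, i \in J -> has_mean i (f i) (e i)) ->
  (forall i, i \in J -> measurable (B i) /\ f i = \1_(B i)) ->
  (\int[P]_w (\prod_(i in J) f i (X i w))%:E = (\prod_(i in J) e i)%:E)%E.
Proof.
move=> fe fB.
have mB i : i \in J -> measurable (B i) by move=> /fB[].
have eE i : i \in J -> (e i)%:E = P (X i @^-1` B i).
  move=> iJ; have [_ _ <-] := fe _ iJ; have [mBi ->] := fB _ iJ.
  by have [_ _ ->] := indic_mean i mBi; rewrite fineK// fin_num_measure//; exact: mXB.
rewrite -prodEFin; transitivity (\prod_(i in J) P (X i @^-1` B i))%E; last first.
  by apply: eq_bigr => i iJ; rewrite eE.
rewrite -indepX// -[X in P X]setIT -integral_indic//; last first.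
  apply: fin_bigcap_measurable => [|i iJ]; first exact: finite_finpred.
  by apply: mXB; exact: mB.
apply: eq_integral => w _; congr EFin; rewrite indicE.
have [wB|wB] := boolP (w \in _).
  rewrite big1// => i iJ; have [_ ->] := fB _ iJ.
  by rewrite indicE mem_set//; move/set_mem : wB => /(_ i iJ).
move: wB => /negP wB; have [i iJ iB] : exists2 i, i \in J & ~ B i (X i w).
  apply: contrapT => H; apply: wB; rewrite inE => i iJ.
  by apply: contrapT => nB; apply: H; exists i.
rewrite (bigD1 i)//=; have [_ ->] := fB _ iJ.
by rewrite indicE memNset// mul0r.
Qed.

(** The definition of independence is the case of indicator functions.  The
    coordinates in [r] are those already allowed to be arbitrary nonnegative
    functions; [integral_transfer] frees one more coordinate at a time. *)
Let ge0_prod (r : seq I) (f : I -> R -> R) (e : I -> R) :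
  (forall i, i \in J -> has_mean i (f i) (e i) /\ forall x, 0 <= f i x) ->
  (forall i, i \in J -> i \notin r -> exists2 B, measurable B & f i = \1_B) ->
  (\int[P]_w (\prod_(i in J) f i (X i w))%:E = (\prod_(i in J) e i)%:E)%E.
Proof.
elim: r f e => [|a r IH] f e fe fB.
  have H i : exists B, i \in J -> measurable B /\ f i = \1_B.
    have [iJ|_] := boolP (i \in J); last by exists set0.
    by have [|B mB fiB] := fB i iJ; [by []|exists B].
  have [B HB] := choice H.
  by apply: (prod_indic (B := B)) => // i iJ; have [] := fe i iJ.
have [aJ|aJ] := boolP (a \in J); last first.
  apply: IH => // i iJ ir; apply: fB => //; rewrite inE negb_or ir andbT.
  by apply: contraNneq aJ => <-.
rewrite (bigD1 a)//=.
under eq_integral do rewrite (bigD1 a)//=.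
have [[mfa ia ea] fa0] := fe a aJ.
have f0 i : i \in J -> forall x, 0 <= f i x by move=> /fe[].
have e0 i : i \in J -> 0 <= e i.
  by move=> iJ; have [[_ _ <-] fi0] := fe i iJ; apply: Rintegral_ge0.
rewrite (@integral_transfer _ _ _ _ _ P (distribution P (X a)) (X a)
  (fun w => \prod_(i in J | i != a) f i (X i w)) (\prod_(i in J | i != a) e i))//.
- rewrite EFinM muleC; congr (_ * _)%E.
  rewrite (@ge0_integral_distribution _ _ _ _ _ P (X a) (EFin \o f a))//.
    by rewrite -ea /Rintegral fineK//; exact: integrable_fin_num.
  exact/measurable_EFinP.
- by apply: mprod => i /andP[/fe[[]]].
- by move=> w; apply: prodr_ge0 => i /andP[/f0].
- move=> B mB.
  pose f' i := if i == a then \1_B else f i.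
  pose e' i := if i == a then fine (P (X a @^-1` B)) else e i.
  have fa' : f' a = \1_B by rewrite /f' eqxx.
  have ea' : e' a = fine (P (X a @^-1` B)) by rewrite /e' eqxx.
  have fE w : \prod_(i in J | i != a) f' i (X i w) =
              \prod_(i in J | i != a) f i (X i w).
    by apply: eq_bigr => i /andP[_ ia0]; rewrite /f' (negbTE ia0).
  have eE : \prod_(i in J | i != a) e' i = \prod_(i in J | i != a) e i.
    by apply: eq_bigr => i /andP[_ ia0]; rewrite /e' (negbTE ia0).
  have := IH f' e'; rewrite [in X in (_ -> _ -> _ = X) -> _](bigD1 a aJ)/= ea' eE.
  under eq_integral do rewrite (bigD1 a)//= fa' fE.
  move=> -> //.
  + rewrite EFinM muleC fineK//; exact: fin_num_measure (mXB _ mB).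
  + move=> i iJ; rewrite /f' /e'; case: eqP => [->|_]; last exact: fe.
    by split; [exact: indic_mean|move=> x; rewrite indicE].
  + move=> i iJ ir; rewrite /f'; case: eqP => [_|/eqP ia0]; first by exists B.
    by apply: fB => //; rewrite inE negb_or ia0.
Qed.

Definition has_ge0_mean i (f : R -> R) e := has_mean i f e /\ forall x, 0 <= f x.

(** Signed functions are carried as differences of nonnegative ones, so that
    integrability of a product never has to be known before its integral. *)
Definition has_diff_mean i (f : R -> R) e := exists p q ep eq,
  [/\ has_ge0_mean i p ep, has_ge0_mean i q eq, f = (fun x => p x - q x) &
     e = ep - eq].

(** The same induction once more: the coordinates in [r] may be signed, and
    expanding one difference leaves two products with one fewer signed
    factor. *)
Let diff_prod (r : seq I) (f : I -> R -> R) (e : I -> R) :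
  (forall i, i \in J -> if i \in r then has_diff_mean i (f i) (e i)
                        else has_ge0_mean i (f i) (e i)) ->
  P.-integrable setT (EFin \o (fun w => \prod_(i in J) f i (X i w))) /\
  \int[P]_w (\prod_(i in J) f i (X i w)) = \prod_(i in J) e i.
Proof.
elim: r f e => [|a r IH] f e fe.
  have fe' i : i \in J -> has_ge0_mean i (f i) (e i) by move=> /fe.
  have f0 w : 0 <= \prod_(i in J) f i (X i w).
    by apply: prodr_ge0 => i /fe'[].
  have fint : (\int[P]_w (\prod_(i in J) f i (X i w))%:E = (\prod_(i in J) e i)%:E)%E.
    apply: (@ge0_prod (index_enum I)) => // i _.
    by rewrite mem_index_enum.
  split; last by rewrite /Rintegral fint.
  apply/integrableP; split.
    by apply/measurable_EFinP/mprod => i /fe'[[]].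
  under eq_integral do rewrite /= ger0_norm//.
  by rewrite fint ltry.
have [ar|ar] := boolP (a \in r).
  apply: IH => i /fe; rewrite inE; case: eqP => // -> .
  by rewrite ar.
have [aJ|aJ] := boolP (a \in J); last first.
  apply: IH => i iJ; move: (fe i iJ); rewrite inE.
  by have [ia|//] := eqVneq i a; rewrite -ia iJ in aJ.
have := fe a aJ; rewrite mem_head => -[p [q [ep [eq [hp hq faE eaE]]]]].
pose upd g i := if i == a then g else f i.
pose upe (g : R) i := if i == a then g else e i.
have H g eg : has_ge0_mean a g eg -> forall i, i \in J ->
    if i \in r then has_diff_mean i (upd g i) (upe eg i)
               else has_ge0_mean i (upd g i) (upe eg i).
  move=> hg i iJ; rewrite /upd /upe; have [->|ia] := eqVneq i a.
    by rewrite (negbTE ar).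
  by have := fe i iJ; rewrite inE (negbTE ia).
have [ip Ip] := IH _ _ (H _ _ hp); have [iq Iq] := IH _ _ (H _ _ hq).
have updE g w : \prod_(i in J) upd g i (X i w) =
    g (X a w) * \prod_(i in J | i != a) f i (X i w).
  rewrite (bigD1 a)//= {1}/upd eqxx; congr (_ * _).
  by apply: eq_bigr => i /andP[_ ia]; rewrite /upd (negbTE ia).
have upeE g : \prod_(i in J) upe g i = g * \prod_(i in J | i != a) e i.
  rewrite (bigD1 a)//= {1}/upe eqxx; congr (_ * _).
  by apply: eq_bigr => i /andP[_ ia]; rewrite /upe (negbTE ia).
have fE : (fun w => \prod_(i in J) f i (X i w)) =
   (fun w => \prod_(i in J) upd p i (X i w) - \prod_(i in J) upd q i (X i w)).
  by apply/funext => w; rewrite !updE (bigD1 a)//= faE mulrBl.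
rewrite fE; split; first exact: (integrableB _ ip iq).
by rewrite RintegralB// Ip Iq !upeE -mulrBl -eaE -bigD1.
Qed.

Lemma integral_prod_independent (f : I -> R -> R) (e : I -> R) :
  (forall i, i \in J -> has_diff_mean i (f i) (e i)) ->
  P.-integrable setT (EFin \o (fun w => \prod_(i in J) f i (X i w))) /\
  \int[P]_w (\prod_(i in J) f i (X i w)) = \prod_(i in J) e i.
Proof.
move=> fe; apply: (@diff_prod (index_enum I)) => i iJ.
by rewrite mem_index_enum; exact: fe.
Qed.

Lemma monomial_diff_mean i k :
  P.-integrable setT (EFin \o (fun w => X i w ^+ k)) ->
  P.-integrable setT (EFin \o (fun w => X i w ^+ (k * 2))) ->
  has_diff_mean i (fun x => x ^+ k) (\int[P]_w (X i w ^+ k)).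
Proof.
move=> ik i2k.
pose q (x : R) := 1 + (x ^+ k) ^+ 2; pose p x := q x + x ^+ k.
have q0 x : 0 <= q x by rewrite addr_ge0// sqr_ge0.
have p0 x : 0 <= p x by rewrite /p /q; set y := x ^+ k; nra.
have mq : measurable_fun setT q.
  by apply: measurable_funD => //; do 2 apply: measurable_funX.
have mp : measurable_fun setT p.
  by apply: measurable_funD => //; apply: measurable_funX.
have iq : P.-integrable setT (EFin \o (q \o X i)).
  rewrite (_ : q \o X i = (fun w => 1 + X i w ^+ (k * 2))); last first.
    by apply/funext => w /=; rewrite exprM.
  have i1 : P.-integrable setT (EFin \o (cst 1 : T -> R)).
    exact: finite_measure_integrable_cst.
  exact: (integrableD _ i1 i2k).
have ip : P.-integrable setT (EFin \o (p \o X i)) by exact: (integrableD _ iq ik).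
exists p, q, (\int[P]_w p (X i w)), (\int[P]_w q (X i w)); split => //.
- by apply/funext => x; rewrite /p addrC addKr.
- by rewrite -RintegralB//; apply: eq_Rintegral => w _; rewrite /p addrC addKr.
Qed.

End independent_product.

(** * Gaussian expectation of polynomials *)

Section gaussian_polynomials.
Context d (T : measurableType d) (R : realType) (P : probability T R).
Context (N : nat) (X : 'I_N -> {RV P >-> R}) (sd : 'I_N -> R).
Hypothesis indepX : mutually_independent [set: 'I_N]%SET X.
Hypothesis sd0 : forall i, 0 < sd i.
Hypothesis lawX : forall i, has_law (X i) (normal_prob 0 (sd i)).

Local Notation S := (mpoly.mpoly N R).
Definition poly_eval (w : T) : S -> R := mpoly.meval (fun i => X i w).

(** Representing random variables by polynomials in the independent entries
    turns their derivatives into formal ones, and the expectation into a linear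
    functional on an algebra. *)
Definition poly_mean (p : S) : R := \int[P]_w poly_eval w p.

Let moment i k : R := \int[P]_w (X i w ^+ k).

Let momentSS i k : moment i k.+1 = sd i ^+ 2 * k%:R * moment i k.-1.
Proof.
rewrite /moment (integral_normal_law (sd0 i) (lawX i) k.+1).2.
by rewrite (integral_normal_law (sd0 i) (lawX i) k.-1).2 integral_normal_monomialS.
Qed.

Let monomial_eval w m : poly_eval w (mpoly.mpolyX R m) = \prod_i X i w ^+ m i.
Proof. exact: mpoly.mevalX. Qed.

Let monomial_mean m :
  P.-integrable setT (EFin \o (fun w => poly_eval w (mpoly.mpolyX R m))) /\
  poly_mean (mpoly.mpolyX R m) = \prod_i moment i (m i).
Proof.
rewrite /poly_mean.
have -> : (fun w => poly_eval w (mpoly.mpolyX R m)) =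
    (fun w => \prod_(i in [set: 'I_N]%SET) X i w ^+ m i).
  by apply/funext => w; rewrite monomial_eval; apply: eq_bigl => i; rewrite inE.
have -> : \prod_i moment i (m i) = \prod_(i in [set: 'I_N]%SET) moment i (m i).
  by apply: eq_bigl => i; rewrite inE.
apply: (integral_prod_independent indepX (f := fun i x => x ^+ m i)) => i _.
by apply: monomial_diff_mean;
  apply: (integral_normal_law (sd0 i) (lawX i) _).1.
Qed.

Lemma integrable_poly p : P.-integrable setT (EFin \o (fun w => poly_eval w p)).
Proof.
elim/mpoly.mpolyind: p => [|c m p _ _ IH].
  rewrite (_ : _ \o _ = cst 0%E); first exact: integrable0.
  by apply/funext => w /=; rewrite /poly_eval mpoly.meval0.
rewrite (_ : _ \o _ = (fun w => c%:E * (poly_eval w (mpoly.mpolyX R m))%:E +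
    (poly_eval w p)%:E)%E); last first.
  by apply/funext => w /=; rewrite /poly_eval mpoly.mevalD mpoly.mevalZ.
apply: integrableD => //; apply: integrableZl => //.
exact: (monomial_mean m).1.
Qed.

Lemma poly_mean_linear c p q :
  poly_mean (c *: p + q) = c * poly_mean p + poly_mean q.
Proof.
rewrite /poly_mean; under eq_Rintegral do
  rewrite /poly_eval mpoly.mevalD mpoly.mevalZ.
have iZ := integrableZl measurableT c (integrable_poly p).
rewrite RintegralD//; last exact: integrable_poly.
by rewrite RintegralZl//; exact: integrable_poly.
Qed.

Lemma poly_mean1 : poly_mean 1 = 1.
Proof.
rewrite /poly_mean; under eq_Rintegral do rewrite /poly_eval mpoly.meval1.
by rewrite Rintegral_cst//= mul1r probability_setT.
Qed.

Lemma poly_mean0 : poly_mean 0 = 0.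
Proof.
by rewrite /poly_mean; under eq_Rintegral do rewrite /poly_eval mpoly.meval0;
  rewrite Rintegral_cst// mul0r.
Qed.

(** Gaussian integration by parts.  By linearity and independence it reduces
    to monomials, hence to the recursion between the moments of one normal
    variable. *)
Lemma poly_mean_ibp i p :
  poly_mean (mpoly.mpolyX R (mpoly.mnm1 i) * p) =
  sd i ^+ 2 * poly_mean (mpoly.mderiv i p).
Proof.
elim/mpoly.mpolyind: p => [|c m p _ _ IH].
  by rewrite mulr0 mpoly.mderiv0 poly_mean0 mulr0.
rewrite mulrDr -scalerAr poly_mean_linear IH mpoly.mderivD mpoly.mderivZ.
rewrite poly_mean_linear mulrDr; congr (_ + _).
rewrite mulrCA; congr (_ * _).
rewrite -mpoly.mpolyXD (monomial_mean _).2 mpoly.mderivX.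
rewrite -[_ *: _]addr0 poly_mean_linear poly_mean0 addr0 (monomial_mean _).2.
rewrite (bigD1 i)//= [in RHS](bigD1 i)//= mpoly.mnmDE mpoly.mnmBE mpoly.mnm1E.
rewrite eqxx add1n subn1 momentSS !mulrA; congr (_ * _).
apply: eq_bigr => j ji; rewrite mpoly.mnmDE mpoly.mnmBE mpoly.mnm1E eq_sym.
by rewrite (negbTE ji) add0n subn0.
Qed.
End gaussian_polynomials.

(** * Schwinger-Dyson equations for a split Gaussian matrix *)

Section derivations.
Context (R : realFieldType) (S : comAlgType R).

Definition derivation (D : S -> S) : Prop :=
  (forall c p q, D (c *: p + q) = c *: D p + D q) /\
  (forall p q, D (p * q) = D p * q + p * D q).

Variable D : S -> S.
Hypothesis derD : derivation D.

Lemma derivationD p q : D (p + q) = D p + D q.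
Proof. by have := derD.1 1 p q; rewrite !scale1r. Qed.

Lemma derivation0 : D 0 = 0.
Proof. by apply: (addrI (D 0)); rewrite -derivationD !addr0. Qed.

Lemma derivationZ c p : D (c *: p) = c *: D p.
Proof. by have := derD.1 c p 0; rewrite derivation0 !addr0. Qed.

Lemma derivation1 : D 1 = 0.
Proof.
have := derD.2 1 1; rewrite !mulr1 mul1r => /esym/eqP.
by rewrite -subr_eq0 addrK => /eqP.
Qed.

Lemma derivation_scalar c : D c%:A = 0.
Proof. by rewrite derivationZ derivation1 scaler0. Qed.

Lemma derivation_sum I r (Q : pred I) (F : I -> S) :
  D (\sum_(i <- r | Q i) F i) = \sum_(i <- r | Q i) D (F i).
Proof. exact: (big_morph D derivationD derivation0). Qed.

Lemma derivation_mulmx m n p (M : 'M[S]_(m, n)) (M' : 'M[S]_(n, p)) :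
  map_mx D (M *m M') = map_mx D M *m M' + M *m map_mx D M'.
Proof.
apply/matrixP => i j; rewrite !mxE derivation_sum -big_split /=.
by apply: eq_bigr => k _; rewrite !mxE derD.2.
Qed.

Lemma derivation_scalar_mx m n (M : 'M[R]_(m, n)) :
  map_mx D (map_mx (in_alg S) M) = 0.
Proof. by apply/matrixP => i j; rewrite !mxE derivation_scalar. Qed.

Lemma derivation_trace n (M : 'M[S]_n) : D (\tr M) = \tr (map_mx D M).
Proof. by rewrite /mxtrace derivation_sum; apply: eq_bigr => i _; rewrite mxE. Qed.

End derivations.

Definition dotv (R : pzSemiRingType) (n : nat) (x y : 'rV[R]_n) : R := (x *m y^T) 0 0.

Section dot_product.
Context (R : comPzRingType) (n : nat).
Implicit Types x y z : 'rV[R]_n.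

Lemma dotvE x y : dotv x y = \sum_i x 0 i * y 0 i.
Proof. by rewrite /dotv mxE; apply: eq_bigr => i _; rewrite mxE. Qed.

Lemma dotv_mx x y : x *m y^T = (dotv x y)%:M.
Proof. by rewrite [LHS]mx11_scalar. Qed.

Lemma dotvC x y : dotv x y = dotv y x.
Proof. by rewrite /dotv -[in LHS](trmxK x) -trmx_mul mxE. Qed.

Lemma dotvDl x y z : dotv (x + y) z = dotv x z + dotv y z.
Proof. by rewrite /dotv mulmxDl mxE. Qed.

Lemma dotvZl (a : R) x y : dotv (a *: x) y = a * dotv x y.
Proof. by rewrite /dotv -scalemxAl mxE. Qed.

Lemma dotvNl x y : dotv (- x) y = - dotv x y.
Proof. by rewrite /dotv mulNmx mxE. Qed.

Lemma dotvDr x y z : dotv x (y + z) = dotv x y + dotv x z.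
Proof. by rewrite dotvC dotvDl !(dotvC _ x). Qed.

Lemma dotvZr (a : R) x y : dotv x (a *: y) = a * dotv x y.
Proof. by rewrite dotvC dotvZl dotvC. Qed.

Lemma dotvNr x y : dotv x (- y) = - dotv x y.
Proof. by rewrite dotvC dotvNl dotvC. Qed.

Lemma dotv_mulmx (m : nat) x (M : 'M[R]_(n, m)) (y : 'rV[R]_m) :
  dotv (x *m M) y = dotv x (y *m M^T).
Proof. by rewrite /dotv trmx_mul trmxK mulmxA. Qed.

End dot_product.

(** For the contraction [H] of a symmetric Gaussian quartic form by [u] twice,
    [form_cov u x y z w] is proportional to the covariance of [x H y^T] and
    [z H w^T].  On the complement of [u] only the first term survives, the
    covariance of a Gaussian orthogonal matrix of variance 1/3; with
    [x = z = u] and [y], [w] orthogonal to [u] the value is [dotv y w], three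
    times as much.  This excess is what creates the outlier. *)
Definition form_cov (R : realFieldType) (n : nat) (u x y z w : 'rV[R]_n) : R :=
  3^-1 * (dotv x z * dotv y w + dotv x w * dotv y z) +
  2 / 3 * (dotv x u * dotv z u * dotv y w + dotv x u * dotv w u * dotv y z +
           dotv y u * dotv z u * dotv x w + dotv y u * dotv w u * dotv x z +
           dotv x u * dotv y u * dotv z u * dotv w u).

Definition sform (R : realFieldType) (S : comAlgType R) n (H : 'M[S]_n) (x y : 'rV[R]_n) : S :=
  (map_mx (in_alg S) x *m H *m (map_mx (in_alg S) y)^T) 0 0.

(** Orthogonal projection onto the complement of a unit vector [u]. *)
Definition oproj (R : pzRingType) n (u : 'rV[R]_n) : 'M[R]_n := 1%:M - u^T *m u.

Section oproj.
Context (R : realFieldType) (n : nat) (u : 'rV[R]_n).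
Hypothesis u1 : dotv u u = 1.
Local Notation P := (oproj u).

Lemma oproj_tr : P^T = P.
Proof. by rewrite /oproj linearB /= trmx1 trmx_mul trmxK. Qed.

Lemma mul_oproj : u *m P = 0.
Proof. by rewrite /oproj mulmxBr mulmx1 mulmxA dotv_mx u1 mul1mx subrr. Qed.

Lemma oproj_idem : P *m P = P.
Proof.
by rewrite {1}/oproj mulmxBl mul1mx -mulmxA mul_oproj mulmx0 subr0.
Qed.

Lemma dotv_row_oproj p : dotv (row p P) u = 0.
Proof.
by rewrite dotvC /dotv tr_row oproj_tr colE mulmxA mul_oproj mul0mx mxE.
Qed.

Lemma dotv_rows_oproj p q : dotv (row p P) (row q P) = P p q.
Proof.
rewrite /dotv tr_row oproj_tr !rowE colE -mulmxA (mulmxA P) oproj_idem.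
by rewrite mulmxA -rowE -colE !mxE.
Qed.
End oproj.

Section schwinger_dyson.
Context (R : realFieldType) (S : comAlgType R) (E : S -> R).
Hypothesis E_linear : forall c p q, E (c *: p + q) = c * E p + E q.
Context (n : nat) (u : 'rV[R]_n) (H : 'M[S]_n).
Context (D : 'rV[R]_n -> 'rV[R]_n -> S -> S) (kappa : R).
Hypothesis u1 : dotv u u = 1.
Hypothesis Hsym : H^T = H.
Hypothesis derD : forall x y, derivation (D x y).
Hypothesis E_ibp : forall x y F, E (sform H x y * F) = E (D x y F).
Hypothesis D_form : forall x y z w,
  D x y (sform H z w) = (kappa * form_cov u x y z w)%:A.

Local Notation P := (oproj u).
Local Notation PS := (map_mx (in_alg S) (oproj u)).

Lemma E_add p q : E (p + q) = E p + E q.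
Proof. by have := E_linear 1 p q; rewrite scale1r mul1r. Qed.

Lemma E_zero : E 0 = 0.
Proof. by apply: (addrI (E 0)); rewrite -E_add !addr0. Qed.

Lemma E_scale c p : E (c *: p) = c * E p.
Proof. by have := E_linear c p 0; rewrite E_zero !addr0. Qed.

Lemma E_sum I r (Q : pred I) (F : I -> S) :
  E (\sum_(i <- r | Q i) F i) = \sum_(i <- r | Q i) E (F i).
Proof. exact: (big_morph E E_add E_zero). Qed.

Definition comp_mx : 'M[S]_n := PS *m H *m PS.
(** The zeroth power is the projection and not the identity, so every power
    lives on the complement of [u] and the powers multiply without
    exception. *)
Definition comp_pow k : 'M[S]_n := iter k (mulmx comp_mx) PS.
Definition comp_tr k : S := \tr (comp_pow k).
Local Notation B := comp_mx.
Local Notation Bp := comp_pow.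

Lemma PS_tr : PS^T = PS.
Proof. by rewrite map_trmx oproj_tr. Qed.

Lemma PS_idem : PS *m PS = PS.
Proof. by rewrite -map_mxM oproj_idem. Qed.

Lemma comp_mx_tr : B^T = B.
Proof. by rewrite /comp_mx !trmx_mul Hsym PS_tr mulmxA. Qed.

Lemma comp_mxP : B *m PS = B.
Proof. by rewrite /comp_mx -[LHS]mulmxA PS_idem. Qed.

Lemma comp_Pmx : PS *m B = B.
Proof. by rewrite /comp_mx !mulmxA PS_idem. Qed.

Lemma comp_powS k : Bp (k.+1) = B *m Bp k.
Proof. by []. Qed.

Lemma comp_powD a b : Bp a *m Bp b = Bp (a + b).
Proof.
elim: a => [|a IH]; last by rewrite addSn !comp_powS -IH mulmxA.
case: b => [|b]; first exact: PS_idem.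
by rewrite add0n comp_powS mulmxA comp_Pmx.
Qed.

Lemma comp_pow_tr k : (Bp k)^T = Bp k.
Proof.
elim: k => [|k IH]; first exact: PS_tr.
rewrite comp_powS trmx_mul IH comp_mx_tr -{1}comp_mxP -[PS]/(Bp 0).
by rewrite -[B *m Bp 0]/(Bp 1) comp_powD addn1.
Qed.

Lemma comp_powPl k : PS *m Bp k = Bp k. Proof. by rewrite -[PS]/(Bp 0) comp_powD. Qed.
Lemma comp_powPr k : Bp k *m PS = Bp k.
Proof. by rewrite -[PS]/(Bp 0) comp_powD addn0. Qed.

Lemma comp_mxE p q : B p q = sform H (row p P) (row q P).
Proof.
rewrite /sform !map_row tr_row PS_tr -row_mul /comp_mx !colE mulmxA -!colE.
by rewrite -row_mul !mxE.
Qed.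

Lemma comp_pow_absorb a b (M : 'M[S]_n) :
  Bp a *m (PS *m M *m PS) *m Bp b = Bp a *m M *m Bp b.
Proof. by rewrite !mulmxA comp_powPr -!mulmxA comp_powPl. Qed.

(** Integration by parts against the entry [(p, q)] of the block [B]. *)
Definition comp_der p q : S -> S := D (row p P) (row q P).
Local Notation dB := comp_der.

Lemma comp_derE p q i j : dB p q (B i j) =
  (kappa / 3 * (P p i * P q j + P p j * P q i))%:A.
Proof.
rewrite comp_mxE /dB D_form /form_cov !dotv_row_oproj// !dotv_rows_oproj//.
by rewrite !(mul0r, mulr0, addr0) mulrA.
Qed.

Lemma comp_ibp p q F : E (B p q * F) = E (dB p q F).
Proof. by rewrite comp_mxE E_ibp. Qed.

Lemma comp_der_pow p q k : map_mx (dB p q) (Bp k) =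
  \sum_(a < k) Bp a *m map_mx (dB p q) B *m Bp (k.-1 - a).
Proof.
have derpq : derivation (dB p q) by exact: derD.
elim: k => [|k IH]; first by rewrite big_ord0 [LHS]derivation_scalar_mx.
have PdB : PS *m map_mx (dB p q) B = map_mx (dB p q) B.
  rewrite -[in RHS]comp_Pmx (derivation_mulmx derpq PS B) derivation_scalar_mx// mul0mx.
  by rewrite add0r.
rewrite comp_powS (derivation_mulmx derpq B (Bp k)) IH big_ord_recl subn0 -[Bp 0]/PS PdB.
congr (_ + _); rewrite mulmx_sumr; apply: eq_bigr => a _.
rewrite lift0 comp_powS !mulmxA; congr (_ *m Bp _).
by case: k {IH} a => [[]//|k] a /=; rewrite subSS.
Qed.

Let mul_delta_mx_entry (M N : 'M[S]_n) p q i j :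
  (M *m delta_mx p q *m N) i j = M i p * N q j.
Proof.
rewrite !mxE (bigD1 q)//= big1 ?addr0; last first.
  move=> k kq; rewrite !mxE big1 ?mul0r// => l _.
  by rewrite mxE (negbTE kq) andbF mulr0.
congr (_ * _); rewrite !mxE (bigD1 p)//= big1 ?addr0; last first.
  by move=> k kp; rewrite mxE (negbTE kp) mulr0.
by rewrite mxE !eqxx mulr1.
Qed.

Let trace_mul_delta (M : 'M[S]_n) p q : \tr (M *m delta_mx p q) = M q p.
Proof.
rewrite -[_ *m delta_mx p q]mulmx1 /mxtrace.
under eq_bigr do rewrite mul_delta_mx_entry mxE.
rewrite (bigD1 q)//= eqxx mulr1 big1 ?addr0// => i iq.
by rewrite eq_sym (negbTE iq) mulr0.
Qed.

Let tr_mul_sum (M N : 'M[S]_n) : \tr (M *m N) = \sum_i \sum_j M i j * N j i.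
Proof. by apply: eq_bigr => i _; rewrite mxE. Qed.

Let scE (c : S) (M : 'M[S]_n) i j : (c *: M) i j = c * M i j.
Proof. by rewrite mxE. Qed.

Let adE (M N : 'M[S]_n) i j : (M + N) i j = M i j + N i j.
Proof. by rewrite mxE. Qed.

(** Up to the factor [kappa / 3], an entry of the block is dual to the
    symmetrised matrix unit compressed to the complement of [u], exactly as for
    a Gaussian orthogonal matrix. *)
Lemma comp_der_mx p q : map_mx (dB p q) B =
  (kappa / 3)%:A *: (PS *m (delta_mx p q + delta_mx q p) *m PS).
Proof.
have PC i j : P i j = P j i by rewrite -[in LHS]oproj_tr mxE.
apply/matrixP => i j; rewrite scE mulmxDr mulmxDl adE !mul_delta_mx_entry.
have PSE i' j' : PS i' j' = (P i' j')%:A by rewrite mxE.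
rewrite mxE comp_derE !PSE !mulr_algl !scalerA -!scalerDl.
by rewrite scalerA (PC i p) (PC i q) [_ * P p j]mulrC.
Qed.

Lemma comp_der_tr p q k :
  dB p q (comp_tr k) = (2 * k%:R * kappa / 3) *: (Bp (k.-1)) p q.
Proof.
have derpq : derivation (dB p q) by exact: derD.
rewrite /comp_tr derivation_trace// comp_der_pow linear_sum /=.
transitivity (\sum_(a < k) \tr (Bp (k.-1) *m map_mx (dB p q) B)).
  apply: eq_bigr => a _; rewrite mxtrace_mulC mulmxA comp_powD.
  by case: k a => [[]//|k] a /=; rewrite subnK// -ltnS.
rewrite sumr_const card_ord comp_der_mx -scalemxAr linearZ /=.
rewrite !mulmxA mxtrace_mulC !mulmxA comp_powPl comp_powPr mulmxDr linearD /=.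
rewrite !trace_mul_delta -{1}comp_pow_tr mxE.
set b := (Bp k.-1) p q; rewrite -mulr2n mulr_natl -scalerAl mul1r.
rewrite -scaler_nat -[b *+ 2]scaler_nat !scalerA; congr (_ *: _).
by field.
Qed.

(** Differentiating [B ^ k] cuts the closed word tr(B * B ^ k) at a second
    place.  The two terms of the symmetrised matrix unit either split the word
    into two traces or reconnect it into one. *)
Lemma sum_comp_der_pow k : \sum_p \sum_q dB p q ((Bp k) q p) =
  (kappa / 3) *: \sum_(a < k) (comp_tr a * comp_tr (k.-1 - a) + comp_tr k.-1).
Proof.
transitivity (\sum_p \sum_q \sum_(a < k)
    (Bp a *m map_mx (dB p q) B *m Bp (k.-1 - a)) q p).
  apply: eq_bigr => p _; apply: eq_bigr => q _.
  rewrite (_ : dB p q _ = (map_mx (dB p q) (Bp k)) q p); last by rewrite mxE.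
  by rewrite comp_der_pow summxE.
transitivity (\sum_(a < k) \sum_p \sum_q (kappa / 3) *:
    ((Bp a) q p * (Bp (k.-1 - a)) p q + (Bp a) q q * (Bp (k.-1 - a)) p p)).
  rewrite exchange_big; under eq_bigr do rewrite exchange_big.
  rewrite exchange_big; apply: eq_bigr => a _.
  rewrite exchange_big; apply: eq_bigr => p _; apply: eq_bigr => q _.
  rewrite comp_der_mx -scalemxAr -scalemxAl scE mulr_algl; congr (_ *: _).
  rewrite comp_pow_absorb mulmxDr mulmxDl adE.
  rewrite !mul_delta_mx_entry; congr (_ * _ + _).
  by rewrite -[in LHS]comp_pow_tr mxE.
rewrite scaler_sumr; apply: eq_bigr => a _.
under eq_bigr do rewrite -scaler_sumr.
rewrite -scaler_sumr; congr (_ *: _).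
under eq_bigr do rewrite big_split /=.
rewrite big_split /= addrC; congr (_ + _).
  under eq_bigr do rewrite -mulr_suml.
  by rewrite -mulr_sumr.
have akE : comp_tr k.-1 = comp_tr (a + (k.-1 - a))%N.
  by congr comp_tr; case: k a => [[]//|k] a /=; rewrite subnKC// -ltnS.
by rewrite akE /comp_tr -comp_powD tr_mul_sum exchange_big.
Qed.

Lemma comp_tr0 : comp_tr 0 = (n%:R - 1)%:A.
Proof.
rewrite -[comp_tr 0]/(\tr PS) trace_map_mx; congr (_%:A).
rewrite /oproj linearB /= mxtrace1 mxtrace_mulC; congr (_ - _).
by rewrite -u1 /mxtrace big_ord1.
Qed.

Definition comp_traces (ks : seq nat) : S := \prod_(k <- ks) comp_tr k.

Lemma comp_traces_nil : E (comp_traces [::]) = E 1.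
Proof. by rewrite /comp_traces big_nil. Qed.

Lemma comp_traces_cons k ks :
  comp_traces (k :: ks) = comp_tr k * comp_traces ks.
Proof. by rewrite /comp_traces big_cons. Qed.

Let comp_derivation p q : derivation (dB p q).
Proof. exact: derD. Qed.

(** When tr(B * B ^ k) * F is integrated by parts, the derivatives that fall
    on [F] assemble into this first-order operator. *)
Let grad k (F : S) := \sum_p \sum_q (Bp k) q p * dB p q F.

Let grad_mul k F G : grad k (F * G) = grad k F * G + F * grad k G.
Proof.
rewrite /grad mulr_suml mulr_sumr -big_split /=; apply: eq_bigr => p _.
rewrite mulr_suml mulr_sumr -big_split /=; apply: eq_bigr => q _.
by rewrite (comp_derivation _ _).2; ring.
Qed.

Let grad_tr k j : grad k (comp_tr j) = (2 * j%:R * kappa / 3) *: comp_tr (k + j.-1).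
Proof.
transitivity ((2 * j%:R * kappa / 3) *: \tr (Bp k *m Bp j.-1)); last first.
  by rewrite comp_powD.
rewrite tr_mul_sum exchange_big scaler_sumr; apply: eq_bigr => p _.
rewrite scaler_sumr; apply: eq_bigr => q _.
by rewrite comp_der_tr -scalerAr.
Qed.

Let grad_1 k : grad k 1 = 0.
Proof.
rewrite /grad big1// => p _; rewrite big1// => q _.
by rewrite (derivation1 (comp_derivation _ _)) mulr0.
Qed.

Definition omit (ks : seq nat) i := take i ks ++ drop i.+1 ks.

Lemma grad_traces k ks : grad k (comp_traces ks) =
  \sum_(i < size ks) (2 * (nth 0%N ks i)%:R * kappa / 3) *:
     comp_traces ((k + (nth 0%N ks i).-1)%N :: omit ks i).
Proof.
elim: ks => [|j ks IH]; first by rewrite big_ord0 /comp_traces big_nil grad_1.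
rewrite comp_traces_cons grad_mul grad_tr IH big_ord_recl /=; congr (_ + _).
  by rewrite /omit /= ?drop0 comp_traces_cons scalerAl.
rewrite mulr_sumr; apply: eq_bigr => i _.
by rewrite -scalerAr /= /omit /= !comp_traces_cons mulrCA.
Qed.

(** One factor [B] of the first trace is integrated by parts.  The derivative
    hits another factor of the same trace, which gives the sum over [a], or a
    factor of the trace number [i], which merges the two words. *)
Lemma schwinger_dyson k ks :
  E (comp_traces (k.+1 :: ks)) =
  kappa / 3 * \sum_(a < k) (E (comp_traces [:: nat_of_ord a, (k.-1 - a)%N & ks]) +
                            E (comp_traces (k.-1 :: ks))) +
  \sum_(i < size ks) 2 * (nth 0%N ks i)%:R * kappa / 3 *
     E (comp_traces ((k + (nth 0%N ks i).-1)%N :: omit ks i)).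
Proof.
rewrite comp_traces_cons /comp_tr comp_powS tr_mul_sum mulr_suml E_sum.
transitivity (E (\sum_p \sum_q dB p q ((Bp k) q p) * comp_traces ks +
                 grad k (comp_traces ks))).
  rewrite /grad -big_split /= E_sum; apply: eq_bigr => p _.
  rewrite mulr_suml -big_split /= !E_sum; apply: eq_bigr => q _.
  by rewrite -mulrA comp_ibp (comp_derivation _ _).2.
rewrite E_add grad_traces; congr (_ + _); last first.
  by rewrite E_sum; apply: eq_bigr => i _; rewrite E_scale.
under eq_bigr do rewrite -mulr_suml.
rewrite -mulr_suml sum_comp_der_pow -scalerAl E_scale; congr (_ * _).
rewrite mulr_suml E_sum; apply: eq_bigr => a _.
by rewrite mulrDl E_add !comp_traces_cons mulrA.
Qed.

(** The part of the row [u *m H] that couples [u] to its complement. *)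
Definition side_row : 'rV[S]_n := map_mx (in_alg S) u *m H *m PS.
Definition side_moment k : S := (side_row *m Bp k *m side_row^T) 0 0.
Local Notation r := side_row.

Let ds p : S -> S := D u (row p P).

Let ds_derivation p : derivation (ds p).
Proof. exact: derD. Qed.

Let side_rowE p : r 0 p = sform H u (row p P).
Proof.
rewrite /sform !map_row tr_row PS_tr /side_row !colE mulmxA -!colE.
by rewrite !mxE.
Qed.

Let scE' m' (c : S) (M : 'M[S]_(n, m')) i j : (c *: M) i j = c * M i j.
Proof. by rewrite mxE. Qed.

Let ds_row p q : ds p (r 0 q) = (kappa * P p q)%:A.
Proof.
rewrite side_rowE /ds D_form /form_cov !dotv_row_oproj// !dotv_rows_oproj//.
rewrite [dotv u (row _ _)]dotvC !dotv_row_oproj// u1 !(mul0r, mulr0, addr0, mul1r).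
by congr (_ * _)%:A; field.
Qed.

(** The side row is uncorrelated with the block [B], so below it behaves as a
    Gaussian vector independent of [B]. *)
Let ds_comp p : map_mx (ds p) B = 0.
Proof.
apply/matrixP => i j; rewrite mxE comp_mxE /ds D_form /form_cov [RHS]mxE.
rewrite !dotv_row_oproj// ![dotv u (row _ _)]dotvC !dotv_row_oproj//.
by rewrite !(mul0r, mulr0, addr0) scale0r.
Qed.

Let ds_pow p k : map_mx (ds p) (Bp k) = 0.
Proof.
elim: k => [|k IH]; first by rewrite [LHS](derivation_scalar_mx (ds_derivation p)).
rewrite comp_powS (derivation_mulmx (ds_derivation p) B (Bp k)) IH ds_comp.
by rewrite mul0mx mulmx0 addr0.
Qed.

Let ds_tr p k : ds p (comp_tr k) = 0.
Proof.
by rewrite /comp_tr (derivation_trace (ds_derivation p)) ds_pow linear0.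
Qed.

Let ds_mul_row p (M : 'M[S]_n) : map_mx (ds p) M = 0 -> M *m PS = M ->
  map_mx (ds p) (M *m r^T) = kappa%:A *: col p M.
Proof.
move=> dM MP; rewrite (derivation_mulmx (ds_derivation p)) dM mul0mx add0r.
have -> : map_mx (ds p) r^T = kappa%:A *: col p PS.
  apply/matrixP => q i; rewrite ord1 mxE [r^T _ _]mxE ds_row scE'.
  rewrite [col _ _ _ _]mxE [X in _ = _ * X]mxE /= mulr_algl scalerA; congr (_ * _)%:A.
  by rewrite -[in LHS]oproj_tr mxE.
by rewrite -scalemxAr !colE mulmxA MP.
Qed.

Let side_ibp k F : E (side_moment k * F) =
  kappa * E (comp_tr k * F) + \sum_p E ((Bp k *m r^T) p 0 * ds p F).
Proof.
rewrite /side_moment -mulmxA mxE mulr_suml E_sum.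
transitivity (\sum_p (E ((kappa%:A * (Bp k) p p) * F) +
    E ((Bp k *m r^T) p 0 * ds p F))).
  apply: eq_bigr => p _; rewrite -mulrA side_rowE E_ibp -/(ds p).
  rewrite (ds_derivation p).2 E_add; congr (E (_ * _) + _).
  have /matrixP/(_ p 0) := ds_mul_row (ds_pow p k) (comp_powPr k).
  by rewrite mxE => ->; rewrite scE' mxE.
rewrite big_split /=; congr (_ + _).
under eq_bigr do rewrite mulr_algl -scalerAl E_scale.
by rewrite -mulr_sumr -E_sum -mulr_suml.
Qed.

Lemma mean_side_moment k : E (side_moment k) = kappa * E (comp_tr k).
Proof.
rewrite -[side_moment k]mulr1 side_ibp mulr1 big1 ?addr0// => p _.
by rewrite (derivation1 (ds_derivation p)) mulr0 E_zero.
Qed.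

(** The four copies of the side row are paired in three ways: one pairing gives
    the square of the trace, the two others the trace of the square. *)
Lemma mean_sqr_side_moment k : E (side_moment k * side_moment k) =
  kappa ^+ 2 * (E (comp_tr k * comp_tr k) + 2 * E (comp_tr (k + k))).
Proof.
have Eqt : E (comp_tr k * side_moment k) = kappa * E (comp_tr k * comp_tr k).
  rewrite mulrC side_ibp big1 ?addr0// => p _.
  by rewrite ds_tr mulr0 E_zero.
rewrite side_ibp Eqt.
have dsq p : ds p (side_moment k) = (2 * kappa) *: (Bp k *m r^T) p 0.
  rewrite /side_moment -mulmxA mxE (derivation_sum (ds_derivation p)).
  transitivity (\sum_j (kappa * P p j) *: (Bp k *m r^T) j 0 +
      \sum_j r 0 j * (kappa%:A * (Bp k) j p)).
    rewrite -big_split; apply: eq_bigr => j _ /=.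
    rewrite (ds_derivation p).2 ds_row; congr (_ + _ * _); first by rewrite mulr_algl.
    have /matrixP/(_ j 0) := ds_mul_row (ds_pow p k) (comp_powPr k).
    by rewrite mxE => ->; rewrite scE' mxE.
  have -> : \sum_j (kappa * P p j) *: (Bp k *m r^T) j 0 = kappa *: (Bp k *m r^T) p 0.
    under eq_bigr do rewrite -scalerA; rewrite -scaler_sumr; congr (_ *: _).
    rewrite -[in RHS]comp_powPl -mulmxA mxE; apply: eq_bigr => j _.
    by rewrite [in RHS]mxE mulr_algl.
  have -> : \sum_j r 0 j * (kappa%:A * (Bp k) j p) = kappa *: (Bp k *m r^T) p 0.
    under eq_bigr do rewrite mulr_algl -scalerAr; rewrite -scaler_sumr; congr (_ *: _).
    rewrite mxE; apply: eq_bigr => j _; rewrite mulrC -[in LHS]comp_pow_tr.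
    by rewrite mxE [r^T _ _]mxE.
  by rewrite -scalerDl; congr (_ *: _); ring.
under eq_bigr do rewrite dsq -scalerAr E_scale.
rewrite -mulr_sumr -E_sum.
have -> : \sum_p (Bp k *m r^T) p 0 * (Bp k *m r^T) p 0 = side_moment (k + k).
  rewrite /side_moment -comp_powD mulmxA -mulmxA mxE; apply: eq_bigr => p _.
  by congr (_ * _); rewrite -[in LHS]comp_pow_tr -trmx_mul mxE.
by rewrite mean_side_moment; ring.
Qed.

Lemma mean_sqr_diag : E (sform H u u * sform H u u) = 4 * kappa * E 1.
Proof.
by rewrite E_ibp D_form /form_cov !u1 E_scale; congr (_ * _); field.
Qed.

End schwinger_dyson.

(** * Contraction of a symmetric quartic form *)

Section quartic_polarization.
Context (R : realFieldType) (S : comAlgType R) (E : S -> R).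
Hypothesis E_linear : forall c p q, E (c *: p + q) = c * E p + E q.
Context (n : nat) (g : 'I_n -> 'I_n -> 'I_n -> 'I_n -> S).
Hypothesis g12 : forall i j k l, g i j k l = g j i k l.
Hypothesis g23 : forall i j k l, g i j k l = g i k j l.
Hypothesis g34 : forall i j k l, g i j k l = g i j l k.

Let scale_in_alg (c : R) (p : S) : c *: p = in_alg S c * p.
Proof. by rewrite mulr_algl. Qed.

Definition quartic (x y z w : 'rV[R]_n) : S :=
  \sum_i \sum_j \sum_k \sum_l (x 0 i * y 0 j * z 0 k * w 0 l) *: g i j k l.

Context (Dq : 'rV[R]_n -> S -> S).
Hypothesis Dq_derivation : forall x, derivation (Dq x).
Hypothesis Dq_ibp : forall x F, E (quartic x x x x * F) = E (Dq x F).
Hypothesis Dq_g : forall x i j k l,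
  Dq x (g i j k l) = (4 * (x 0 i * x 0 j * x 0 k * x 0 l))%:A.

Let q12 x y z w : quartic x y z w = quartic y x z w.
Proof.
rewrite /quartic exchange_big; apply: eq_bigr => i _; apply: eq_bigr => j _.
apply: eq_bigr => k _; apply: eq_bigr => l _.
by rewrite g12; congr (_ *: _); ring.
Qed.

Let q23 x y z w : quartic x y z w = quartic x z y w.
Proof.
apply: eq_bigr => i _; rewrite exchange_big; apply: eq_bigr => j _.
apply: eq_bigr => k _; apply: eq_bigr => l _.
by rewrite g23; congr (_ *: _); ring.
Qed.

Let q34 x y z w : quartic x y z w = quartic x y w z.
Proof.
apply: eq_bigr => i _; apply: eq_bigr => j _.
rewrite exchange_big; apply: eq_bigr => k _; apply: eq_bigr => l _.
by rewrite g34; congr (_ *: _); ring.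
Qed.

Let q1 (c : R) x x' y z w :
  quartic (x + c *: x') y z w = quartic x y z w + c%:A * quartic x' y z w.
Proof.
rewrite /quartic mulr_algl !scaler_sumr -big_split; apply: eq_bigr => i _ /=.
rewrite scaler_sumr -big_split; apply: eq_bigr => j _ /=.
rewrite scaler_sumr -big_split; apply: eq_bigr => k _ /=.
rewrite scaler_sumr -big_split; apply: eq_bigr => l _ /=.
by rewrite scalerA -scalerDl !mxE; congr (_ *: _); ring.
Qed.

Let q2 (c : R) x x' y z w :
  quartic y (x + c *: x') z w = quartic y x z w + c%:A * quartic y x' z w.
Proof. by rewrite q12 q1 [quartic x _ _ _]q12 [quartic x' _ _ _]q12. Qed.

Let q3 (c : R) x x' y z w :
  quartic y z (x + c *: x') w = quartic y z x w + c%:A * quartic y z x' w.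
Proof. by rewrite q23 q2 [quartic _ x _ _]q23 [quartic _ x' _ _]q23. Qed.

Let q4 (c : R) x x' y z w :
  quartic y z w (x + c *: x') = quartic y z w x + c%:A * quartic y z w x'.
Proof. by rewrite q34 q3 [quartic _ _ x _]q34 [quartic _ _ x' _]q34. Qed.

Let quart (c : R) z u : let v := z + c *: u in let C : S := c%:A in
  quartic v v v v = quartic z z z z + 4 * C * quartic z z z u +
    6 * C ^+ 2 * quartic z z u u + 4 * C ^+ 3 * quartic z u u u +
    C ^+ 4 * quartic u u u u.
Proof.
move=> v C; rewrite /v q1 !q2 !q3 !q4 -/C.
rewrite (q34 z z u z) (q23 z u z z) (q34 z z u z) (q12 u z z z) (q23 z u z z) (q34 z z u z).
rewrite (q23 z u z u) (q34 z u u z) (q23 z u z u).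
rewrite (q12 u z z u) (q23 z u z u) (q12 u z u z) (q34 z u u z) (q23 z u z u).
rewrite (q23 u u z z) (q12 u z u z) (q34 z u u z) (q23 z u z u).
rewrite (q12 u z u u) (q23 u u z u) (q12 u z u u) (q34 u u u z) (q23 u u z u) (q12 u z u u).
ring.
Qed.

Let scale1A (x : 'rV[R]_n) y : x + y = x + 1 *: y. Proof. by rewrite scale1r. Qed.
Let scaleN1A (x : 'rV[R]_n) y : x - y = x + (-1) *: y. Proof. by rewrite scaleN1r. Qed.

Local Notation A4 v := (quartic v v v v).

(** Integration by parts is available for the values of the quartic form on the
    diagonal.  Its value at [(x, y, u, u)] is recovered from six of them, by
    polarising first in [x], [y] and then against [u]. *)
Lemma quartic_polarization x y u : 48 * quartic x y u u =
  A4 (x + y + u) + A4 (x + y - u) - 2 * A4 (x + y)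
  - A4 (x - y + u) - A4 (x - y - u) + 2 * A4 (x - y).
Proof.
have H z : A4 (z + u) + A4 (z - u) = 2 * A4 z + 12 * quartic z z u u + 2 * A4 u.
  by rewrite [z + u]scale1A scaleN1A !quart scaleN1r scale1r; ring.
have H2 : quartic (x + y) (x + y) u u - quartic (x - y) (x - y) u u = 4 * quartic x y u u.
  rewrite [x + y]scale1A scaleN1A !q1 !q2 scaleN1r scale1r (q12 y x); ring.
have -> : 48 * quartic x y u u = 12 * (4 * quartic x y u u) by ring.
rewrite -H2; have := H (x - y); have := H (x + y).
set a := A4 (x + y + u); set b := A4 (x + y - u); set c := A4 (x - y + u).
set e := A4 (x - y - u) => /(canRL (addrK _)) -> /(canRL (addrK _)) ->; ring.
Qed.

Variables (u : 'rV[R]_n) (s : R).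
Hypothesis u1 : dotv u u = 1.

Definition contr_mx : 'M[S]_n :=
  \matrix_(i, j) (s *: \sum_k \sum_l (u 0 k * u 0 l) *: g i j k l).

(** The polarisation formula with each fourth power replaced by its dual
    derivation. *)
Definition contr_der (x y : 'rV[R]_n) (F : S) : S :=
  (s / 48) *: (Dq (x + y + u) F + Dq (x + y - u) F - 2 *: Dq (x + y) F
  - Dq (x - y + u) F - Dq (x - y - u) F + 2 *: Dq (x - y) F).

Lemma contr_mx_tr : contr_mx^T = contr_mx.
Proof.
apply/matrixP => i j; rewrite !mxE; congr (_ *: _).
by apply: eq_bigr => k _; apply: eq_bigr => l _; rewrite g12.
Qed.

Lemma sform_contr x y : sform contr_mx x y = s *: quartic x y u u.
Proof.
rewrite /sform mxE; under eq_bigr do rewrite mxE mulr_suml.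
rewrite exchange_big /quartic scaler_sumr; apply: eq_bigr => i _.
rewrite scaler_sumr; apply: eq_bigr => j _.
rewrite !mxE /= !mulr_algl mulrC mulr_algl !scalerA mulrC -scalerA scaler_sumr.
rewrite !scaler_sumr; apply: eq_bigr => k _; rewrite !scaler_sumr.
apply: eq_bigr => l _; rewrite !scalerA; congr (_ *: _); ring.
Qed.

Lemma contr_derivation x y : derivation (contr_der x y).
Proof.
split=> [c p q|p q]; rewrite /contr_der.
  by rewrite !(Dq_derivation _).1 !scale_in_alg; ring.
by rewrite !(Dq_derivation _).2 !scale_in_alg; ring.
Qed.

Let E_add p q : E (p + q) = E p + E q.
Proof. by have := E_linear 1 p q; rewrite scale1r mul1r. Qed.

Let E_scale c p : E (c *: p) = c * E p.
Proof.
have E0 : E 0 = 0 by apply: (addrI (E 0)); rewrite -E_add !addr0.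
by have := E_linear c p 0; rewrite E0 !addr0.
Qed.

Let E_opp p : E (- p) = - E p.
Proof. by rewrite -scaleN1r E_scale mulN1r. Qed.

Lemma contr_ibp x y F : E (sform contr_mx x y * F) = E (contr_der x y F).
Proof.
rewrite sform_contr -scalerAl E_scale /contr_der E_scale.
have -> : quartic x y u u * F = (48^-1 : R) *: (A4 (x + y + u) * F +
    A4 (x + y - u) * F - 2 *: (A4 (x + y) * F) - A4 (x - y + u) * F -
    A4 (x - y - u) * F + 2 *: (A4 (x - y) * F)).
  have F48 : quartic x y u u = (48^-1 : R) *: (48 * quartic x y u u).
    have -> : 48 * quartic x y u u = (48 : R) *: quartic x y u u.
      by rewrite scaler_nat mulr_natl.
    by rewrite scalerA mulVf ?scale1r// pnatr_eq0.
  rewrite F48 quartic_polarization -scalerAl !scaler_nat; congr (_ *: _); ring.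
by rewrite E_scale mulrA !(E_add, E_opp, E_scale) !Dq_ibp.
Qed.

Let sum4 (a b c e : 'I_n -> R) :
  \sum_i \sum_j \sum_k \sum_l a i * b j * c k * e l =
  (\sum_i a i) * (\sum_i b i) * (\sum_i c i) * (\sum_i e i).
Proof.
rewrite -!mulrA mulr_suml; apply: eq_bigr => i _.
rewrite mulr_suml mulr_sumr; apply: eq_bigr => j _.
rewrite mulr_suml !mulr_sumr; apply: eq_bigr => k _.
by rewrite !mulr_sumr; apply: eq_bigr => l _; ring.
Qed.

Let Dq_quartic v z w : Dq v (quartic z w u u) =
  (4 * dotv v z * dotv v w * dotv v u ^+ 2)%:A.
Proof.
have -> : 4 * dotv v z * dotv v w * dotv v u ^+ 2 =
    4 * \sum_i \sum_j \sum_k \sum_l (v 0 i * z 0 i) * (v 0 j * w 0 j) *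
      (v 0 k * u 0 k) * (v 0 l * u 0 l).
  by rewrite sum4 -!dotvE; ring.
rewrite (derivation_sum (Dq_derivation v)) mulr_sumr scaler_suml.
apply: eq_bigr => i _.
rewrite (derivation_sum (Dq_derivation v)) mulr_sumr scaler_suml.
apply: eq_bigr => j _.
rewrite (derivation_sum (Dq_derivation v)) mulr_sumr scaler_suml.
apply: eq_bigr => k _.
rewrite (derivation_sum (Dq_derivation v)) mulr_sumr scaler_suml.
apply: eq_bigr => l _.
rewrite (derivationZ (Dq_derivation v)) Dq_g scalerA; congr (_ *: _); ring.
Qed.

Lemma contr_der_form x y z w :
  contr_der x y (sform contr_mx z w) = (s ^+ 2 * form_cov u x y z w)%:A.
Proof.
rewrite sform_contr /contr_der !(derivationZ (Dq_derivation _)) !Dq_quartic.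
rewrite !(dotvDl, dotvNl) u1 /form_cov ![dotv _ u](dotvC _ u).
rewrite !scalerA -!scaleNr -!scalerDl scalerA; congr (_ *: _).
by rewrite /GRing.scale /=; field.
Qed.

End quartic_polarization.

(** * Moments of the contracted tensor *)

Section real_compression.
Context (R : realType) (n : nat) (u : 'rV[R]_n) (H : 'M[R]_n).

Definition rcomp : 'M[R]_n := oproj u *m H *m oproj u.
Definition rcomp_pow k : 'M[R]_n := iter k (mulmx rcomp) (oproj u).
Definition rside_row : 'rV[R]_n := u *m H *m oproj u.
Definition rside_moment k : R := dotv (rside_row *m rcomp_pow k) rside_row.
Definition rdiag : R := dotv (u *m H) u.

End real_compression.

(** The recursion of [schwinger_dyson] with [kappa = n^-1], for
    [m ks] the expectation of the product of the traces of the powers [ks] of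
    the block; the trace of the zeroth power is the dimension [n - 1] of the
    complement. *)
Definition trace_moments (R : realFieldType) (n : nat) (m : seq nat -> R) : Prop :=
  [/\ m [::] = 1, forall ks, m (0%N :: ks) = (n%:R - 1) * m ks &
   forall k ks, m (k.+1 :: ks) =
    n%:R^-1 / 3 * \sum_(a < k) (m [:: nat_of_ord a, (k.-1 - a)%N & ks] + m (k.-1 :: ks)) +
    \sum_(i < size ks) 2 * (nth 0%N ks i)%:R * n%:R^-1 / 3 *
      m ((k + (nth 0%N ks i).-1)%N :: omit ks i)].

Section gote_polynomials.
Context (R : realType) d (T : measurableType d) (P : probability T R).
Context (n : nat) (G : 4.-tuple 'I_n -> {RV P >-> R}).
Hypothesis n0 : (0 < n)%N.
Hypothesis hG : GOTE4 G.

(** Sorted index tuples represent multisets of indices, hence the independent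
    entries of the tensor. *)
Definition sort_index (t : 4.-tuple 'I_n) : 4.-tuple 'I_n :=
  [tuple of sort (fun i j : 'I_n => (i <= j)%N) t].

Lemma perm_sort_index t : perm_eq (sort_index t) t.
Proof. by rewrite /= perm_sort. Qed.

Lemma sort_indexP s t : reflect (sort_index s = sort_index t) (perm_eq s t).
Proof.
have H := @perm_sortP _ (fun i j : 'I_n => (i <= j)%N) _ _ _ s t.
apply: (iffP idP) => [st|st].
  apply: val_inj => /=; apply/perm_sortP => //.
  - by move=> i j; exact: leq_total.
  - by move=> i j k; exact: leq_trans.
  - by move=> i j ij; apply/val_inj/anti_leq.
rewrite -(perm_sort (fun i j : 'I_n => (i <= j)%N) s) -[sort _ s]/(val (sort_index s)).
by rewrite st perm_sort.
Qed.

Definition sorted_indices : {set 4.-tuple 'I_n} := [set t | sort_index t == t].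
Local Notation J := sorted_indices.

Lemma sort_index_in t : sort_index t \in J.
Proof. by rewrite inE; apply/eqP/sort_indexP; exact: perm_sort_index. Qed.

Let t0 : 4.-tuple 'I_n := sort_index [tuple of nseq 4 (Ordinal n0)].
Let t0J : t0 \in J. Proof. exact: sort_index_in. Qed.

Local Notation N := #|J|.
Let idx (t : 4.-tuple 'I_n) : 'I_N := enum_rank_in t0J (sort_index t).
Let X (a : 'I_N) := G (enum_val a).
Let sd (a : 'I_N) : R := Num.sqrt (4 / (nperm (enum_val a))%:R).

Let val_idx t : enum_val (idx t) = sort_index t.
Proof. by rewrite enum_rankK_in// sort_index_in. Qed.

Let idx_val a : idx (enum_val a) = a.
Proof.
rewrite /idx; have := enum_valP a; rewrite inE => /eqP ->.
exact: enum_valK_in.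
Qed.

Let indepX : mutually_independent [set: 'I_N]%SET X.
Proof.
have distinctJ : {in J &, forall s t : 4.-tuple 'I_n, perm_eq s t -> s = t}.
  move=> s t; rewrite !inE => /eqP sE /eqP tE /sort_indexP.
  by rewrite sE tE.
have [_ _ /(_ J distinctJ) indepJ] := hG; move=> K B _ mB.
have := indepJ [set enum_val a | a in K]%SET (fun t => B (idx t)).
rewrite big_imset /=; last by move=> a b _ _; exact: enum_val_inj.
under eq_bigr do rewrite idx_val.
move=> <-.
- congr (P _); apply/seteqP; split => w /= Hw t /=.
  + by move=> /imsetP[a aK ->]; rewrite /= idx_val; exact: Hw.
  + by move=> tK; have := Hw (enum_val t) (imset_f _ tK); rewrite /= idx_val.
- by apply/fintype.subsetP => _ /imsetP[a _ ->]; exact: enum_valP.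
- by move=> _ /imsetP[a aK ->]; rewrite idx_val; exact: mB.
Qed.

Let npermE (t : 4.-tuple 'I_n) :
  nperm t = #|[pred t' : 4.-tuple 'I_n | perm_eq t t']|.
Proof. by apply: eq_card => t'; rewrite unfold_in inE /= /in_set asboolb. Qed.

Let nperm_gt0 t : (0 < @nperm n t)%N.
Proof. by rewrite npermE; apply/card_gt0P; exists t; rewrite inE. Qed.

Let sd0 a : 0 < sd a.
Proof. by rewrite sqrtr_gt0 divr_gt0// ltr0n. Qed.

Let lawX a : has_law (X a) (normal_prob 0 (sd a)).
Proof. by have [_ + _] := hG; apply. Qed.

Local Notation S := (mpoly.mpoly N R).
Let g4 (t : 4.-tuple 'I_n) : S := mpoly.mpolyX R (mpoly.mnm1 (idx t)).
Let g i j k l : S := g4 [tuple i; j; k; l].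

Let g4_perm (s t : 4.-tuple 'I_n) : perm_eq s t -> g4 s = g4 t.
Proof. by move=> /sort_indexP st; rewrite /g4 /idx st. Qed.

Let g12 i j k l : g i j k l = g j i k l.
Proof. by apply: g4_perm; rewrite /= (perm_catCA [:: i] [:: j] [:: k; l]). Qed.

Let g23 i j k l : g i j k l = g i k j l.
Proof. by apply: g4_perm; rewrite /= perm_cons (perm_catCA [:: j] [:: k] [:: l]). Qed.

Let g34 i j k l : g i j k l = g i j l k.
Proof. by apply: g4_perm; rewrite /= !perm_cons (perm_catC [:: k] [:: l]). Qed.

Let xt (x : 'rV[R]_n) (t : seq 'I_n) : R := \prod_(i <- t) x 0 i.

Let Dq (x : 'rV[R]_n) (F : S) : S :=
  \sum_(a : 'I_N) (4 * xt x (enum_val a)) *: mpoly.mderiv a F.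

Let Dq_derivation x : derivation (Dq x).
Proof.
split=> [c p q|p q].
  rewrite /Dq scaler_sumr -big_split; apply: eq_bigr => a _ /=.
  by rewrite mpoly.mderivD mpoly.mderivZ scalerDr !scalerA [c * _]mulrC.
rewrite /Dq mulr_suml mulr_sumr -big_split; apply: eq_bigr => a _ /=.
by rewrite mpoly.mderivM scalerDr -scalerAl -scalerAr.
Qed.

Let mderiv_var a b : mpoly.mderiv a (mpoly.mpolyX R (mpoly.mnm1 b)) = (a == b)%:R :> S.
Proof.
rewrite mpoly.mderivX mpoly.mnm1E eq_sym; case: eqP => [->|_].
  by rewrite scale1r (_ : mpoly.mnm_sub _ _ = mpoly.mnm0)
    ?mpoly.mpolyX0//; apply/mpoly.mnmP => i; rewrite mpoly.mnmBE subnn mpoly.mnm0E.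
by rewrite scale0r.
Qed.

Let xt_sort x t : xt x (sort_index t) = xt x t.
Proof. by apply: perm_big; exact: perm_sort_index. Qed.

Let Dq_g4 x t : Dq x (g4 t) = (4 * xt x t)%:A.
Proof.
rewrite /Dq (bigD1 (idx t))//= big1 ?addr0 => [|a ai].
  by rewrite mderiv_var eqxx val_idx xt_sort.
by rewrite mderiv_var (negbTE ai) scaler0.
Qed.

Let xt4 x i j k l : xt x [tuple i; j; k; l] = x 0 i * x 0 j * x 0 k * x 0 l.
Proof. by rewrite /xt /= !big_cons big_nil mulr1 !mulrA. Qed.

Let Dq_g x i j k l : Dq x (g i j k l) = (4 * (x 0 i * x 0 j * x 0 k * x 0 l))%:A.
Proof. by rewrite Dq_g4 xt4. Qed.

Lemma sum_tuple4 (V : nmodType) (F : 4.-tuple 'I_n -> V) :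
  \sum_i \sum_j \sum_k \sum_l F [tuple i; j; k; l] = \sum_t F t.
Proof.
rewrite pair_bigA /= pair_bigA /= pair_bigA /=.
pose h (p : 'I_n * 'I_n * 'I_n * 'I_n) := [tuple p.1.1.1; p.1.1.2; p.1.2; p.2].
rewrite [RHS](reindex h)//; apply: onW_bij.
exists (fun t : 4.-tuple 'I_n => (tnth t 0, tnth t 1, tnth t 2, tnth t 3)).
  by case=> [[[i j] k] l].
case/tupleP => i; case/tupleP => j; case/tupleP => k; case/tupleP => l t.
by rewrite (tuple0 t); apply/val_inj.
Qed.

Local Notation E := (poly_mean X).

Let E_linear c p q : E (c *: p + q) = c * E p + E q.
Proof. exact: (poly_mean_linear indepX sd0 lawX). Qed.

Let card_idx a : #|[pred t | idx t == a]| = nperm (enum_val a).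
Proof.
rewrite npermE; apply: eq_card => t; rewrite !inE /=.
apply/eqP/idP => [<-|].
  by rewrite val_idx perm_sort.
by move=> /sort_indexP st; rewrite /idx -st -/(idx _) idx_val.
Qed.

Let quartic_sum x : quartic g x x x x =
  \sum_(a : 'I_N) ((nperm (enum_val a))%:R * xt x (enum_val a)) *:
    mpoly.mpolyX R (mpoly.mnm1 a).
Proof.
transitivity (\sum_(t : 4.-tuple 'I_n) xt x t *: g4 t).
  rewrite -sum_tuple4; apply: eq_bigr => i _; apply: eq_bigr => j _.
  by apply: eq_bigr => k _; apply: eq_bigr => l _; rewrite xt4.
rewrite (partition_big idx xpredT)//=; apply: eq_bigr => a _.
rewrite (eq_bigr (fun _ => xt x (enum_val a) *: mpoly.mpolyX R (mpoly.mnm1 a))).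
  by rewrite sumr_const card_idx -scaler_nat scalerA.
by move=> t /eqP <-; rewrite val_idx xt_sort.
Qed.

(** A multiset occurs in the quartic form as many times as it has distinct
    rearrangements, and its entry has variance 4 divided by that number.  The
    two factors cancel: this is the orthogonal invariance of the tensor. *)
Let Dq_ibp x F : E (quartic g x x x x * F) = E (Dq x F).
Proof.
rewrite quartic_sum mulr_suml (E_sum E_linear) /Dq (E_sum E_linear).
apply: eq_bigr => a _.
rewrite -scalerAl !(E_scale E_linear) (poly_mean_ibp indepX sd0 lawX).
rewrite /sd sqr_sqrtr ?divr_ge0 ?ler0n//.
have nz : (nperm (enum_val a))%:R != 0 :> R by rewrite pnatr_eq0 -lt0n.
by field.
Qed.

Variable u : 'rV[R]_n.
Hypothesis u1 : dotv u u = 1.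
Let kappa : R := n%:R^-1.
Let s : R := (Num.sqrt n%:R)^-1.

Let s2 : s ^+ 2 = kappa.
Proof. by rewrite /s exprVn sqr_sqrtr// ler0n. Qed.

Let HS : 'M[S]_n := contr_mx g u s.

Let HS_tr : HS^T = HS.
Proof. exact: contr_mx_tr. Qed.

Let DS := contr_der Dq u s.

Let DS_derivation x y : derivation (DS x y).
Proof. exact: contr_derivation. Qed.

Let DS_ibp x y F : E (sform HS x y * F) = E (DS x y F).
Proof. exact: (contr_ibp E_linear g12 g23 g34 Dq_ibp). Qed.

Let DS_form x y z w : DS x y (sform HS z w) = (kappa * form_cov u x y z w)%:A.
Proof. by rewrite -s2; exact: contr_der_form. Qed.

Definition contraction (w : T) : 'M[R]_n :=
  (Num.sqrt n%:R)^-1 *: contract2 (fun t => G t w) u u.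

Let ev w : {rmorphism S -> R} := mpoly.meval (fun a => X a w).

Let ev_g4 w t : ev w (g4 t) = G t w.
Proof.
rewrite /= mpoly.mevalXU /X val_idx.
by have [H _ _] := hG; apply: H; exact: perm_sort_index.
Qed.

Let ev_scalar w c : ev w (c%:A) = c.
Proof. by rewrite /= mpoly.mevalZ mpoly.meval1 mulr1. Qed.

Let ev_scalar_mx w m p (M : 'M[R]_(m, p)) : map_mx (ev w) (map_mx (in_alg S) M) = M.
Proof. by apply/matrixP => i j; rewrite !mxE ev_scalar. Qed.

Let ev_HS w : map_mx (ev w) HS = contraction w.
Proof.
apply/matrixP => i j; rewrite !mxE /= mpoly.mevalZ; congr (_ * _).
rewrite (rmorph_sum (ev w)); apply: eq_bigr => k _.
rewrite (rmorph_sum (ev w)); apply: eq_bigr => l _.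
by rewrite /= mpoly.mevalZ -[X in _ * X]/(ev w _) ev_g4; ring.
Qed.

Let ev_pow w k : map_mx (ev w) (comp_pow u HS k) = rcomp_pow u (contraction w) k.
Proof.
elim: k => [|k IH]; first exact: ev_scalar_mx.
rewrite comp_powS map_mxM IH /=; congr (_ *m _).
by rewrite !map_mxM !ev_scalar_mx ev_HS.
Qed.

Let ev_tr w k : ev w (comp_tr u HS k) = \tr (rcomp_pow u (contraction w) k).
Proof. by rewrite -ev_pow trace_map_mx. Qed.

Let ev_row w : map_mx (ev w) (side_row u HS) = rside_row u (contraction w).
Proof. by rewrite !map_mxM !ev_scalar_mx ev_HS. Qed.

Let ev_side w k : ev w (side_moment u HS k) = rside_moment u (contraction w) k.
Proof.
rewrite /rside_moment /dotv -ev_row -ev_pow map_trmx -!map_mxM.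
by rewrite [RHS]mxE.
Qed.

Let ev_diag w : ev w (sform HS u u) = rdiag u (contraction w).
Proof.
rewrite /rdiag /dotv -ev_HS -[in RHS](ev_scalar_mx w u) map_trmx -!map_mxM.
by rewrite [RHS]mxE.
Qed.

Definition has_expectation (f : T -> R) (e : R) : Prop :=
  P.-integrable setT (EFin \o f) /\ \int[P]_w f w = e.

Let ev_mean (p : S) (f : T -> R) : (forall w, ev w p = f w) ->
  has_expectation f (E p).
Proof.
move=> pf; have fE : f = (fun w => poly_eval X w p).
  by apply/funext => w; rewrite -pf.
by rewrite fE; split => //; exact: (integrable_poly indepX sd0 lawX).
Qed.

(** All that is used of the law of the tensor.  One function [m] describes the
    traces of powers of the block, and through them the first two moments of
    the side moments: given the block, the side row is a Gaussian vector with
    covariance [n^-1] times the projection. *)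
Lemma gote_moments : exists m : seq nat -> R,
  [/\ trace_moments n m,
      forall k, has_expectation (fun w => \tr (rcomp_pow u (contraction w) k)) (m [:: k]),
      forall k, has_expectation (fun w => rside_moment u (contraction w) k)
        (n%:R^-1 * m [:: k]),
      forall k, has_expectation (fun w => rside_moment u (contraction w) k ^+ 2)
        (n%:R^-1 ^+ 2 * (m [:: k; k] + 2 * m [:: (k + k)%N])) &
      has_expectation (fun w => rdiag u (contraction w)) 0 /\
      has_expectation (fun w => rdiag u (contraction w) ^+ 2) (4 / n%:R)].
Proof.
have E1 : E 1 = 1 by exact: poly_mean1.
exists (fun ks => E (comp_traces u HS ks)).
have tr1 k : comp_traces u HS [:: k] = comp_tr u HS k.
  by rewrite /comp_traces big_seq1.
split.
- split; first by rewrite comp_traces_nil.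
    move=> ks; rewrite comp_traces_cons comp_tr0// mulr_algl.
    by rewrite (E_scale E_linear).
  exact: (schwinger_dyson E_linear u1 HS_tr DS_derivation DS_ibp DS_form).
- by move=> k; apply: ev_mean => w; rewrite tr1 ev_tr.
- move=> k; rewrite tr1.
  rewrite -(mean_side_moment E_linear u1 DS_derivation DS_ibp DS_form).
  exact: ev_mean.
- move=> k; rewrite tr1 /comp_traces big_cons big_seq1.
  rewrite -(mean_sqr_side_moment E_linear u1 HS_tr DS_derivation DS_ibp DS_form).
  by apply: ev_mean => w; rewrite rmorphM ev_side.
- have -> : 0 = E (sform HS u u).
    rewrite -[sform _ _ _]mulr1 DS_ibp (derivation1 (DS_derivation _ _)).
    by rewrite (E_zero E_linear).
  split; first exact: ev_mean.
  have -> : 4 / n%:R = E (sform HS u u * sform HS u u).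
    by rewrite (mean_sqr_diag E_linear u1 DS_ibp DS_form) E1 mulr1.
  by apply: ev_mean => w; rewrite rmorphM ev_diag.
Qed.

End gote_polynomials.

(** * Semicircle moments and the equation of the outlier *)

Section noncrossing_moments.
Context (R : realFieldType) (s del rho : R).

(** For [del = 0] these are the moments of the semicircle law of variance [s],
    indexed so that [moment k.+1] convolves the moments with indices adding up
    to [k.-1].  The geometric source [del * rho ^+ k] makes the sequence a
    majorant of finite-dimensional moments.  A list is stored because the
    recursion needs all previous values. *)
Fixpoint moment_list k : seq R :=
  if k is k'.+1 then
    rcons (moment_list k')
      (s * \sum_(a < k') (moment_list k')`_a * (moment_list k')`_(k'.-1 - a) +
       del * rho ^+ k)
  else [:: 1].

Definition moment k : R := (moment_list k)`_k.
Local Notation w := moment.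

Let size_moment_list k : size (moment_list k) = k.+1.
Proof. by elim: k => //= k IH; rewrite size_rcons IH. Qed.

Let nth_moment_list k j : (j <= k)%N -> (moment_list k)`_j = w j.
Proof.
elim: k => [|k IH]; first by case: j.
rewrite leq_eqVlt => /predU1P[->//|jk].
by rewrite /= nth_rcons size_moment_list jk IH.
Qed.

Lemma moment0 : w 0 = 1. Proof. by []. Qed.

Lemma momentS k :
  w k.+1 = s * \sum_(a < k) w a * w (k.-1 - a) + del * rho ^+ k.+1.
Proof.
rewrite {1}/moment /= nth_rcons size_moment_list ltnn eqxx; congr (_ * _ + _).
apply: eq_bigr => a _; rewrite !nth_moment_list//; last exact: ltnW.
by rewrite (leq_trans (leq_subr _ _))// leq_pred.
Qed.

Hypotheses (s0 : 0 <= s) (del0 : 0 <= del) (rho0 : 0 <= rho).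

Lemma moment_ge0 k : 0 <= w k.
Proof.
elim/ltn_ind: k => -[|k] IH; first by rewrite moment0.
rewrite momentS addr_ge0 ?mulr_ge0 ?exprn_ge0//; apply: sumr_ge0 => a _.
rewrite mulr_ge0// IH// ?ltnS; first by rewrite ltnW.
by rewrite (leq_trans (leq_subr _ _))// leq_pred.
Qed.

Lemma moment_ge k : (0 < k)%N -> del * rho ^+ k <= w k.
Proof.
case: k => // k _; rewrite momentS lerDr mulr_ge0// sumr_ge0// => a _.
by rewrite mulr_ge0// moment_ge0.
Qed.

(** Truncation of the expansion at infinity of the Stieltjes transform. *)
Definition stieltjes (lam : R) K : R := \sum_(0 <= k < K) w k / lam ^+ k.+1.

Let conv_exchange (p : nat -> R) K :
  \sum_(0 <= k < K) \sum_(0 <= a < k) p a * p (k.-1 - a)%N =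
  \sum_(0 <= a < K) p a * \sum_(0 <= j < (K - a).-1) p j.
Proof.
transitivity (\sum_(0 <= k < K) \sum_(0 <= a < K | (a < k)%N) p a * p (k.-1 - a)%N).
  rewrite big_nat [RHS]big_nat; apply: eq_bigr => k /andP[_ kK].
  by rewrite (big_nat_widen _ _ K)// ltnW.
rewrite (exchange_big_dep_nat xpredT)//= big_nat [RHS]big_nat.
apply: eq_bigr => a /andP[_ aK]; rewrite mulr_sumr.
rewrite (@big_cat_nat _ _ _ a.+1)//= big_nat_cond big_pred0 ?add0r; last first.
  by move=> k; lia.
rewrite -{1}[a.+1]add0n big_addn -subnS big_nat_cond [RHS]big_nat_cond.
apply: eq_big => [j|j _]; first by lia.
by congr (_ * p _); lia.
Qed.

(** The quadratic equation of the Stieltjes transform, with the convolution cut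
    off by the truncation. *)
Let stieltjesS lam K : 0 < lam -> let p k := w k / lam ^+ k.+1 in
  lam * stieltjes lam K.+1 =
  1 + s * \sum_(0 <= a < K) p a * (\sum_(0 <= j < (K - a).-1) p j) +
  \sum_(0 <= k < K) del * (rho / lam) ^+ k.+1.
Proof.
move=> lam0 p; rewrite -conv_exchange [X in 1 + X]mulr_sumr -addrA -big_split /=.
rewrite /stieltjes big_nat_recl//= moment0 expr1 mulrDr; congr (_ + _).
  by rewrite mul1r mulfV// gt_eqF.
rewrite mulr_sumr; apply: eq_bigr => k _.
have lamn j : lam ^+ j != 0 by rewrite expf_neq0// gt_eqF.
have -> : lam * (w k.+1 / lam ^+ k.+2) = w k.+1 / lam ^+ k.+1.
  by rewrite [lam ^+ k.+2]exprS; field; rewrite lamn gt_eqF.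
rewrite momentS mulrDl expr_div_n !mulrA; congr (_ + _).
rewrite -mulrA; congr (_ * _); rewrite big_mkord mulr_suml.
apply: eq_bigr => a _; rewrite /p mulrACA -invfM -exprD; congr (_ / _ ^+ _).
have := ltn_ord a; lia.
Qed.

Let p_ge0 lam k : 0 < lam -> 0 <= w k / lam ^+ k.+1.
Proof. by move=> lam0; rewrite divr_ge0 ?moment_ge0// exprn_ge0// ltW. Qed.

Let sum_le (p : nat -> R) a b : (forall k, 0 <= p k) -> (a <= b)%N ->
  \sum_(0 <= k < a) p k <= \sum_(0 <= k < b) p k.
Proof.
move=> p0 ab; rewrite (big_cat_nat (n := a) (leq0n a) ab) /= lerDl.
exact: sumr_ge0.
Qed.

Lemma stieltjes_ge0 lam K : 0 < lam -> 0 <= stieltjes lam K.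
Proof. by move=> lam0; apply: sumr_ge0 => k _; exact: p_ge0. Qed.

(** Any supersolution [x] of the quadratic equation dominates the truncations:
    each step of the recursion stays below it. *)
Lemma stieltjes_le lam x e : 0 < lam -> 0 <= x ->
  (forall K, \sum_(0 <= k < K) del * (rho / lam) ^+ k.+1 <= e) ->
  1 + s * x ^+ 2 + e <= lam * x -> forall K, stieltjes lam K <= x.
Proof.
move=> lam0 x0 He Hx; elim=> [|K IH].
  by rewrite /stieltjes big_geq.
rewrite -(ler_pM2l lam0) stieltjesS// (le_trans _ Hx)// lerD// lerD2l.
rewrite ler_wpM2l// expr2.
apply: (@le_trans _ _ (stieltjes lam K * stieltjes lam K)); last first.
  by rewrite ler_pM// stieltjes_ge0.
rewrite {1}/stieltjes mulr_suml ler_sum// => a _.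
rewrite ler_wpM2l ?p_ge0//; apply: sum_le => [k|]; first exact: p_ge0.
lia.
Qed.

Lemma moment_le lam x e : 0 < lam -> 0 <= x ->
  (forall K, \sum_(0 <= k < K) del * (rho / lam) ^+ k.+1 <= e) ->
  1 + s * x ^+ 2 + e <= lam * x -> forall k, w k <= x * lam ^+ k.+1.
Proof.
move=> lam0 x0 He Hx k; have := stieltjes_le lam0 x0 He Hx k.+1.
rewrite /stieltjes big_nat_recr//= => H.
rewrite -ler_pdivrMr ?exprn_gt0// (le_trans _ H)// lerDr.
exact: stieltjes_ge0.
Qed.

(** At level [K + K] the cut-off no longer removes any term of the square of the
    truncation at level [K]. *)
Lemma stieltjes_double lam K : 0 < lam ->
  1 + s * stieltjes lam K ^+ 2 <= lam * stieltjes lam (K + K).+1.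
Proof.
move=> lam0; rewrite stieltjesS// -addrA lerD2l.
apply: ler_wpDr.
  by apply: sumr_ge0 => k _; rewrite mulr_ge0// exprn_ge0// divr_ge0// ltW.
rewrite ler_wpM2l//.
have p0 k := p_ge0 k lam0.
apply: (@le_trans _ _ (\sum_(0 <= a < K) (w a / lam ^+ a.+1) *
    \sum_(0 <= j < (K + K - a).-1) w j / lam ^+ j.+1)); last first.
  by apply: sum_le; [move=> a; rewrite mulr_ge0// sumr_ge0|exact: leq_addr].
rewrite expr2 {1}/stieltjes mulr_suml big_nat [leRHS]big_nat.
apply: ler_sum => a /andP[_ aK]; rewrite ler_wpM2l//; apply: sum_le => //.
lia.
Qed.

End noncrossing_moments.

Section outlier_threshold.
Context (R : archiRealFieldType).
Local Notation c := (moment 3^-1 (0 : R) 0).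
Local Notation St := (stieltjes 3^-1 (0 : R) 0).

(** [x = lam0] solves [lam0 * x = 1 + x ^+ 2 / 3], because
    [lam0 ^+ 2 = 3 / 2]. *)
Lemma stieltjes_le_outlier (lam0 lam : R) K : 0 < lam0 -> lam0 ^+ 2 = 3 / 2 -> lam0 <= lam ->
  St lam K <= lam0.
Proof.
move=> l0 l02 ll; have lam_gt0 : 0 < lam by exact: lt_le_trans ll.
apply: (@stieltjes_le _ _ _ _ _ _ _ _ _ 0) => //; try exact: ltW.
  by move=> j; rewrite big1// => k _; rewrite mul0r.
nra.
Qed.

(** If all truncations stayed below [lam], each doubling of the level would add
    at least the fixed positive amount [g], which is impossible for a bounded
    sequence. *)
Lemma stieltjes_gt_below (lam : R) : 0 < lam -> lam ^+ 2 < 3 / 2 ->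
  exists K, lam < St lam K.
Proof.
move=> l0 l2; apply/not_existsP => H.
have {}H K : St lam K <= lam by rewrite leNgt; apply/negP/H.
pose g := (1 - 2 / 3 * lam ^+ 2) / lam.
have g0 : 0 < g by rewrite divr_gt0//; lra.
pose Ks := fix Ks i := if i is i'.+1 then (Ks i' + Ks i').+1 else 0%N.
have HK i : g * i%:R <= St lam (Ks i).
  elim: i => [|i IH]; first by rewrite mulr0 stieltjes_ge0.
  have := @stieltjes_double _ 3^-1 (0 : R) 0 _ _ _ lam (Ks i) l0.
  rewrite -/(Ks i.+1) => H2; apply: (@le_trans _ _ (g + St lam (Ks i))).
    by rewrite -natr1 mulrDr mulr1 addrC lerD2l.
  rewrite -(ler_pM2l l0) (le_trans _ (H2 _ _ _))// /g mulrDr mulrCA mulfV ?gt_eqF//.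
  by have := H (Ks i); set S := St _ _; nra.
have := archi_boundP (divr_ge0 (ltW l0) (ltW g0)).
rewrite ltr_pdivrMr// mulrC => /lt_le_trans/(_ (HK _))/lt_le_trans/(_ (H _)).
by rewrite ltxx.
Qed.

End outlier_threshold.

(** * Trace moments in finite dimension *)

Lemma third_two_thirds_le (R : realFieldType) (K J v L : R) :
  0 <= K -> 0 <= J -> v * J <= J -> K + J <= L -> 3^-1 * K + 2 / 3 * v * J <= L.
Proof. by move=> K0 J0 vJ KJ; lra. Qed.

Lemma size_omit (ks : seq nat) i : (i < size ks)%N -> size (omit ks i) = (size ks).-1.
Proof. by move=> iks; rewrite /omit size_cat size_take size_drop iks; lia. Qed.

Lemma sumn_omit (ks : seq nat) i : (i < size ks)%N ->
  (sumn (omit ks i) + nth 0%N ks i)%N = sumn ks.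
Proof.
move=> iks; rewrite -[in RHS](cat_take_drop i ks) /omit !sumn_cat.
by rewrite (drop_nth 0%N iks) /=; lia.
Qed.

Lemma prod_omit (R : realType) (w : nat -> R) (ks : seq nat) i : (i < size ks)%N ->
  w (nth 0%N ks i) * \prod_(k <- omit ks i) w k = \prod_(k <- ks) w k.
Proof.
move=> iks; rewrite -[in RHS](cat_take_drop i ks) /omit !big_cat.
by rewrite (drop_nth 0%N iks) big_cons mulrCA.
Qed.

Section trace_recursion.
Context (R : realType) (n : nat) (m : seq nat -> R).
Hypotheses (n0 : (0 < n)%N) (mP : trace_moments n m).

Definition norm_traces (ks : seq nat) : R := m ks / n%:R ^+ size ks.
Local Notation t := norm_traces.

Let nR0 : n%:R != 0 :> R. Proof. by rewrite pnatr_eq0 -lt0n. Qed.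

Lemma norm_traces_nil : t [::] = 1.
Proof. by case: mP => m1 _ _; rewrite /t m1 expr0 divr1. Qed.

Lemma norm_traces0 ks : t (0%N :: ks) = (1 - n%:R^-1) * t ks.
Proof.
case: mP => _ m0 _; rewrite /t m0 /= exprS; field.
by rewrite expf_neq0//.
Qed.

Lemma norm_tracesS k ks : t (k.+1 :: ks) =
  3^-1 * \sum_(a < k) (t [:: nat_of_ord a, (k.-1 - a)%N & ks] + n%:R^-1 * t (k.-1 :: ks)) +
  \sum_(i < size ks) 2 / 3 * n%:R^-1 ^+ 2 * (nth 0%N ks i)%:R *
     t ((k + (nth 0%N ks i).-1)%N :: omit ks i).
Proof.
have nX j : n%:R ^+ j != 0 :> R by rewrite expf_neq0.
case: mP => _ _ mS; rewrite {1}/t mS mulrDl; congr (_ + _).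
  rewrite -[LHS]mulrA mulr_suml !mulr_sumr; apply: eq_bigr => a _.
  by rewrite /t /= !exprS; field; rewrite nR0 nX.
rewrite mulr_suml; apply: eq_bigr => i _; rewrite /t /= size_omit//.
have -> : n%:R ^+ (size ks).+1 = n%:R * (n%:R * n%:R ^+ (size ks).-1) :> R.
  by rewrite -!exprS; congr (_ ^+ _); have := ltn_ord i; lia.
by rewrite /= !exprS; field; rewrite nR0 nX.
Qed.

Section bound.
Variables (del rho Q : R) (L : nat).
Local Notation w := (moment 3^-1 del rho).
Hypotheses (del0 : 0 <= del) (rho0 : 0 <= rho) (Q0 : 0 <= Q).
Hypothesis wQ1 : forall k, (0 < k)%N -> (k <= L)%N -> w k.-1 <= Q * rho ^+ k.+1.
Hypothesis wQ2 : forall k j, (0 < j)%N -> (k + j <= L)%N ->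
  w (k + j.-1) <= Q * rho ^+ k.+1 * w j.
Hypothesis nQ : L%:R * Q <= del * n%:R.

Let w_ge0 k : 0 <= w k.
Proof. by apply: moment_ge0 => //; rewrite invr_ge0. Qed.

(** Compared with the product of majorants, the recursion has extra terms of
    relative size [sumn ks / n].  They involve shorter words, which [wQ1] and
    [wQ2] bound by [Q * rho ^+ k.+1] times the other majorants; the source
    [del * rho ^+ k.+1] of the majorant pays for all of them as long as
    [L * Q <= del * n]. *)
Lemma norm_traces_bound ks : (sumn ks <= L)%N -> 0 <= t ks <= \prod_(k <- ks) w k.
Proof.
have n1 : 1 <= n%:R :> R by rewrite ler1n.
have ni0 : 0 < n%:R^-1 :> R by rewrite invr_gt0 ltr0n.
have ni1 : n%:R^-1 <= 1 :> R by rewrite invf_le1// ltr0n.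
have c0 : 0 <= 2 / 3 * n%:R^-1 ^+ 2 :> R by rewrite mulr_ge0// sqr_ge0.
have [N] := ubnP (sumn ks + size ks).
elim: N ks => // N IH [|k ks] ksN ksL; first by rewrite norm_traces_nil big_nil ler01 lexx.
case: k ksN ksL => [|k] ksN ksL.
  have /andP[h1 h2] : 0 <= t ks <= \prod_(k <- ks) w k.
    by apply: IH; move: ksN ksL => /=; clear; lia.
  rewrite norm_traces0 big_cons moment0 mul1r; apply/andP; split; first by nra.
  by apply: (le_trans _ h2); nra.
rewrite norm_tracesS big_cons.
set W := \prod_(j <- ks) w j.
have W0 : 0 <= W by exact: prodr_ge0.
have H1 (a : 'I_k) : 0 <= t [:: nat_of_ord a, (k.-1 - a)%N & ks] <=
    w a * w (k.-1 - a) * W.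
  rewrite -mulrA; have := IH [:: nat_of_ord a, (k.-1 - a)%N & ks]; rewrite !big_cons; apply.
    by move: ksN (ltn_ord a) => /=; clear; lia.
  by move: ksL (ltn_ord a) => /=; clear; lia.
have H2 (a : 'I_k) : 0 <= t (k.-1 :: ks) <= Q * rho ^+ k.+1 * W.
  have := IH (k.-1 :: ks); rewrite big_cons => /(_ _ _)/andP[||-> h2].
  - by move: ksN (ltn_ord a) => /=; clear; lia.
  - by move: ksL (ltn_ord a) => /=; clear; lia.
  - rewrite (le_trans h2)// ler_wpM2r// wQ1//; first by move: (ltn_ord a); clear; lia.
    by move: ksL => /=; clear; lia.
have H3 (i : 'I_(size ks)) :
    0 <= (nth 0%N ks i)%:R * t ((k + (nth 0%N ks i).-1)%N :: omit ks i) <=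
    (nth 0%N ks i)%:R * (Q * rho ^+ k.+1 * W).
  have [->|j0] := posnP (nth 0%N ks i); first by rewrite !mul0r lexx.
  have hs := sumn_omit (ltn_ord i); have hz := size_omit (ltn_ord i).
  have := IH ((k + (nth 0%N ks i).-1)%N :: omit ks i).
  rewrite big_cons => /(_ _ _)/andP[||h1 h2].
  - by move: ksN; rewrite /= hz; move: hs j0 (ltn_ord i); clear; lia.
  - by move: ksL hs j0 => /=; clear; lia.
  rewrite mulr_ge0//= ler_wpM2l// (le_trans h2)// /W -(prod_omit _ (ltn_ord i)).
  rewrite mulrA ler_wpM2r//; first exact: prodr_ge0.
  by apply: wQ2 => //; move: ksL hs => /=; clear; lia.
apply/andP; split.
  apply: addr_ge0.
    rewrite mulr_ge0 ?invr_ge0//; apply: sumr_ge0 => a _.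
    by have /andP[? _] := H1 a; have /andP[? _] := H2 a; rewrite addr_ge0// mulr_ge0// ltW.
  apply: sumr_ge0 => i _; rewrite -mulrA mulr_ge0//.
  by have /andP[] := H3 i.
set B := Q * rho ^+ k.+1 * W.
have B0 : 0 <= B by rewrite !mulr_ge0// exprn_ge0.
apply: (@le_trans _ _ (3^-1 * \sum_(a < k) (w a * w (k.-1 - a) * W + n%:R^-1 * B) +
    \sum_(i < size ks) 2 / 3 * n%:R^-1 ^+ 2 * ((nth 0%N ks i)%:R * B))).
  apply: lerD.
    rewrite ler_wpM2l ?invr_ge0//; apply: ler_sum => a _.
    by have /andP[_ h1] := H1 a; have /andP[_ h2] := H2 a; rewrite lerD// ler_wpM2l// ltW.
  by apply: ler_sum => i _; rewrite -mulrA ler_wpM2l//; have /andP[] := H3 i.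
have -> : \sum_(i < size ks) 2 / 3 * n%:R^-1 ^+ 2 * ((nth 0%N ks i)%:R * B) =
    2 / 3 * n%:R^-1 ^+ 2 * ((sumn ks)%:R * B).
  by rewrite -mulr_sumr -mulr_suml -natr_sum sumnE (big_nth 0%N) big_mkord.
rewrite big_split /= -mulr_suml sumr_const card_ord.
rewrite momentS; set C := \sum_(a < k) _.
rewrite [leRHS]mulrDl mulrDr -addrA [3^-1 * (C * W)]mulrA lerD2l.
have kL : (k + sumn ks <= L)%N by move: ksL => /=; clear; lia.
have {}kL : k%:R + (sumn ks)%:R <= L%:R :> R by rewrite -natrD ler_nat.
rewrite -[(n%:R^-1 * B) *+ k]mulr_natl; set K := k%:R in kL *; set J := (sumn ks)%:R in kL *.
have J0 : 0 <= J by rewrite /J ler0n.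
have K0 : 0 <= K by rewrite /K ler0n.
set v := n%:R^-1 in ni0 ni1 *.
have nQ' : L%:R * Q * v <= del by rewrite /v ler_pdivrMr// ltr0n.
apply: (@le_trans _ _ (v * (L%:R * B))).
  have -> : 3^-1 * (K * (v * B)) + 2 / 3 * v ^+ 2 * (J * B) =
    v * ((3^-1 * K + 2 / 3 * v * J) * B) by ring.
  rewrite ler_wpM2l// ?(ltW ni0)// ler_wpM2r//.
  have vJ : v * J <= J by rewrite ler_piMl.
  exact: third_two_thirds_le.
have -> : v * (L%:R * B) = (L%:R * Q * v) * (rho ^+ k.+1 * W) by rewrite /B; ring.
by rewrite -[leRHS]mulrA ler_wpM2r// mulr_ge0// exprn_ge0.
Qed.

End bound.
End trace_recursion.

Lemma cvg_sumr (R : realType) (I : Type) (r : seq I) (f : I -> nat -> R) (l : I -> R) :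
  (forall i, f i n @[n --> \oo] --> l i) ->
  \sum_(i <- r) f i n @[n --> \oo] --> \sum_(i <- r) l i.
Proof.
move=> fl; elim: r => [|i r IH].
  by rewrite big_nil; under eq_fun do rewrite big_nil; exact: cvg_cst.
by rewrite big_cons; under eq_fun do rewrite big_cons; exact: cvgD.
Qed.

Section trace_limits.
Context (R : realType) (m : nat -> seq nat -> R).
Hypothesis mP : forall n, (0 < n)%N -> trace_moments n (m n).
Local Notation c := (moment 3^-1 (0 : R) 0).

(** In the limit the terms that merge or reconnect words carry a factor
    [n^-1]; what remains of the recursion acts on the first word alone, so
    the limit is a product. *)
Lemma norm_traces_cvg ks :
  norm_traces n (m n) ks @[n --> \oo] --> \prod_(k <- ks) c k.
Proof.
have cvg_inv : (n%:R^-1 : R) @[n --> \oo] --> (0 : R).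
  by rewrite -cvg_shiftS; exact: cvg_harmonic.
have [N] := ubnP (sumn ks + size ks).
elim: N ks => // N IH [|k ks] ksN.
  rewrite big_nil; apply: cvg_near_cst; near=> n.
  rewrite norm_traces_nil//; apply: mP; near: n; exact: nbhs_infty_gt.
case: k ksN => [|k] ksN.
  rewrite big_cons moment0; set W := \prod_(j <- ks) c j.
  have -> : 1 * W = (1 - 0) * W by rewrite subr0.
  apply: (@cvg_trans _ ((1 - n%:R^-1) * norm_traces n (m n) ks @[n --> \oo])).
    apply: near_eq_cvg; near=> n; rewrite norm_traces0//.
      by near: n; exact: nbhs_infty_gt.
    by apply: mP; near: n; exact: nbhs_infty_gt.
  apply: cvgM; first by apply: cvgB => //; exact: cvg_cst.
  by apply: IH; move: ksN => /=; clear; lia.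
rewrite big_cons momentS mul0r addr0.
set W := \prod_(j <- ks) c j.
have -> : 3^-1 * (\sum_(a < k) c a * c (k.-1 - a)) * W =
  3^-1 * \sum_(a < k) (\prod_(j <- [:: nat_of_ord a, (k.-1 - a)%N & ks]) c j +
     0 * \prod_(j <- k.-1 :: ks) c j) +
  \sum_(i < size ks) 2 / 3 * 0 ^+ 2 * (nth 0%N ks i)%:R *
     \prod_(j <- (k + (nth 0%N ks i).-1)%N :: omit ks i) c j.
  rewrite [X in _ = _ + X]big1 ?addr0; last first.
    by move=> i _; rewrite expr2 !mul0r mulr0 !mul0r.
  rewrite -mulrA; congr (_ * _); rewrite mulr_suml; apply: eq_bigr => a _.
  by rewrite mul0r addr0 !big_cons mulrA.
apply: (@cvg_trans _ ((3^-1 * \sum_(a < k)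
   (norm_traces n (m n) [:: nat_of_ord a, (k.-1 - a)%N & ks] +
    n%:R^-1 * norm_traces n (m n) (k.-1 :: ks)) +
  \sum_(i < size ks) 2 / 3 * n%:R^-1 ^+ 2 * (nth 0%N ks i)%:R *
     norm_traces n (m n) ((k + (nth 0%N ks i).-1)%N :: omit ks i)) @[n --> \oo])).
  apply: near_eq_cvg; near=> n; rewrite norm_tracesS//.
    by near: n; exact: nbhs_infty_gt.
  by apply: mP; near: n; exact: nbhs_infty_gt.
apply: cvgD.
  apply: cvgM; first exact: cvg_cst.
  apply: cvg_sumr => a; apply: cvgD.
    by apply: IH; move: ksN (ltn_ord a) => /=; clear; lia.
  apply: cvgM => //; apply: IH.
  by move: ksN (ltn_ord a) => /=; clear; lia.
apply: cvg_sumr => i.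
have hs := sumn_omit (ltn_ord i); have hz := size_omit (ltn_ord i).
have [->|j0] := posnP (nth 0%N ks i).
  by rewrite !mulr0 mul0r; under eq_fun do rewrite mulr0 mul0r; exact: cvg_cst.
apply: cvgM; last first.
  by apply: IH; move: ksN; rewrite /= hz; move: hs j0 (ltn_ord i); clear; lia.
apply: cvgM; last exact: cvg_cst.
apply: cvgM; first exact: cvg_cst.
by rewrite !expr2; apply: cvgM.
Unshelve. all: by end_near. Qed.

End trace_limits.

(** * Norm of the block on the complement *)

Section trace_power.
Context (R : realType) (m : nat -> seq nat -> R).
Hypothesis mP : forall n, (0 < n)%N -> trace_moments n (m n).

Variables lam rho bet del x th : R.
Local Notation w := (moment 3^-1 del rho).
Local Notation eta := (th - 1).

Hypotheses (lam0 : 0 < lam) (rho1 : 1 <= rho) (bet0 : 0 < bet) (x0 : 0 < x).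
Hypotheses (del0 : 0 < del) (del1 : del <= 1) (th1 : 1 < th).
Hypothesis lamE : lam = th * rho.
Hypothesis lam_bet : lam * th ^+ 5 <= bet.
Hypothesis lam_x : 1 + 3^-1 * x ^+ 2 + del / (th - 1) <= lam * x.

Let rho0 : 0 < rho. Proof. exact: lt_le_trans rho1. Qed.
Let th0 : 0 < th. Proof. exact: lt_trans th1. Qed.
Let eta0 : 0 < eta. Proof. by rewrite subr_gt0. Qed.
Let thn0 k : 0 < th ^+ k. Proof. by rewrite exprn_gt0. Qed.

Let w_le k : w k <= x * lam ^+ k.+1.
Proof.
apply: (@moment_le _ _ _ _ _ _ _ _ _ (del / eta)) => //; try exact: ltW.
have q0 : 0 <= rho / lam by rewrite divr_ge0// ltW.
have C0 : 0 <= del / eta by rewrite divr_ge0// ltW.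
move=> K; apply: (@le_trans _ _ (\sum_(0 <= k < K) del * (rho / lam) ^+ k.+1 +
     del / eta * (rho / lam) ^+ K)).
  by rewrite lerDl mulr_ge0// exprn_ge0.
elim: K => [|K IH]; first by rewrite big_geq// expr0 mulr1 add0r.
rewrite big_nat_recr//= -addrA (le_trans _ IH)// lerD2l.
have -> : del * (rho / lam) ^+ K.+1 + del / eta * (rho / lam) ^+ K.+1 =
    del / eta * (rho / lam) ^+ K; last by [].
rewrite exprS; set q := (rho / lam) ^+ K; rewrite lamE; field.
by rewrite !gt_eqF.
Qed.

Let w_ge k : (0 < k)%N -> del * rho ^+ k <= w k.
Proof. by apply: moment_ge; rewrite ?invr_ge0// ltW. Qed.

Let bernoulli k : 1 + k%:R * eta <= th ^+ k.
Proof.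
elim: k => [|k IH]; first by rewrite mul0r addr0 expr0.
rewrite exprS -natr1; apply: (@le_trans _ _ (th * (1 + k%:R * eta))).
  have -> : th * (1 + k%:R * eta) = 1 + (k%:R + 1) * eta + k%:R * eta ^+ 2 by ring.
  by rewrite lerDl mulr_ge0// sqr_ge0.
by rewrite ler_wpM2l// ltW.
Qed.

Let bound n L : (0 < n)%N -> L%:R * (x / del * th ^+ L) <= del * n%:R ->
  m n [:: L] <= n%:R * x * lam ^+ L.+1.
Proof.
move=> n0 HL; have n0' : 0 < n%:R :> R by rewrite ltr0n.
have /andP[_] : 0 <= norm_traces n (m n) [:: L] <= \prod_(k <- [:: L]) w k.
  apply: (@norm_traces_bound _ _ _ n0 (mP n0) del rho (x / del * th ^+ L) L) => //=.
  - exact: ltW.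
  - exact: ltW.
  - by rewrite mulr_ge0 ?divr_ge0// ltW.
  - move=> k k0 kL; rewrite (le_trans (w_le _))// prednK//.
    have r0 : 0 <= x * (th ^+ L * rho ^+ k.+1).
      by rewrite !mulr_ge0 ?exprn_ge0 ?(ltW x0) ?(ltW rho0) ?(ltW th0).
    apply: (@le_trans _ _ (x * (th ^+ L * rho ^+ k.+1))); last first.
      have -> : x / del * th ^+ L * rho ^+ k.+1 =
          x * (th ^+ L * rho ^+ k.+1) * del^-1 by field; rewrite gt_eqF.
      by rewrite ler_peMr// invf_ge1.
    rewrite ler_wpM2l ?(ltW x0)// lamE exprMn.
    apply: ler_pM; rewrite ?exprn_ge0 ?(ltW rho0) ?(ltW th0)//.
      by apply: ler_weXn2l; rewrite // ltW.
    by rewrite exprS ler_peMl ?exprn_ge0 ?(ltW rho0).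
  - move=> k j j0 kjL; rewrite (le_trans (w_le _))//.
    have -> : (k + j.-1).+1 = (k + j)%N by rewrite -addnS prednK.
    apply: (@le_trans _ _ (x / del * th ^+ L * rho ^+ k.+1 * (del * rho ^+ j))).
      have -> : x / del * th ^+ L * rho ^+ k.+1 * (del * rho ^+ j) =
          x * (th ^+ L * (rho * rho ^+ (k + j))).
        by rewrite exprD exprS; field; rewrite gt_eqF.
      rewrite ler_wpM2l ?(ltW x0)// lamE exprMn.
      apply: ler_pM; rewrite ?exprn_ge0 ?(ltW rho0) ?(ltW th0)//.
        by apply: ler_weXn2l; rewrite // ltW.
      by rewrite ler_peMl ?exprn_ge0 ?(ltW rho0).
    rewrite ler_wpM2l ?w_ge//.
    by rewrite !mulr_ge0 ?exprn_ge0 ?invr_ge0 ?(ltW rho0) ?(ltW del0) ?(ltW x0) ?ltW.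
  - by rewrite addn0.
rewrite big_seq1 /norm_traces expr1 ler_pdivrMr// => /le_trans; apply.
by rewrite mulrC -mulrA ler_wpM2l// ltW.
Qed.

(** The level [l] of order [log n / (4 * log th)].  With the power [2 * l] the
    majorant is still legitimate, as it costs [th ^+ (2 * l)], about
    [n ^ (1/2)]; and the geometric gain [(th ^+ 5) ^+ (2 * l)] of [bet] over
    [lam], about [n ^ (5/2)], outweighs the dimension [n]. *)
Let choose_level n : (0 < n)%N ->
  exists l, th ^+ (4 * l) <= n%:R /\ n%:R < th ^+ (4 * l.+1).
Proof.
move=> n0; have ex : exists l, n%:R < th ^+ (4 * l.+1).
  have n_eta : 0 <= n%:R / eta :> R by rewrite divr_ge0// ltW.
  pose b := Num.bound (n%:R / eta : R); exists b.
  have := archi_boundP n_eta; rewrite -/b ltr_pdivrMr// => H.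
  apply: (@lt_le_trans _ _ (th ^+ b)).
    by rewrite (lt_le_trans H)// (le_trans _ (bernoulli b))// lerDr.
  by apply: ler_weXn2l; [exact: ltW|clear; lia].
have := ex_minnP ex => -[l Hl lmin]; exists l; split => //.
case: l Hl lmin => [|l] Hl lmin; first by rewrite muln0 expr0 ler1n.
by rewrite leNgt; apply/negP => /lmin; rewrite ltnn.
Qed.

Lemma trace_power_small_gen (e : R) : 0 < e -> \forall n \near \oo,
  exists2 l, (0 < l)%N & m n [:: (2 * l)%N] <= e * bet ^+ (2 * l).
Proof.
move=> e0; pose C := 2 * x / del ^+ 2.
(* the first term makes the level admissible for the majorant, the second one
   makes the geometric gain exceed [1 / e] *)
pose l0 := (Num.bound (C / eta ^+ 2) + Num.bound (x * lam * th ^+ 4 / e / eta)).+1.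
have C0 : 0 <= C / eta ^+ 2.
  by rewrite /C !divr_ge0 ?exprn_ge0 ?mulr_ge0 ?(ltW x0) ?(ltW del0) ?(ltW eta0).
have C1 : 0 <= x * lam * th ^+ 4 / e / eta.
  by rewrite !divr_ge0 ?(ltW e0) ?(ltW eta0)// !mulr_ge0 ?(ltW x0) ?(ltW lam0) ?ltW.
near=> n.
have n0 : (0 < n)%N by near: n; exact: nbhs_infty_gt.
have [l [nl ln]] := choose_level n0.
have ll : (l0 <= l)%N.
  rewrite leqNgt; apply/negP => ll0.
  have : (n%:R < th ^+ (4 * l0.+1)).
    by apply: (lt_le_trans ln); apply: ler_weXn2l; [exact: ltW|move: ll0; clear; lia].
  apply/negP; rewrite -leNgt; near: n.
  exists (Num.bound (th ^+ (4 * l0.+1))) => // j /= Hj.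
  by rewrite (le_trans (ltW (archi_boundP _)))// ?ler_nat// ltW.
have lC : C / eta ^+ 2 <= l%:R.
  rewrite (le_trans (ltW (archi_boundP C0)))// ler_nat (leq_trans _ ll)//.
  by rewrite /l0; clear; lia.
have lC1 : x * lam * th ^+ 4 / e / eta <= l%:R.
  rewrite (le_trans (ltW (archi_boundP C1)))// ler_nat (leq_trans _ ll)//.
  by rewrite /l0; clear; lia.
have thl := bernoulli l.
have l_ge0 : 0 <= l%:R :> R by [].
exists l; first by apply: leq_trans ll.
apply: (le_trans (bound n0 _)).
  apply: (@le_trans _ _ (del * th ^+ (4 * l))); last by rewrite ler_wpM2l// ltW.
  have -> : (2 * l)%:R * (x / del * th ^+ (2 * l)) = del * (C * l%:R) * th ^+ (2 * l).
    by rewrite natrM /C; field; rewrite gt_eqF.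
  have -> : del * th ^+ (4 * l) = del * (th ^+ l * th ^+ l) * th ^+ (2 * l).
    by rewrite -exprD -mulrA -exprD; congr (_ * _ ^+ _); clear; lia.
  rewrite ler_wpM2r ?(ltW (thn0 _))// ler_wpM2l ?(ltW del0)//.
  have l1 : 0 <= l%:R * eta by rewrite mulr_ge0// ltW.
  apply: (@le_trans _ _ ((l%:R * eta) * (l%:R * eta))).
    have -> : C * l%:R = C / eta ^+ 2 * l%:R * eta ^+ 2 by field; rewrite gt_eqF.
    rewrite -!expr2 exprMn ler_wpM2r ?exprn_ge0 ?(ltW eta0)// expr2 ler_wpM2r//.
  by rewrite ler_pM// (le_trans _ thl)// lerDr.
apply: (@le_trans _ _ (th ^+ (4 * l.+1) * x * lam ^+ (2 * l).+1)).
  by rewrite -!mulrA ler_wpM2r ?mulr_ge0 ?exprn_ge0 ?(ltW x0) ?(ltW lam0)// ltW.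
have lb : lam ^+ (2 * l) * th ^+ (10 * l) <= bet ^+ (2 * l).
  have -> : (10 * l = 5 * (2 * l))%N by clear; lia.
  rewrite [th ^+ _]exprM -exprMn; apply: lerXn2r; rewrite ?nnegrE ?(ltW bet0)//.
  by rewrite mulr_ge0 ?exprn_ge0 ?(ltW lam0) ?ltW.
have : x * lam * th ^+ 4 <= e * th ^+ (6 * l).
  have h1 : x * lam * th ^+ 4 / e <= th ^+ l.
    move: lC1; rewrite ler_pdivrMr// => /le_trans; apply.
    by rewrite (le_trans _ thl)// lerDr.
  rewrite -ler_pdivrMl// mulrC (le_trans h1)//.
  by apply: ler_weXn2l; [exact: ltW|clear; lia].
move=> H; have -> : th ^+ (4 * l.+1) * x * lam ^+ (2 * l).+1 =
    (x * lam * th ^+ 4) * (th ^+ (4 * l) * lam ^+ (2 * l)).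
  rewrite [lam ^+ _]exprS mulnS exprD; ring.
apply: (@le_trans _ _ (e * (lam ^+ (2 * l) * th ^+ (10 * l)))); last first.
  by rewrite ler_wpM2l// ltW.
apply: (le_trans (ler_wpM2r _ H)); first by rewrite mulr_ge0// exprn_ge0// ltW.
rewrite (_ : 10 * l = 6 * l + 4 * l)%N ?exprD; last by clear; lia.
by rewrite le_eqVlt; apply/orP; left; apply/eqP; ring.
Unshelve. all: by end_near. Qed.

End trace_power.

(** The rates have to satisfy [2 / Num.sqrt 3 < lam < bet < Num.sqrt (3 / 2)]:
    the edge of the semicircle, about 1.1547, is where a supersolution [x]
    begins to exist, and [bet] must stay below the outlier, about 1.2247.  The
    fifth power of [th = 116 / 115] just fits between [lam = 116 / 100] and
    [bet = 122 / 100]. *)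
Lemma trace_power_small (R : realType) (m : nat -> seq nat -> R) (e : R) :
  (forall n, (0 < n)%N -> trace_moments n (m n)) -> 0 < e ->
  \forall n \near \oo,
  exists2 l, (0 < l)%N & m n [:: (2 * l)%N] <= e * (122 / 100) ^+ (2 * l).
Proof.
move=> mP; apply: (@trace_power_small_gen R m mP (116 / 100) (115 / 100) _
  (1 / 100 * (1 / 200)) (174 / 100) (116 / 115)); try lra.
by rewrite (_ : 116 / 115 - 1 = 1 / 115); lra.
Qed.

(** * Largest eigenvalue and Rayleigh quotient *)

Section real_dot_product.
Context (R : realType) (n : nat).
Implicit Types x y z : 'rV[R]_n.

Lemma dotv_ge0 x : 0 <= dotv x x.
Proof. by rewrite dotvE sumr_ge0// => i _; rewrite -expr2 sqr_ge0. Qed.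

Lemma dotv_eq0 x : (dotv x x == 0) = (x == 0).
Proof.
apply/eqP/eqP => [|->]; last by rewrite /dotv mul0mx mxE.
rewrite dotvE => /eqP; rewrite psumr_eq0 => [/allP H|i _]; last first.
  by rewrite -expr2 sqr_ge0.
apply/rowP => i; rewrite mxE; have := H i; rewrite mem_index_enum => /(_ isT).
by rewrite /= mulf_eq0 orbb => /eqP.
Qed.

Lemma dotv_gt0 x : x != 0 -> 0 < dotv x x.
Proof. by move=> x0; rewrite lt_neqAle dotv_ge0 eq_sym dotv_eq0 x0. Qed.

Lemma dotv_cauchy x y : dotv x y ^+ 2 <= dotv x x * dotv y y.
Proof.
have [->|y0] := eqVneq y 0.
  by rewrite {1}dotvC /dotv !mul0mx mxE expr0n mulr0.
have yy := dotv_gt0 y0.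
have := dotv_ge0 (dotv y y *: x - dotv x y *: y).
rewrite !(dotvDl, dotvDr, dotvZl, dotvZr, dotvNl, dotvNr) (dotvC y x).
set a := dotv x x; set b := dotv x y; set c := dotv y y in yy *.
rewrite (_ : _ + _ = c * (a * c - b ^+ 2)); last by ring.
by rewrite pmulr_rge0// subr_ge0.
Qed.

Lemma l2normE x : l2norm x = Num.sqrt (dotv x x).
Proof. by rewrite /l2norm dotvE; congr Num.sqrt; apply: eq_bigr => i _; rewrite expr2. Qed.

End real_dot_product.

Section rayleigh.
Context (R : realType) (n : nat) (A : 'M[R]_n).
Hypotheses (n0 : (0 < n)%N) (Asym : A^T = A).
Local Notation form x := (dotv (x *m A) x).

Let continuous_coord i : continuous (fun x : 'rV[R]_n => x 0 i).
Proof. exact: (@coord_continuous R 1 n 0 i). Qed.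

Let continuous_sum (I : Type) (r : seq I) (F : I -> 'rV[R]_n -> R) :
  (forall i, continuous (F i)) -> continuous (fun x => \sum_(i <- r) F i x).
Proof.
move=> cF; elim: r => [|i r IH].
  rewrite (_ : (fun x => _) = cst 0); first exact: cst_continuous.
  by apply/funext => x; rewrite big_nil.
rewrite (_ : (fun x => _) = (fun x => F i x + \sum_(i <- r) F i x)).
  by move=> x; exact: (cvgD (cF i x) (IH x)).
by apply/funext => x; rewrite big_cons.
Qed.

Lemma continuous_dotv : continuous (fun x : 'rV[R]_n => dotv x x).
Proof.
rewrite (_ : (fun x => _) = (fun x : 'rV[R]_n => \sum_i x 0 i * x 0 i)).
  by apply: continuous_sum => i x; exact: (cvgM (@continuous_coord i x) (@continuous_coord i x)).
by apply/funext => x; exact: dotvE.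
Qed.

Lemma continuous_form : continuous (fun x : 'rV[R]_n => form x).
Proof.
rewrite (_ : (fun x => _) =
   (fun x : 'rV[R]_n => \sum_i (\sum_j x 0 j * A j i) * x 0 i)).
  apply: continuous_sum => i x.
  have H : continuous (fun x : 'rV[R]_n => \sum_j x 0 j * A j i).
    by apply: continuous_sum => j y; exact: (cvgM (@continuous_coord j y) (cvg_cst _)).
  exact: (cvgM (H x) (@continuous_coord i x)).
by apply/funext => x; rewrite dotvE; apply: eq_bigr => i _; rewrite mxE.
Qed.

Let sphere : set 'rV[R]_n := [set x | dotv x x = 1].

Let sphere_compact : compact sphere.
Proof.
apply: (@subclosed_compact _ _ [set x : 'rV[R]_n | forall i, `[(-1)%R, 1%R]%classic (x 0 i)]).
- apply: (@preimage_closed _ _ (fun x : 'rV[R]_n => dotv x x) [set y | y = 1]).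
    by move=> x _; exact: continuous_dotv.
  exact: closed_eq.
- exact: (@rV_compact R n (fun=> `[(-1)%R, 1%R]%classic) (fun=> @segment_compact R (-1) 1)).
- move=> x /= x1 i; rewrite in_itv/= -ler_norml -(ler_pXn2r (n := 2))// ?nnegrE//.
  rewrite expr1n real_normK ?num_real// -x1 dotvE (bigD1 i)//= -expr2 lerDl.
  by apply: sumr_ge0 => j _; rewrite -expr2 sqr_ge0.
Qed.

(** The Rayleigh quotient attains its maximum on the compact unit sphere, and
    the first-order condition at a maximiser is the eigenvalue equation. *)
Lemma rayleigh_max : exists a, eigenvalue A a /\ forall y, form y <= a * dotv y y.
Proof.
have S0 : sphere !=set0.
  exists (delta_mx 0 (Ordinal n0)); rewrite /sphere /= dotvE (bigD1 (Ordinal n0))//=.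
  rewrite big1 ?addr0 => [|j j0]; rewrite !mxE ?eqxx ?mulr1//.
  by rewrite (negbTE j0) mul0r.
have [x0 x01 x0max] := EVT_max_rV S0 sphere_compact (continuous_subspaceT continuous_form).
have {}x01 : dotv x0 x0 = 1 by move/set_mem : x01.
pose a := form x0.
have amax y : form y <= a * dotv y y.
  have [->|y0] := eqVneq y 0; first by rewrite mul0mx /dotv !mul0mx mxE mulr0.
  have yy := dotv_gt0 y0; pose c := (Num.sqrt (dotv y y))^-1.
  have c2 : c * c = (dotv y y)^-1 by rewrite -expr2 exprVn sqr_sqrtr// ltW.
  have /x0max : (c *: y) \in sphere.
    by apply/mem_set; rewrite /sphere /= dotvZl dotvZr mulrA c2 mulVf// gt_eqF.
  by rewrite -scalemxAl dotvZl dotvZr mulrA c2 mulrC ler_pdivrMr.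
exists a; split => //; apply/eigenvalueP; exists x0; last first.
  by rewrite -dotv_eq0 x01 oner_eq0.
have [g gE] : exists g, g = x0 *m A - a *: x0 by eexists.
apply/eqP; rewrite -subr_eq0 -gE -dotv_eq0.
set N := dotv g g; have N0 : 0 <= N by exact: dotv_ge0.
(* first-order condition at the maximiser in the direction g *)
have H t : 2 * t * N + t ^+ 2 * (form g - a * N) <= 0.
  have := amax (x0 + t *: g).
  rewrite mulmxDl -scalemxAl !(dotvDl, dotvDr, dotvZl, dotvZr) x01 -/N.
  rewrite [dotv (g *m A) x0]dotv_mulmx Asym (dotvC g (x0 *m A)) (dotvC g x0) -/a.
  have -> : dotv (x0 *m A) g = N + a * dotv x0 g.
    by rewrite -[x0 *m A](subrK (a *: x0)) -gE dotvDl dotvZl.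
  set e := dotv x0 g; set f := form g => h; lra.
have [//|N1] := eqVneq N 0.
have {}N1 : 0 < N by rewrite lt_neqAle eq_sym N1.
pose K := `|form g - a * N| + 1; have K0 : 0 < K by rewrite ltr_wpDl.
have := H (N / K); have : `|form g - a * N| <= K by rewrite lerDl.
rewrite ler_norml => /andP[+ _]; set d := _ - _ => dK.
have -> : 2 * (N / K) * N + (N / K) ^+ 2 * d = (N / K) ^+ 2 * (2 * K + d).
  by field; rewrite gt_eqF.
rewrite pmulr_rle0 ?exprn_gt0 ?divr_gt0//; lra.
Qed.

Lemma lambda1P : eigenvalue A (lambda1 A) /\
  forall y, form y <= lambda1 A * dotv y y.
Proof.
have [a [ea amax]] := rayleigh_max.
suff -> : lambda1 A = a by [].
have ub b : eigenvalue A b -> b <= a.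
  move=> /eigenvalueP[v vA v0]; have := amax v.
  by rewrite vA dotvZl ler_pM2r// dotv_gt0.
apply/le_anti/andP; split.
  by apply: ge_sup; [exists a|move=> b; exact: ub].
by apply: ub_le_sup => //; exists a => b; exact: ub.
Qed.

Lemma lambda1_le t : (forall y, form y <= t * dotv y y) -> lambda1 A <= t.
Proof.
move=> H; have [/eigenvalueP[v vA v0] _] := lambda1P.
by have := H v; rewrite vA dotvZl ler_pM2r// dotv_gt0.
Qed.

End rayleigh.

(** * A symmetric matrix split along a unit vector *)

Section compression_spectrum.
Context (R : realType) (n : nat) (u : 'rV[R]_n) (H : 'M[R]_n).
Hypotheses (n0 : (0 < n)%N) (u1 : dotv u u = 1) (Hsym : H^T = H).
Local Notation P := (oproj u).
Local Notation B := (rcomp u H).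
Local Notation Bp := (rcomp_pow u H).
Local Notation r := (rside_row u H).
Local Notation h := (rdiag u H).
Local Notation q := (rside_moment u H).

Let PP : P *m P = P. Proof. exact: oproj_idem. Qed.
Let PT : P^T = P. Proof. exact: oproj_tr. Qed.

Lemma rcomp_tr : B^T = B.
Proof. by rewrite /rcomp !trmx_mul PT Hsym mulmxA. Qed.

Let BP : B *m P = B. Proof. by rewrite /rcomp -[LHS]mulmxA PP. Qed.
Let PB : P *m B = B. Proof. by rewrite /rcomp !mulmxA PP. Qed.

Let BpS k : Bp k.+1 = B *m Bp k. Proof. by []. Qed.

Let BpD a b : Bp a *m Bp b = Bp (a + b).
Proof.
elim: a => [|a IH]; last by rewrite addSn !BpS -IH mulmxA.
by case: b => [|b]; [exact: PP|rewrite add0n BpS mulmxA PB].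
Qed.

Let BpB k : Bp k *m B = Bp k.+1.
Proof. by rewrite -[B in LHS]BP -[B *m P]/(Bp 1) BpD addn1. Qed.

Lemma rcomp_pow_tr k : (Bp k)^T = Bp k.
Proof. by elim: k => [|k IH]; [exact: PT|rewrite BpS trmx_mul IH rcomp_tr BpB]. Qed.

Lemma trace_rcomp_pow_even_ge0 l : 0 <= \tr (Bp (2 * l)).
Proof.
rewrite mul2n -addnn -BpD -{1}(rcomp_pow_tr l) /mxtrace; apply: sumr_ge0 => i _.
rewrite mxE; apply: sumr_ge0 => j _.
by rewrite [_^T i j]mxE -expr2 sqr_ge0.
Qed.

(** The norm of a row is at most the Frobenius norm of the matrix times that of
    the vector; [\tr (C^T *m C)] is the square of the Frobenius norm. *)
Let frobenius m (v : 'rV[R]_m) (C : 'M[R]_m) :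
  dotv (v *m C) (v *m C) <= dotv v v * \tr (C^T *m C).
Proof.
rewrite dotvE /mxtrace mulr_sumr; apply: ler_sum => j _.
have e1 : (v *m C) 0 j = dotv v (col j C)^T by rewrite /dotv trmxK [col j C]colE mulmxA -colE [RHS]mxE.
have e2 : (C^T *m C) j j = dotv (col j C)^T (col j C)^T.
  by rewrite dotvE mxE; apply: eq_bigr => i _; rewrite !mxE.
by rewrite -expr2 e1 e2 dotv_cauchy.
Qed.

Let eigenvalue_bound (bet a : R) l : (0 < l)%N -> 0 <= bet ->
  \tr (Bp (2 * l)) <= bet ^+ (2 * l) -> eigenvalue B a -> `|a| <= bet.
Proof.
move=> l0 b0 trb /eigenvalueP[v vB v0].
have [->|a0] := eqVneq a 0; first by rewrite normr0.
have vP : v *m P = v.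
  by apply: (scalerI a0); rewrite scalemxAl -vB -mulmxA BP.
have vBp k : v *m Bp k = a ^+ k *: v.
  elim: k => [|k IH]; first by rewrite expr0 scale1r.
  by rewrite BpS mulmxA vB -scalemxAl IH scalerA exprS.
have := frobenius v (Bp l); rewrite rcomp_pow_tr BpD addnn -mul2n vBp.
rewrite dotvZl dotvZr mulrA -expr2 -exprM mulrC ler_pM2l ?dotv_gt0// => al.
have : `|a| ^+ (2 * l) <= bet ^+ (2 * l).
  apply: le_trans trb; apply: le_trans al.
  by rewrite exprM real_normK ?num_real// -exprM [(l * 2)%N]mulnC.
by rewrite ler_pXn2r ?nnegrE// muln_gt0.
Qed.

(** An even power of an eigenvalue is at most the trace of that power.  The
    lower bound of the form comes from the largest eigenvalue of [- B]. *)
Lemma compression_bound (bet : R) l : (0 < l)%N -> 0 <= bet ->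
  \tr (Bp (2 * l)) <= bet ^+ (2 * l) ->
  forall y, `|dotv (y *m B) y| <= bet * dotv y y.
Proof.
move=> l0 b0 trb y; rewrite ler_norml; apply/andP; split; last first.
  have [eB maxB] := lambda1P n0 rcomp_tr.
  rewrite (le_trans (maxB y))// ler_wpM2r ?dotv_ge0//.
  by rewrite (le_trans (ler_norm _))// (eigenvalue_bound l0 b0 trb).
have NBT : (- B)^T = - B by rewrite linearN /= rcomp_tr.
have [/eigenvalueP[v vB v0] maxB] := lambda1P n0 NBT.
rewrite lerNl; have := maxB y; rewrite mulmxN dotvNl => /le_trans; apply.
rewrite ler_wpM2r ?dotv_ge0// (le_trans (ler_norm _))// -normrN.
apply: (eigenvalue_bound l0 b0 trb); apply/eigenvalueP; exists v => //.
by rewrite scaleNr -vB mulmxN opprK.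
Qed.

Lemma form_split (a : R) y : y *m P = y ->
  dotv ((a *: u + y) *m H) (a *: u + y) =
  a ^+ 2 * h + 2 * a * dotv r y + dotv (y *m B) y.
Proof.
move=> yP; rewrite mulmxDl -scalemxAl !(dotvDl, dotvDr, dotvZl, dotvZr).
have -> : dotv (y *m H) u = dotv (u *m H) y by rewrite dotv_mulmx Hsym dotvC.
have -> : dotv r y = dotv (u *m H) y by rewrite /rside_row dotv_mulmx PT yP.
have -> : dotv (y *m B) y = dotv (y *m H) y.
  by rewrite /rcomp mulmxA dotv_mulmx PT yP mulmxA yP.
by rewrite /rdiag; ring.
Qed.

Let uy (y : 'rV[R]_n) : y *m P = y -> dotv u y = 0.
Proof. by move=> yP; rewrite dotvC -yP dotv_mulmx PT mul_oproj// /dotv trmx0 mulmx0 mxE. Qed.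

Lemma norm_split (a : R) y : y *m P = y ->
  dotv (a *: u + y) (a *: u + y) = a ^+ 2 + dotv y y.
Proof.
move=> yP; rewrite !(dotvDl, dotvDr, dotvZl, dotvZr) u1 (dotvC y u) uy//; ring.
Qed.

Lemma split_vector x : exists a y, y *m P = y /\ x = a *: u + y.
Proof.
exists (dotv x u), (x *m P); split; first by rewrite -mulmxA PP.
rewrite /oproj mulmxBr mulmx1 mulmxA dotv_mx mul_scalar_mx.
by rewrite addrC subrK.
Qed.

Section resolvent.
Variables (lam : R) (K : nat).
Hypothesis lam0 : 0 < lam.

Definition side_stieltjes j : R := \sum_(0 <= k < j) q k / lam ^+ k.+1.
Local Notation Q := side_stieltjes.

Let rB k : 'rV[R]_n := r *m Bp k.
Let z : 'rV[R]_n := \sum_(0 <= k < K) (lam ^+ k.+1)^-1 *: rB k.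
Let e : 'rV[R]_n := - ((lam ^+ K)^-1 *: rB K).

Let rBP k : rB k *m P = rB k.
Proof. by rewrite /rB -mulmxA -[P]/(Bp 0) BpD addn0. Qed.

Let rP : r *m P = r. Proof. by rewrite /rside_row -mulmxA PP. Qed.

Let rB0 : rB 0 = r. Proof. exact: rP. Qed.

Let dot_rB i j : dotv (rB i) (rB j) = q (i + j)%N.
Proof.
rewrite /rB dotv_mulmx rcomp_pow_tr -mulmxA BpD dotvC addnC.
by rewrite /rside_moment addnC.
Qed.

Let zP : z *m P = z.
Proof.
by rewrite /z mulmx_suml; apply: eq_bigr => k _; rewrite -scalemxAl rBP.
Qed.

(** [z] is the Neumann series of the resolvent row [r (lam - B)^-1] truncated at
    level [K], and [e] is the remainder. *)
Let z_resolvent : lam *: z - z *m B = r + e.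
Proof.
rewrite /z mulmx_suml scaler_sumr -sumrB.
pose f k := - ((lam ^+ k)^-1 *: rB k).
transitivity (\sum_(0 <= k < K) (f k.+1 - f k)).
  apply: eq_bigr => k _; rewrite /f opprK addrC scalerA; congr (_ + _ *: _).
    by rewrite -scalemxAl /rB -mulmxA BpB.
  have lk : lam ^+ k != 0 by rewrite expf_neq0// gt_eqF.
  by rewrite exprS; field; rewrite lk gt_eqF.
by rewrite telescope_sumr// /f expr0 invr1 scale1r rB0 opprK addrC.
Qed.

Let dotv_sum_r (I : Type) (s : seq I) (F : I -> 'rV[R]_n) x :
  dotv x (\sum_(i <- s) F i) = \sum_(i <- s) dotv x (F i).
Proof.
elim: s => [|i s IH]; first by rewrite !big_nil /dotv trmx0 mulmx0 mxE.
by rewrite !big_cons dotvDr IH.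
Qed.

Let dot_rz : dotv r z = Q K.
Proof.
rewrite /z dotv_sum_r /Q; apply: eq_bigr => k _.
by rewrite dotvZr -[X in dotv X]rB0 dot_rB mulrC.
Qed.

Let dot_ez : dotv e z = Q K - Q (K + K).
Proof.
rewrite /z dotv_sum_r /Q (big_cat_nat (leq0n K) (leq_addr K K)) /=.
rewrite opprD addNKr -{2}[K]add0n big_addn addnK -sumrN.
apply: eq_bigr => k _; rewrite /e dotvZr dotvNl dotvZl dot_rB.
rewrite mulrN mulrA -invfM -exprD addSn [(K + k)%N]addnC.
by rewrite mulrC.
Qed.

Let dot_ee : dotv e e = q (K + K) / lam ^+ (K + K).
Proof.
rewrite /e dotvNl dotvNr opprK dotvZl dotvZr dot_rB mulrA -invfM -exprD.
by rewrite mulrC.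
Qed.

(** In the coordinates [a] and [y], centred at the approximate eigenvector
    [u + z], the form of [lam - H] is diagonal up to the remainder [e]: the
    Schur complement of the block appears as the coefficient of [a ^+ 2]. *)
Let gap (a : R) y : y *m P = y ->
  lam * dotv (a *: u + (a *: z + y)) (a *: u + (a *: z + y)) -
  dotv ((a *: u + (a *: z + y)) *m H) (a *: u + (a *: z + y)) =
  a ^+ 2 * (lam - h - Q (K + K)) + 2 * a * dotv e y +
  (lam * dotv y y - dotv (y *m B) y).
Proof.
move=> yP; have zyP : (a *: z + y) *m P = a *: z + y.
  by rewrite mulmxDl -scalemxAl zP yP.
rewrite norm_split// form_split//.
rewrite mulmxDl -scalemxAl !(dotvDl, dotvDr, dotvZl, dotvZr) (dotvC y z) dot_rz.
have := dot_ez; have : z *m B = lam *: z - (r + e).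
  by rewrite -z_resolvent opprB addrC subrK.
move: e => f zB dot_fz.
have -> : dotv (y *m B) z = dotv (z *m B) y by rewrite dotv_mulmx rcomp_tr dotvC.
rewrite zB !(dotvDl, dotvNl, dotvZl) dot_rz dot_fz.
set yy := dotv y y; set yB := dotv _ y; ring.
Qed.

(** The test vector is [u + z]. *)
Lemma lambda1_gt : lam - h - Q (K + K) < 0 -> lam < lambda1 H.
Proof.
move=> neg; have [_ maxH] := lambda1P n0 Hsym.
have y0 : (0 : 'rV[R]_n) *m P = 0 by rewrite mul0mx.
have := gap 1 y0; rewrite mul0mx !scale1r addr0.
have d0 (x : 'rV[R]_n) : dotv x 0 = 0 by rewrite /dotv trmx0 mulmx0 mxE.
rewrite !d0 !mulr0 subr0 !addr0 expr1n mul1r.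
move=> gapE; have := maxH (u + z).
have pos : 0 < dotv (u + z) (u + z).
  have := norm_split 1 zP; rewrite scale1r expr1n => ->.
  by rewrite ltr_pwDl// dotv_ge0.
move=> le; rewrite -(ltr_pM2r pos) (lt_le_trans _ le)// -subr_lt0 gapE.
exact: neg.
Qed.

(** Completing the square in the identity [gap]: the cross term [2 a <e, y>] is
    dominated by the two diagonal terms. *)
Lemma lambda1_upper (bet : R) : bet < lam ->
  (forall y, dotv (y *m B) y <= bet * dotv y y) ->
  0 <= lam - h - Q (K + K) ->
  q (K + K) / lam ^+ (K + K) <= (lam - h - Q (K + K)) * (lam - bet) ->
  lambda1 H <= lam.
Proof.
move=> bl yB c0 ce; apply: lambda1_le => // x.
have [a [y [yP ->]]] := split_vector x.
have y'P : (y - a *: z) *m P = y - a *: z.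
  by rewrite mulmxBl -scalemxAl zP yP.
have := gap a y'P; rewrite [a *: z + _]addrC subrK => gapE.
rewrite -subr_ge0 gapE; have := yB (y - a *: z); have := dotv_cauchy e (y - a *: z).
rewrite dot_ee; have := dotv_ge0 (y - a *: z).
move: ce c0; set s := dotv _ (_ - _); set t := dotv e _; set c := lam - h - _.
set E := q _ / _; move=> ce c0 s0 te yB'.
have ds : 0 < lam - bet by rewrite subr_gt0.
have te' : t ^+ 2 <= c * (lam - bet) * s by rewrite (le_trans te)// ler_wpM2r.
apply: (@le_trans _ _ (a ^+ 2 * c + 2 * a * t + (lam - bet) * s)); last first.
  by rewrite lerD2l mulrBl lerB.
have [s00|sn0] := eqVneq s 0.
  have t0 : t = 0.
    by apply/eqP; rewrite -sqrf_eq0 eq_le sqr_ge0 andbT (le_trans te')// s00 mulr0.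
  by rewrite t0 s00 !mulr0 !addr0 mulr_ge0// sqr_ge0.
have {sn0} sp : 0 < s by rewrite lt_neqAle eq_sym sn0.
have dsp : 0 < (lam - bet) * s by rewrite mulr_gt0.
rewrite -(pmulr_lge0 _ dsp).
have -> : (a ^+ 2 * c + 2 * a * t + (lam - bet) * s) * ((lam - bet) * s) =
  ((lam - bet) * s + a * t) ^+ 2 + a ^+ 2 * (c * (lam - bet) * s - t ^+ 2) by ring.
by rewrite addr_ge0 ?sqr_ge0// mulr_ge0 ?sqr_ge0// subr_ge0.
Qed.

End resolvent.

Lemma form_abs_le (bet : R) : 0 <= bet ->
  (forall y, `|dotv (y *m B) y| <= bet * dotv y y) ->
  forall x, `|dotv (x *m H) x| <= (`|h| + 1 + q 0 + bet) * dotv x x.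
Proof.
move=> b0 yB x; have [a [y [yP ->]]] := split_vector x.
rewrite norm_split// form_split//.
have q0 : q 0 = dotv r r.
  by rewrite /rside_moment /= /rside_row -[_ *m P *m P]mulmxA PP.
have rr := dotv_ge0 r; have yy := dotv_ge0 y.
have cs := dotv_cauchy r y; have yBy := yB y.
rewrite q0; set t := dotv r y in cs *; set s := dotv y y in yy cs yBy *.
have h1 : `|2 * a * t| <= a ^+ 2 + dotv r r * s.
  apply: (@le_trans _ _ (a ^+ 2 + t ^+ 2)); last by rewrite lerD2l.
  by rewrite ler_norml; have := sqr_ge0 (a - t); have := sqr_ge0 (a + t); nra.
have a20 := sqr_ge0 a; have ah := normr_ge0 h.
have n1 : `|a ^+ 2 * h| = a ^+ 2 * `|h| by rewrite normrM ger0_norm.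
apply: (le_trans (ler_normD _ _)); apply: (le_trans (lerD (ler_normD _ _) (lexx _))).
rewrite n1; apply: (@le_trans _ _ (a ^+ 2 * `|h| + (a ^+ 2 + dotv r r * s) + bet * s)).
  by rewrite lerD// lerD.
rewrite -subr_ge0; set rr' := dotv r r in rr *.
have -> : (`|h| + 1 + rr' + bet) * (a ^+ 2 + s) -
  (a ^+ 2 * `|h| + (a ^+ 2 + rr' * s) + bet * s) =
  s * `|h| + s + a ^+ 2 * rr' + a ^+ 2 * bet by ring.
by rewrite !addr_ge0// mulr_ge0.
Qed.

End compression_spectrum.

(** * From moments to the position of the largest eigenvalue *)

Section outlier_window.
Context (R : realType).
Local Notation c := (moment 3^-1 (0 : R) 0).
Local Notation St := (stieltjes 3^-1 (0 : R) 0).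

Lemma side_stieltjes_near n (u : 'rV[R]_n) H (lam eta : R) j : 1 <= lam ->
  (forall k, (k < j)%N -> `|rside_moment u H k - c k| <= eta) ->
  `|side_stieltjes u H lam j - St lam j| <= j%:R * eta.
Proof.
move=> lam1; elim: j => [|j IH] qc.
  by rewrite /side_stieltjes /stieltjes !big_geq// subr0 normr0 mul0r.
rewrite /side_stieltjes /stieltjes !big_nat_recr//= opprD addrACA -mulrBl.
rewrite -[j.+1%:R]natr1 [in leRHS]mulrDl mul1r (le_trans (ler_normD _ _))// lerD//.
  by apply: IH => k kj; apply: qc; rewrite ltnS ltnW.
have l1 : 1 <= lam ^+ j.+1 by rewrite exprn_ege1.
rewrite normrM normfV (ger0_norm (le_trans ler01 l1)).
apply: le_trans (qc j (ltnSn j)); rewrite ler_pdivrMr ?(lt_le_trans ltr01)//.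
by rewrite ler_peMr.
Qed.

Variable lam0 : R.
Hypotheses (lam0_gt0 : 0 < lam0) (lam0E : lam0 ^+ 2 = 3 / 2).
Local Notation bet := (122 / 100 : R).

Let lam0_gt : bet < lam0.
Proof. by rewrite -(ltr_pXn2r (n := 2))// ?nnegrE ?ltW// lam0E; lra. Qed.

Let c_le k : c k <= lam0 * lam0 ^+ k.+1.
Proof.
apply: (@moment_le _ _ _ _ _ _ _ _ _ 0) => //; try exact: ltW.
  by move=> j; rewrite big1// => i _; rewrite mul0r.
by rewrite -expr2 lam0E; lra.
Qed.

(** At [lam0 + eps] the truncated Stieltjes transform is at most [lam0], which
    leaves a gap [eps / 2] in [lambda1_upper] whatever the level [K]; the level
    is then chosen so that the remainder, of size [(lam0 / lam) ^+ (K + K)],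
    is small with respect to [eps ^+ 2]. *)
Lemma lambda1_upper_window (eps : R) : 0 < eps -> exists N eta,
  0 < eta /\ forall n (u : 'rV[R]_n) H, (0 < n)%N -> dotv u u = 1 -> H^T = H ->
  (forall y, dotv (y *m rcomp u H) y <= bet * dotv y y) ->
  `|rdiag u H| <= eta ->
  (forall k, (k < N)%N -> `|rside_moment u H k - c k| <= eta) ->
  lambda1 H <= lam0 + eps.
Proof.
move=> e0; set lam := lam0 + eps.
have lam_gt0 : 0 < lam by rewrite addr_gt0.
have lam_gt1 : 1 <= lam by rewrite /lam; move: lam0_gt e0; lra.
have th1 : `|lam0 / lam| < 1.
  rewrite ger0_norm; last by rewrite divr_ge0// ltW.
  by rewrite ltr_pdivrMr// mul1r ltrDl.
have [K _ HK] : \forall K \near \oo, `|(lam0 / lam) ^+ K| < eps ^+ 2 / 8.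
  have e8 : 0 < eps ^+ 2 / 8 by rewrite divr_gt0// exprn_gt0.
  have /cvgrPdist_lt/(_ _ e8) := cvg_expr th1.
  by apply: filterS => K; rewrite sub0r normrN.
have {HK} := HK (K + K)%N (leq_addr _ _).
rewrite ger0_norm; last by rewrite exprn_ge0// divr_ge0// ltW.
move=> HK.
pose D : R := (K + K)%:R + 1.
have D0 : 0 < D by rewrite ltr_wpDl.
exists (K + K).+1, (Num.min (eps / 2 / D) (eps ^+ 2 / 4)); split.
  by rewrite lt_min !divr_gt0// exprn_gt0.
move=> n u H n0 u1 Hsym yB; set eta := Num.min _ _ => hh hq.
have eta1 : eta * D <= eps / 2 by rewrite -ler_pdivlMr// ge_min lexx.
have eta2 : eta <= eps ^+ 2 / 4 by rewrite ge_min lexx orbT.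
have Qn := side_stieltjes_near lam_gt1 (fun k kK => hq k (ltnW kK)).
have Sle : St lam (K + K) <= lam0 by apply: stieltjes_le_outlier; rewrite ?lerDl ?ltW.
have gapE : eps / 2 <= lam - rdiag u H - side_stieltjes u H lam (K + K).
  move: hh Qn eta1; rewrite !ler_norml /D mulrDr mulr1 mulrC.
  move=> /andP[_ hh] /andP[_ Qn] eta1; rewrite /lam; lra.
apply: (lambda1_upper n0 u1 Hsym lam_gt0 (K := K) (bet := bet)) => //.
- by rewrite /lam; move: lam0_gt e0; lra.
- by rewrite (le_trans _ gapE)// divr_ge0// ltW.
have eb : eps <= lam - bet by rewrite /lam; move: lam0_gt; lra.
apply: (@le_trans _ _ (eps / 2 * eps)); last first.
  by apply: ler_pM => //; rewrite ?divr_ge0// ltW.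
have lK : 1 <= lam ^+ (K + K) by rewrite exprn_ege1.
have qle : rside_moment u H (K + K) <= lam0 * lam0 ^+ (K + K).+1 + eta.
  move: (hq _ (ltnSn _)) (c_le (K + K)%N); rewrite ler_norml => /andP[_ h1] h2.
  by move: h1 h2; clear; set a := lam0 * _; set b := rside_moment _ _ _; set c' := c _; lra.
apply: (le_trans (ler_wpM2r _ qle)); first by rewrite invr_ge0 exprn_ge0// ltW.
have -> : (lam0 * lam0 ^+ (K + K).+1 + eta) / lam ^+ (K + K) =
    3 / 2 * (lam0 / lam) ^+ (K + K) + eta / lam ^+ (K + K).
  by rewrite expr_div_n exprS mulrDl -lam0E; congr (_ + _); ring.
have : eta / lam ^+ (K + K) <= eta.
  rewrite ler_pdivrMr ?(lt_le_trans ltr01)// ler_peMr//.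
  by rewrite le_min !divr_ge0 ?exprn_ge0 ?(ltW _).
by move: HK eta2; clear; set a := _ / lam ^+ _; set b := (_ / _) ^+ _; nra.
Qed.

(** Below [lam0] some truncation of the Stieltjes transform exceeds [lam], and
    [lambda1_gt] applies.  The maximum with 1 matters only when [eps] is
    large, and keeps the powers of [lam] in the denominators at least 1. *)
Lemma lambda1_lower_window (eps : R) : 0 < eps -> exists N eta,
  0 < eta /\ forall n (u : 'rV[R]_n) H, (0 < n)%N -> dotv u u = 1 -> H^T = H ->
  `|rdiag u H| <= eta ->
  (forall k, (k < N)%N -> `|rside_moment u H k - c k| <= eta) ->
  lam0 - eps <= lambda1 H.
Proof.
move=> e0; pose lam := Num.max 1 (lam0 - eps).
have lam_ge1 : 1 <= lam by rewrite le_max lexx.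
have lam_gt0 : 0 < lam by rewrite (lt_le_trans ltr01).
have lam_lt : lam < lam0.
  by rewrite gt_max ltrBlDr ltrDl e0 andbT; move: lam0_gt; lra.
have lam2 : lam ^+ 2 < 3 / 2 by rewrite -lam0E ltr_pXn2r// nnegrE ltW.
have [K HK] := stieltjes_gt_below lam_gt0 lam2.
have {}HK : lam < St lam (K + K).
  rewrite (lt_le_trans HK)// /stieltjes [leRHS](big_cat_nat (leq0n K) (leq_addr K K))//=.
  rewrite lerDl sumr_ge0// => k _; apply: divr_ge0; last by rewrite exprn_ge0// ltW.
  by apply: moment_ge0 => //; rewrite invr_ge0.
pose D : R := (K + K)%:R + 2.
have D0 : 0 < D by rewrite ltr_wpDl.
pose g := St lam (K + K) - lam.
have g0 : 0 < g by rewrite subr_gt0.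
exists (K + K)%N, (g / D); split; first by rewrite divr_gt0.
move=> n u H n0 u1 Hsym hh hq.
have etaE : (g / D) * D = g by rewrite divfK// gt_eqF.
have eta0 : 0 < g / D by rewrite divr_gt0.
apply: (@le_trans _ _ lam); first by rewrite le_max lexx orbT.
apply/ltW/(lambda1_gt n0 u1 Hsym lam_gt0 (K := K)).
have := side_stieltjes_near lam_ge1 hq.
move: hh etaE eta0; rewrite /D; set eta := g / _; rewrite mulrDr !ler_norml.
move=> /andP[hh _] etaE eta0 /andP[Qn _].
by move: hh etaE eta0 Qn; rewrite /g mulrC; set A := side_stieltjes _ _ _ _;
  set B := St _ _; set Z := (K + K)%:R * eta; lra.
Qed.

(** The deterministic part of the argument: closeness of finitely many numbers
    to their limits, and one trace bound, locate the largest eigenvalue.  The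
    constant 10 is a crude upper bound for [1 + 1 + 2 + bet], which is what
    [form_abs_le] gives when all deviations are at most 1. *)
Lemma outlier_window (eps : R) : 0 < eps -> exists N eta,
  0 < eta /\ forall n (u : 'rV[R]_n) H l, (0 < n)%N -> (0 < l)%N -> dotv u u = 1 -> H^T = H ->
  `|rdiag u H| <= eta ->
  (forall k, (k < N)%N -> `|rside_moment u H k - c k| <= eta) ->
  \tr (rcomp_pow u H (2 * l)) <= bet ^+ (2 * l) ->
  `|lambda1 H - lam0| <= eps /\ forall x, `|dotv (x *m H) x| <= 10 * dotv x x.
Proof.
move=> e0; have [N1 [eta1 [eta10 H1]]] := lambda1_upper_window e0.
have [N2 [eta2 [eta20 H2]]] := lambda1_lower_window e0.
exists (maxn N1 N2).+1, (Num.min 1 (Num.min eta1 eta2)); split.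
  by rewrite !lt_min ltr01 eta10.
move=> n u H l n0 l0 u1 Hsym; rewrite le_min => /andP[h1]; rewrite le_min => /andP[hh1 hh2].
move=> hq tr; have b0 : 0 <= bet by lra.
have yB := compression_bound n0 u1 Hsym l0 b0 tr.
have hq' k : (k < (maxn N1 N2).+1)%N -> [/\ `|rside_moment u H k - c k| <= 1,
    `|rside_moment u H k - c k| <= eta1 & `|rside_moment u H k - c k| <= eta2].
  by move=> /hq; rewrite !le_min => /andP[? /andP[? ?]].
split.
  rewrite ler_distl; apply/andP; split.
    apply: (H2 n u H) => // k kN; have [|_ _ //] := hq' k.
    by rewrite ltnS ltnW// (leq_trans kN)// leq_maxr.
  apply: (H1 n u H) => // [y|k kN]; first by apply: le_trans (yB y); exact: ler_norm.
  have [|_ + _ //] := hq' k.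
  by rewrite ltnS ltnW// (leq_trans kN)// leq_maxl.
move=> x; apply: le_trans (form_abs_le u1 Hsym b0 yB x) _.
rewrite ler_wpM2r ?dotv_ge0//; have [//|+ _ _] := hq' 0%N.
by rewrite moment0 ler_norml => /andP[_]; move: h1; lra.
Qed.

End outlier_window.

(** * Concentration *)

Section small_failure.
Context (R : realType) d (T : measurableType d) (P : probability T R).

(** An event contained in [Q] with probability at least [1 - e].  The
    exceptional set is required to be measurable, so that [Q] need not be. *)
Definition fails_le (e : R) (Q : T -> Prop) : Prop :=
  exists E : set T, [/\ measurable E, (P E <= e%:E)%E & forall w, ~ E w -> Q w].

Lemma fails_leW (e e' : R) (Q Q' : T -> Prop) : e <= e' ->
  (forall w, Q w -> Q' w) -> fails_le e Q -> fails_le e' Q'.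
Proof.
move=> ee QQ [E [mE PE EQ]]; exists E; split => // [|w /EQ/QQ//].
by rewrite (le_trans PE)// lee_fin.
Qed.

Lemma fails_leI (e1 e2 : R) (Q1 Q2 : T -> Prop) :
  fails_le e1 Q1 -> fails_le e2 Q2 -> fails_le (e1 + e2) (fun w => Q1 w /\ Q2 w).
Proof.
move=> [E1 [mE1 PE1 EQ1]] [E2 [mE2 PE2 EQ2]]; exists (E1 `|` E2); split.
- exact: measurableU.
- by rewrite (le_trans (measureU2 _ mE1 mE2))// EFinD leeD.
- by move=> w nE; split; [apply: EQ1|apply: EQ2] => Ew; apply: nE; [left|right].
Qed.

Lemma fails_le_lt (e : R) N (Q : nat -> T -> Prop) :
  (forall k, (k < N)%N -> fails_le e (Q k)) ->
  fails_le (e *+ N) (fun w => forall k, (k < N)%N -> Q k w).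
Proof.
elim: N => [|N IH] H; first by exists set0; split => //; rewrite measure0.
have HN := fails_leI (IH (fun k kN => H k (ltnW kN))) (H N (ltnSn N)).
rewrite mulrSr; apply: fails_leW HN => // w [h1 h2] k.
by rewrite ltnS leq_eqVlt => /predU1P[->//|/h1].
Qed.

Lemma has_expectation_lin (f g : T -> R) (a b e1 e2 : R) :
  has_expectation P f e1 -> has_expectation P g e2 ->
  has_expectation P (fun w => a * f w + b * g w) (a * e1 + b * e2).
Proof.
move=> [if_ <-] [ig <-].
have ia : P.-integrable setT (EFin \o (fun w => a * f w)).
  by have := integrableZl measurableT a if_; apply.
have ib : P.-integrable setT (EFin \o (fun w => b * g w)).
  by have := integrableZl measurableT b ig; apply.
split; first by have := integrableD measurableT ia ib; apply.
by rewrite RintegralD// !RintegralZl.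
Qed.

Lemma has_expectation_cst (a : R) : has_expectation P (fun=> a) a.
Proof.
split; first exact: finite_measure_integrable_cst.
rewrite Rintegral_cst//; transitivity (a * 1); last by rewrite mulr1.
by congr (_ * _); exact: (congr1 fine (probability_setT P)).
Qed.

Lemma markov_fails_le (f : T -> R) (e t : R) : has_expectation P f e ->
  (forall w, 0 <= f w) -> 0 < t -> fails_le (e / t) (fun w => f w <= t).
Proof.
move=> [if_ fe] f0 t0; have mf := measurable_int P if_.
have mE : measurable [set w | (t%:E < (EFin \o f) w)%E].
  rewrite -[X in measurable X]setTI; apply: measurable_lte => //.
exists [set w | (t%:E < (EFin \o f) w)%E]; split => //; last first.
  by move=> w /= /negP; rewrite lte_fin -leNgt.
have fin : (\int[P]_w (f w)%:E = e%:E)%E.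
  by rewrite -fe /Rintegral fineK//; exact: integrable_fin_num.
rewrite mulrC EFinM lee_pdivlMl// -fin.
have -> : (t%:E * P [set w | (t%:E < (EFin \o f) w)%E] =
  \int[P]_(w in [set w | (t%:E < (EFin \o f) w)%E]) t%:E)%E.
  by rewrite integral_cst.
apply: (@le_trans _ _ (\int[P]_(w in [set w | (t%:E < (EFin \o f) w)%E]) (f w)%:E)%E).
  apply: ge0_le_integral => //.
  - by move=> w _; rewrite lee_fin ltW.
  - exact: measurable_funS mf.
  - by move=> w /= /ltW.
apply: ge0_subset_integral => //.
by move=> w _; rewrite lee_fin.
Qed.

Lemma chebyshev_fails_le (X : T -> R) (c e1 e2 eta : R) :
  has_expectation P X e1 -> has_expectation P (fun w => X w ^+ 2) e2 -> 0 < eta ->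
  fails_le ((e2 - 2 * c * e1 + c ^+ 2) / eta ^+ 2) (fun w => `|X w - c| <= eta).
Proof.
move=> h1 h2 eta0.
have h := has_expectation_lin 1 1
  (has_expectation_lin 1 (- (2 * c)) h2 h1) (has_expectation_cst (c ^+ 2)).
have /markov_fails_le H : has_expectation P (fun w => (X w - c) ^+ 2)
    (e2 - 2 * c * e1 + c ^+ 2).
  have -> : (fun w => (X w - c) ^+ 2) =
      (fun w => 1 * (1 * X w ^+ 2 + - (2 * c) * X w) + 1 * c ^+ 2).
    by apply/funext => w; ring.
  by have -> : e2 - 2 * c * e1 + c ^+ 2 = 1 * (1 * e2 + - (2 * c) * e1) + 1 * c ^+ 2 by ring.
apply: fails_leW (H (eta ^+ 2) _ _) => //; last by rewrite exprn_gt0.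
- by move=> w; rewrite -(real_normK (num_real (X w - c))) ler_pXn2r// nnegrE ltW.
- by move=> w; rewrite sqr_ge0.
Qed.

End small_failure.

Lemma near_all_lt N (Q : nat -> nat -> Prop) :
  (forall k, (k < N)%N -> \forall n \near \oo, Q k n) ->
  \forall n \near \oo, forall k, (k < N)%N -> Q k n.
Proof.
elim: N => [|N IH] H; first by near=> n.
have H1 := IH (fun k kN => H k (ltnW kN)); have H2 := H N (ltnSn N).
near=> n => k; rewrite ltnS leq_eqVlt => /predU1P[->|kN].
  by near: n.
by move: k kN; near: n.
Unshelve. all: by end_near. Qed.

Lemma contract2_tr (R : realType) n (G : 4.-tuple 'I_n -> R) (u v : 'rV[R]_n) :
  (forall s t : 4.-tuple 'I_n, perm_eq s t -> G s = G t) -> (contract2 G u v)^T = contract2 G u v.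
Proof.
move=> Gsym; apply/matrixP => i j; rewrite !mxE.
apply: eq_bigr => k _; apply: eq_bigr => l _; congr (_ * _ * _); apply: Gsym => /=.
by apply/permPl; exact: (perm_catCA [:: j] [:: i] [:: k; l]).
Qed.

(** The side moments concentrate because their second moments tend to the
    squares of their limits, and the norm of the block is controlled by one
    high trace power; both are turned into small exceptional events, and
    [outlier_window] does the rest. *)
Lemma outlier_in_probability (R : realType) (d : nat -> measure_display)
  (T : forall n, measurableType (d n)) (P : forall n, probability (T n) R)
  (G : forall n, 4.-tuple 'I_n -> {RV (P n) >-> R}) (f : forall n, 'rV[R]_n)
  (lam0 eps e : R) :
  (forall n, (0 < n)%N -> GOTE4 (G n)) ->
  (forall n, (0 < n)%N -> dotv (f n) (f n) = 1) ->
  0 < lam0 -> lam0 ^+ 2 = 3 / 2 -> 0 < eps -> 0 < e ->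
  \forall n \near \oo, fails_le (P n) e (fun w =>
    `|lambda1 (contraction (G n) (f n) w) - lam0| <= eps /\
    forall x, `|dotv (x *m contraction (G n) (f n) w) x| <= 10 * dotv x x).
Proof.
move=> hG f1 lam0_gt0 lam0E eps0 e0; pose c := moment 3^-1 (0 : R) 0.
pose H n w := contraction (G n) (f n) w.
have [N [eta [eta0 win]]] := outlier_window lam0_gt0 lam0E eps0.
have /choice[m mP] : forall n, exists m, (0 < n)%N -> [/\ trace_moments n m,
      forall k, has_expectation (P n) (fun w => \tr (rcomp_pow (f n) (H n w) k)) (m [:: k]),
      forall k, has_expectation (P n) (fun w => rside_moment (f n) (H n w) k)
        (n%:R^-1 * m [:: k]),
      forall k, has_expectation (P n) (fun w => rside_moment (f n) (H n w) k ^+ 2)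
        (n%:R^-1 ^+ 2 * (m [:: k; k] + 2 * m [:: (k + k)%N])) &
      has_expectation (P n) (fun w => rdiag (f n) (H n w)) 0 /\
      has_expectation (P n) (fun w => rdiag (f n) (H n w) ^+ 2) (4 / n%:R)].
  case=> [|n]; first by exists (fun=> 0).
  by have [m mP] := gote_moments (ltn0Sn n) (hG _ (ltn0Sn n)) (f1 _ (ltn0Sn n)); exists m.
have tm n : (0 < n)%N -> trace_moments n (m n) by move=> /mP[].
(* the budget [e] is shared by the corner, [N] side moments and one trace *)
pose e' : R := e / (N.+2)%:R.
have e'0 : 0 < e' by rewrite divr_gt0// ltr0n.
have eE : e' + e' *+ N + e' = e.
  by rewrite -mulrS -mulrSr -[LHS]mulr_natr divfK// pnatr_eq0.
have cvg_inv : (n%:R^-1 : R) @[n --> \oo] --> (0 : R).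
  by rewrite -cvg_shiftS; exact: cvg_harmonic.
have ee0 : 0 < e' * eta ^+ 2 by rewrite mulr_gt0// exprn_gt0.
(* the variance of the side moments vanishes *)
have qn : \forall n \near \oo, forall k, (k < N)%N ->
    n%:R^-1 ^+ 2 * (m n [:: k; k] + 2 * m n [:: (k + k)%N]) -
    2 * c k * (n%:R^-1 * m n [:: k]) + c k ^+ 2 <= e' * eta ^+ 2.
  apply: near_all_lt => k _.
  have h1 := @norm_traces_cvg R m tm [:: k]; have h2 := @norm_traces_cvg R m tm [:: k; k].
  have h3 := @norm_traces_cvg R m tm [:: (k + k)%N].
  rewrite big_seq1 in h1; rewrite big_seq1 in h3; rewrite big_cons big_seq1 in h2.
  have lim : (norm_traces n (m n) [:: k; k] + 2 * (n%:R^-1 * norm_traces n (m n) [:: (k + k)%N])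
     + - (2 * c k) * norm_traces n (m n) [:: k] + c k ^+ 2) @[n --> \oo] -->
     (c k * c k + 2 * (0 * c (k + k)%N) + - (2 * c k) * c k + c k ^+ 2).
    apply: cvgD; last exact: cvg_cst.
    apply: cvgD; last by apply: cvgM => //; exact: cvg_cst.
    apply: cvgD => //; apply: cvgM; first exact: cvg_cst.
    exact: cvgM.
  have l0 : c k * c k + 2 * (0 * c (k + k)%N) + - (2 * c k) * c k + c k ^+ 2 = 0 by ring.
  rewrite l0 in lim.
  have /cvgrPdist_le/(_ _ ee0) := lim; apply: filterS => n.
  rewrite sub0r normrN => /(le_trans (ler_norm _)); apply: le_trans.
  rewrite le_eqVlt; apply/orP; left; apply/eqP.
  rewrite /norm_traces -exprVn.
  by rewrite /size; ring.
have hn : \forall n \near \oo, 4 / n%:R <= e' * eta ^+ 2 :> R.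
  have : (4 / n%:R : R) @[n --> \oo] --> (4 * 0 : R) by apply: cvgM => //; exact: cvg_cst.
  rewrite mulr0 => /cvgrPdist_le/(_ _ ee0); apply: filterS => n.
  by rewrite sub0r normrN => /(le_trans (ler_norm _)).
have tn := trace_power_small tm e'0.
near=> n.
have n0 : (0 < n)%N by near: n; exists 1%N.
have [_ mt mq mq2 [mh mh2]] := mP n n0.
have [l l0 ml] : exists2 l, (0 < l)%N & m n [:: (2 * l)%N] <= e' * (122 / 100) ^+ (2 * l).
  by near: n.
have bl0 : 0 < (122 / 100 : R) ^+ (2 * l) by rewrite exprn_gt0//; lra.
have Hsym w : (H n w)^T = H n w.
  rewrite /contraction linearZ /= contract2_tr// => s t st.
  by have [Gs _ _] := hG n n0; exact: Gs.
have F1 : fails_le (P n) e' (fun w => `|rdiag (f n) (H n w)| <= eta).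
  apply: fails_leW (chebyshev_fails_le 0 mh mh2 eta0) => [|w]; last by rewrite subr0.
  by rewrite mulr0 subr0 expr0n /= addr0 ler_pdivrMr ?exprn_gt0//; near: n.
have F2 : fails_le (P n) (e' *+ N) (fun w => forall k, (k < N)%N ->
    `|rside_moment (f n) (H n w) k - c k| <= eta).
  apply: fails_le_lt => k kN.
  apply: fails_leW (chebyshev_fails_le (c k) (mq k) (mq2 k) eta0) => //.
  by rewrite ler_pdivrMr ?exprn_gt0//; move: k kN; near: n.
have F3 : fails_le (P n) e' (fun w =>
    \tr (rcomp_pow (f n) (H n w) (2 * l)) <= (122 / 100) ^+ (2 * l)).
  apply: fails_leW (markov_fails_le (mt (2 * l)%N) _ bl0) => //.
    by rewrite ler_pdivrMr.
  by move=> w; exact: (trace_rcomp_pow_even_ge0 (f1 n n0) (Hsym w)).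
rewrite -eE; apply: fails_leW (fails_leI (fails_leI F1 F2) F3) => // w [[w1 w2] w3].
by apply: (win n (f n) (H n w) l) => //; exact: f1.
Unshelve. all: by end_near. Qed.


(** * Measurability of the largest eigenvalue *)

Section largest_eigenvalue_measurable.
Context (R : realType) (n : nat).
Hypothesis n0 : (0 < n)%N.

Let rvec (y : 'rV[rat]_n) : 'rV[R]_n := \row_i ratr (y 0 i).

(** Rational vectors are dense, so countably many linear conditions on the
    entries of [A] suffice. *)
Lemma lambda1_le_rat (A : 'M[R]_n) t : A^T = A ->
  (forall y, dotv (rvec y *m A) (rvec y) <= t * dotv (rvec y) (rvec y)) ->
  lambda1 A <= t.
Proof.
move=> Asym H; apply: lambda1_le => // x; rewrite leNgt; apply/negP => lt.
pose F (y : 'rV[R]_n) := dotv (y *m A) y - t * dotv y y.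
have F0 : 0 < F x by rewrite subr_gt0.
have cF : {for x, continuous F}.
  exact: (cvgB (@continuous_form R n A x) (cvgM (cvg_cst t) (@continuous_dotv R n x))).
have /nbhs_ballP[e /= e0 xe] : \forall y \near x, 0 < F y.
  exact: (cvgr_gt _ cF _ F0).
have [q qP] : exists q : 'I_n -> rat, forall i, ball (x 0 i) e (ratr (q i)).
  suff /choice[q qP] : forall i, exists a : rat, ball (x 0 i) e (ratr a) by exists q.
  move=> i; have [|a] := @rat_in_itvoo R (x 0 i) (x 0 i + e); first by rewrite ltrDl.
  rewrite in_itv /= => /andP[h1 h2]; exists a; rewrite /ball /= distrC ger0_norm.
    by rewrite ltrBlDl.
  by rewrite subr_ge0 ltW.
have /xe : ball x e (rvec (\row_i q i)).
  by split => // i j; rewrite (ord1 i) !mxE; exact: qP.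
by rewrite /F subr_gt0 ltNge H.
Qed.

Context d (T : measurableType d) (H : T -> 'M[R]_n).
Hypothesis Hsym : forall w, (H w)^T = H w.
Hypothesis mH : forall i j, measurable_fun setT (fun w => H w i j).

Let measurable_form (y : 'rV[R]_n) : measurable_fun setT (fun w => dotv (y *m H w) y).
Proof.
rewrite (_ : (fun w => _) = (fun w => \sum_i (\sum_j y 0 j * H w j i) * y 0 i)).
  apply: measurable_sum => i; apply: measurable_funM; last exact: measurable_cst.
  by apply: measurable_sum => j; apply: measurable_funM => //; exact: measurable_cst.
by apply/funext => w; rewrite dotvE; apply: eq_bigr => i _; rewrite mxE.
Qed.

Lemma measurable_lambda1_le t : measurable [set w | lambda1 (H w) <= t].
Proof.
pose E k : set T := if unpickle k is Some y then
  [set w | dotv (rvec y *m H w) (rvec y) <= t * dotv (rvec y) (rvec y)] else setT.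
rewrite (_ : [set w | _] = \bigcap_k E k).
  apply: bigcapT_measurable => k; rewrite /E; case: (unpickle k) => [y|//].
  rewrite -[X in measurable X]setTI.
  have /measurable_EFinP mf := measurable_form (rvec y).
  exact: (measurable_lee measurableT mf
    (measurable_cst (t * dotv (rvec y) (rvec y))%:E)).
apply/seteqP; split => w /=.
  move=> le k _; rewrite /E; case: (unpickle k) => [y|//] /=.
  have [_ maxH] := lambda1P n0 (Hsym w); apply: le_trans (maxH _) _.
  by rewrite ler_wpM2r ?dotv_ge0.
move=> wE; apply: lambda1_le_rat => // y.
by have := wE (pickle y) I; rewrite /E pickleK.
Qed.

Lemma measurable_lambda1_dist c eps :
  measurable [set w | eps < `|lambda1 (H w) - c|].
Proof.
rewrite (_ : [set w | _] = ~` [set w | lambda1 (H w) <= c + eps] `|`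
    \bigcup_k [set w | lambda1 (H w) <= c - eps - k.+1%:R^-1]).
  apply: measurableU; first exact/measurableC/measurable_lambda1_le.
  by apply: bigcupT_measurable => k; exact: measurable_lambda1_le.
apply/seteqP; split => w /=.
  rewrite ltNge ler_distl negb_and -!ltNge => /orP[lt|lt]; last first.
    by left; apply/negP; rewrite -ltNge.
  right; have [k kP] := ltr_add_invr lt; exists k => //=.
  by rewrite lerBrDr ltW.
rewrite ltNge ler_distl negb_and -!ltNge => -[/negP|[k _ /= le]].
  by rewrite -ltNge => ->; rewrite orbT.
by apply/orP; left; rewrite (le_lt_trans le)// ltrBlDr ltrDl invr_gt0.
Qed.

End largest_eigenvalue_measurable.

(** * Polarisation and perturbation *)

(** The form of [A] differs from that of [M] by [s] times the forms of [M] and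
    [D], and the largest eigenvalue is the maximum of the Rayleigh quotient. *)
Lemma lambda1_perturb (R : realType) n (A M D : 'M[R]_n) s b : (0 < n)%N ->
  M^T = M -> D^T = D -> 0 <= s -> A = (1 - s) *: M - s *: D ->
  (forall x, `|dotv (x *m M) x| <= b * dotv x x) ->
  (forall x, `|dotv (x *m D) x| <= b * dotv x x) ->
  `|lambda1 A - lambda1 M| <= 2 * b * s.
Proof.
move=> n0 MT DT s0 AE Mb Db.
have AT : A^T = A by rewrite AE linearB /= !linearZ /= MT DT.
have formA y : `|dotv (y *m A) y - dotv (y *m M) y| <= 2 * b * s * dotv y y.
  have -> : dotv (y *m A) y - dotv (y *m M) y =
      - (s * (dotv (y *m M) y + dotv (y *m D) y)).
    by rewrite AE mulmxBr -!scalemxAr dotvDl dotvNl !dotvZl; ring.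
  rewrite normrN normrM (ger0_norm s0).
  have -> : 2 * b * s * dotv y y = s * (b * dotv y y + b * dotv y y) by ring.
  by rewrite ler_wpM2l// (le_trans (ler_normD _ _))// lerD.
have [_ maxA] := lambda1P n0 AT; have [_ maxM] := lambda1P n0 MT.
rewrite ler_distl; apply/andP; split.
  rewrite lerBlDr; apply: lambda1_le => // y; rewrite mulrDl.
  have := formA y; have := maxA y; rewrite ler_norml.
  by set a := dotv _ y; set m := dotv _ y => h1 /andP[h2 _]; lra.
apply: lambda1_le => // y; rewrite mulrDl.
have := formA y; have := maxM y; rewrite ler_norml.
by set a := dotv _ y; set m := dotv _ y => h1 /andP[_ h2]; lra.
Qed.

Section contraction_algebra.
Context (R : realType) (n : nat) (G : 4.-tuple 'I_n -> R).

Lemma contract2Z a (x : 'rV[R]_n) : contract2 G (a *: x) (a *: x) = a ^+ 2 *: contract2 G x x.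
Proof.
apply/matrixP => i j; rewrite !mxE mulr_sumr; apply: eq_bigr => k _.
by rewrite mulr_sumr; apply: eq_bigr => l _; rewrite !mxE; ring.
Qed.

Hypothesis Gsym : forall s t : 4.-tuple 'I_n, perm_eq s t -> G s = G t.

Lemma contract2C x y : contract2 G x y = contract2 G y x.
Proof.
apply/matrixP => i j; rewrite !mxE exchange_big /=; apply: eq_bigr => k _.
apply: eq_bigr => l _; rewrite mulrAC; congr (_ * _ * _); apply: Gsym => /=.
by rewrite !perm_cons; exact/permPl/(perm_catC [:: _] [:: _]).
Qed.

Lemma contract2_polar x y :
  contract2 G (x + y) (x - y) = contract2 G x x - contract2 G y y.
Proof.
have -> : contract2 G (x + y) (x - y) =
    contract2 G x x - contract2 G y y + (contract2 G y x - contract2 G x y).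
  apply/matrixP => i j; rewrite !mxE -!sumrB -big_split /=; apply: eq_bigr => k _.
  by rewrite -!sumrB -big_split /=; apply: eq_bigr => l _; rewrite !mxE; ring.
by rewrite (contract2C y) subrr addr0.
Qed.

End contraction_algebra.

(** The fallback [e] keeps the result a unit vector when [x = 0], a case that
    cannot be excluded since the two given vectors may coincide. *)
Definition direction (R : realType) n (e x : 'rV[R]_n) : 'rV[R]_n :=
  if x == 0 then e else (Num.sqrt (dotv x x))^-1 *: x.

Lemma direction_unit (R : realType) n (e x : 'rV[R]_n) : dotv e e = 1 ->
  dotv (direction e x) (direction e x) = 1.
Proof.
rewrite /direction; case: eqVneq => // x0 _.
by rewrite dotvZl dotvZr mulrA -expr2 exprVn sqr_sqrtr ?dotv_ge0// mulVf// dotv_eq0.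
Qed.

Lemma contract2_direction (R : realType) n (G : 4.-tuple 'I_n -> R) (e x : 'rV[R]_n) :
  contract2 G x x = dotv x x *: contract2 G (direction e x) (direction e x).
Proof.
rewrite /direction; case: eqVneq => [->|x0].
  have -> : 0 = (0 : R) *: (0 : 'rV[R]_n) by rewrite scale0r.
  by rewrite contract2Z dotvZl mul0r expr0n /= !scale0r.
rewrite contract2Z scalerA exprVn sqr_sqrtr ?dotv_ge0// mulfV ?scale1r//.
by rewrite dotv_eq0.
Qed.

(** * Two merging sequences of unit vectors *)

Unset Implicit Arguments.

Theorem corollary2p1 (R : realType)
    (d : nat -> measure_display) (T : forall n : nat, measurableType (d n))
    (P : forall n : nat, probability (T n) R)
    (G : forall n : nat, 4.-tuple 'I_n -> {RV (P n) >-> R})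
    (u v : forall n : nat, 'rV[R]_n)
    (hu : forall n : nat, (0 < n)%N -> unit_sphere (u n))
    (hv : forall n : nat, (0 < n)%N -> unit_sphere (v n))
    (hG : forall n : nat, (0 < n)%N -> GOTE4 (G n))
    (huv : (fun n : nat => l2norm (u n - v n)) @ \oo --> (0 : R)) :
  cvg_in_probability P
    (fun (n : nat) (w : T n) =>
       lambda1 ((Num.sqrt (n%:R : R))^-1 *:
                contract2 (fun s : 4.-tuple 'I_n => G n s w) (u n) (v n)))
    ((Num.sqrt 3)^-1 * (Num.sqrt 2 + (Num.sqrt 2)^-1)).
Proof.
have norm1 n x : @unit_sphere R n x -> dotv x x = 1.
  rewrite /unit_sphere /= l2normE => x1.
  by rewrite -[LHS]sqr_sqrtr ?dotv_ge0// x1 expr1n.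
set lam0 := (X in cvg_in_probability _ _ X).
have lam0_gt0 : 0 < lam0 by rewrite mulr_gt0 ?addr_gt0 ?invr_gt0 ?sqrtr_gt0.
have lam0E : lam0 ^+ 2 = 3 / 2.
  have s2 : Num.sqrt (2 : R) != 0 by rewrite gt_eqF// sqrtr_gt0.
  rewrite /lam0 exprMn exprVn sqr_sqrtr// sqrrD exprVn sqr_sqrtr// mulfV//.
  by field.
pose x n := 2^-1 *: (u n + v n); pose y n := 2^-1 *: (u n - v n).
have uE n : u n = x n + y n.
  rewrite /x /y -scalerDr addrACA subrr addr0 -mulr2n -[u n *+ 2]scaler_nat scalerA.
  by rewrite mulVf ?scale1r.
have vE n : v n = x n - y n.
  rewrite /x /y -scalerBr opprB [u n + v n]addrC addrACA subrr addr0.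
  by rewrite -mulr2n -[v n *+ 2]scaler_nat scalerA mulVf ?scale1r.
pose f n := direction (u n) (x n); pose g n := direction (u n) (y n).
have f1 n : (0 < n)%N -> dotv (f n) (f n) = 1 by move=> n0; exact/direction_unit/norm1/hu.
have g1 n : (0 < n)%N -> dotv (g n) (g n) = 1 by move=> n0; exact/direction_unit/norm1/hu.
have yy0 : dotv (y n) (y n) @[n --> \oo] --> (0 : R).
  have -> : (fun n => dotv (y n) (y n)) =
      (fun n => 2^-1 * 2^-1 * (l2norm (u n - v n) * l2norm (u n - v n))).
    apply/funext => n; rewrite /y dotvZl dotvZr mulrA l2normE -[Num.sqrt _ * Num.sqrt _]expr2.
    by rewrite sqr_sqrtr ?dotv_ge0.
  have -> : 0 = 2^-1 * 2^-1 * (0 * 0) :> R by rewrite !mulr0.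
  by apply: cvgM; [exact: cvg_cst|exact: cvgM].
move=> eps eps0; pose Ev n : set (T n) := [set w | eps <
  `|lambda1 ((Num.sqrt n%:R)^-1 *:
      contract2 (fun s : 4.-tuple 'I_n => G n s w) (u n) (v n)) - lam0|].
rewrite -[X in X @ _]/(fun n => P n (Ev n)).
have eps20 : 0 < eps / 2 by rewrite divr_gt0.
have small e : 0 < e -> \forall n \near \oo, (P n (Ev n) <= e%:E)%E.
  move=> e0; have e20 : 0 < e / 2 by rewrite divr_gt0.
  have Hf := outlier_in_probability hG f1 lam0_gt0 lam0E eps20 e20.
  have Hg := outlier_in_probability hG g1 lam0_gt0 lam0E eps20 e20.
  (* [lambda1_perturb] with [b = 10] then costs at most [eps / 2] *)
  have e40 : 0 < eps / 40 by rewrite divr_gt0.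
  have yn : \forall n \near \oo, dotv (y n) (y n) <= eps / 40.
    move/cvgrPdist_le : yy0 => /(_ _ e40); apply: filterS => n.
    by rewrite sub0r normrN => /(le_trans (ler_norm _)).
  near=> n.
  have n0 : (0 < n)%N by near: n; exists 1%N.
  have Gsym w (s t : 4.-tuple 'I_n) : perm_eq s t -> G n s w = G n t w.
    by have [H _ _] := hG n n0; exact: H.
  have F1 : fails_le (P n) (e / 2) (fun w =>
    `|lambda1 (contraction (G n) (f n) w) - lam0| <= eps / 2 /\
    forall z, `|dotv (z *m contraction (G n) (f n) w) z| <= 10 * dotv z z).
    by near: n; exact: Hf.
  have F2 : fails_le (P n) (e / 2) (fun w =>
    `|lambda1 (contraction (G n) (g n) w) - lam0| <= eps / 2 /\
    forall z, `|dotv (z *m contraction (G n) (g n) w) z| <= 10 * dotv z z).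
    by near: n; exact: Hg.
  have yn' : dotv (y n) (y n) <= eps / 40 by near: n.
  have [E [mE PE EP]] := fails_leI F1 F2.
  have e2E : e / 2 + e / 2 = e by field.
  rewrite e2E in PE; apply: le_trans PE.
  have xy : dotv (x n) (x n) = 1 - dotv (y n) (y n).
    rewrite /x /y !dotvZl !dotvZr !(dotvDl, dotvDr, dotvNl, dotvNr).
    by rewrite !norm1; [field|exact: hv|exact: hu].
  have ctr (h : 'rV[R]_n) w : (contraction (G n) h w)^T = contraction (G n) h w.
    by rewrite /contraction linearZ /= contract2_tr// => s t; exact: Gsym.
  have mEv : measurable (Ev n).
    apply: measurable_lambda1_dist => // [w|i j].
      by rewrite linearZ /= contract2_tr// => s t; exact: Gsym.
    rewrite (_ : (fun w => _) = (fun w => (Num.sqrt n%:R)^-1 *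
      \sum_(k < n) \sum_(l < n) G n [tuple i; j; k; l] w * u n 0 k * v n 0 l)).
      apply: measurable_funM; first exact: measurable_cst.
      apply: measurable_sum => k; apply: measurable_sum => l.
      apply: measurable_funM; last exact: measurable_cst.
      by apply: measurable_funM => //; exact: measurable_cst.
    by apply/funext => w; rewrite !mxE.
  apply: le_measure; rewrite ?inE// => w /= lt; apply: contrapT => /EP[[w1 w2] [w3 w4]].
  move: lt; apply/negP; rewrite -leNgt.
  set A := (X in lambda1 X).
  have AE : A = (1 - dotv (y n) (y n)) *: contraction (G n) (f n) w -
      dotv (y n) (y n) *: contraction (G n) (g n) w.
    rewrite /A uE vE contract2_polar; last by move=> s t; exact: Gsym.
    rewrite (contract2_direction _ (u n) (x n)) (contract2_direction _ (u n) (y n)).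
    by rewrite scalerBr !scalerA -xy ![(Num.sqrt _)^-1 * _]mulrC -!scalerA.
  have pert := lambda1_perturb n0 (ctr _ w) (ctr _ w) (dotv_ge0 (y n)) AE w2 w4.
  apply: (le_trans (ler_distD (lambda1 (contraction (G n) (f n) w)) _ _)).
  apply: (le_trans (lerD pert w1)); move: yn'; clear.
  by move: (dotv _ _) => s; lra.
have fin n e : (P n (Ev n) <= e%:E)%E -> P n (Ev n) \is a fin_num.
  by move=> le; rewrite ge0_fin_numE ?measure_ge0// (le_lt_trans le)// ltry.
apply/fine_cvgP; split; first by apply: filterS (small 1 ltr01) => n; exact: fin.
apply/cvgrPdist_le => e e0; move: (small e e0); apply: filterS => n /= le.
rewrite sub0r normrN ger0_norm ?fine_ge0 ?measure_ge0// -lee_fin fineK//.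
exact: fin le.
Unshelve. all: by end_near. Qed.
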